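(* Fix $1<s<2$ and $\epsilon>0$. Let $0<\delta<1$ and let $E$ be a set of $\delta^{-s}$ balls of radius $\delta$ in $[0,1]^2$ such that every ball of radius $\delta^{s/2}$ contains $\lesssim 1$ balls of $E$. Then the maximal number of pairwise disjoint intervals of length $\delta$ contained in $\Delta(E)$ is at least $c(\epsilon)\,\delta^{-1+\epsilon}$.
   Context: For a set $E$ of $\delta$-balls, $\Delta(E)=\{|x-y| : x,y\in \bigcup E\}$ is the set of Euclidean distances between points of the union of the balls. $\lesssim 1$ means bounded by an absolute constant; $c(\epsilon)>0$ depends only on $\epsilon$ (and $s$). *)

(* Defs.v *)
From Stdlib Require Import Reals List.
Import ListNotations.
Open Scope R_scope.

Definition pt := (R * R)%type.

Definition dist2 (p q : pt) : R :=
  sqrt ((fst p - fst q) ^ 2 + (snd p - snd q) ^ 2).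

Definition in_ball (c : pt) (r : R) (p : pt) : Prop := dist2 p c <= r.

Definition ball_sub (c : pt) (rho : R) (x : pt) (r : R) : Prop :=
  forall p, in_ball c rho p -> in_ball x r p.

(* A family E of delta-balls is represented by the list of its (distinct)
   centres.  Union of the balls: *)
Definition in_union (delta : R) (E : list pt) (p : pt) : Prop :=
  exists c, In c E /\ in_ball c delta p.

Definition DistSet (delta : R) (E : list pt) (t : R) : Prop :=
  exists x y, in_union delta E x /\ in_union delta E y /\ t = dist2 x y.

Definition in_interval (a len t : R) : Prop := a <= t <= a + len.

Definition ball_count_le (delta r C : R) (E : list pt) : Prop :=
  forall (x : pt) (F : list pt),
    NoDup F -> incl F E -> (forall c, In c F -> ball_sub c delta x r) ->
    INR (length F) <= C.

Definition disjoint_intervals_in (S : R -> Prop) (len : R) (I : list R) : Prop :=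
  NoDup I /\
  (forall a, In a I -> forall t, in_interval a len t -> S t) /\
  (forall a b, In a I -> In b I -> a <> b ->
     forall t, in_interval a len t -> in_interval b len t -> False).

(* Main.v *)
Require Import Defs.
From Stdlib Require Import Reals List.
From Stdlib Require Import Lra Lia ZArith Psatz ClassicalEpsilon FinFun.
Import ListNotations.
Open Scope R_scope.

(** Put [W = 16 delta^(-s/2)].  By Cauchy-Schwarz it suffices to show that at
    most [delta^(-eps) W^8 delta] quadruples satisfy [|a - b| = |c - d|] up to
    [delta].  The rigid motions taking [a] to [c] form a line [v - w m] in
    [R^3], with [v = c - a] and [m = J (a + c)], and such a quadruple is a pair
    of lines passing within [delta] of each other; the [W^4] lines are
    [1/W]-separated in the parameters [(v, m)].

    The incidences are counted by a nonnegative kernel in [(v, w)] which is a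
    trigonometric polynomial.  At a frequency [xi] with [|xi| >> K], orthogonality
    in [w] leaves only pairs of lines with [m - m'] in a strip of width [1/K]
    orthogonal to [xi].  Such a strip meets [O(K)] of the [K^2] squares of side
    [1/K], so the energy of all lines is at most [O(K)] times the energy of the
    pairs with [|m - m'| <= 1/K]; the frequencies [|xi| <= K] contribute only
    [O(K^2)] times the expected amount.  Pairs at [|m - m'| ~ rho] become pairs
    at unit slope distance after dilating by [1/rho], which replaces [W] by
    [rho W] and [delta] by [delta/rho], so one can induct on [W].  The diagonal
    is harmless as long as [delta >= K / W^2]; for smaller [delta] the number of
    incidences is simply monotone in [delta].  With [K = delta^(-eps')] the
    induction stops after [O(1/eps')] steps. *)

(** * Finite sums and indicators *)

(** The obstacle is a balance of exponents. In the block estimate the pairs with [|m - m'| <= 1/K]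
    come back with a factor [1/K^2], of which orthogonality consumes one [K] and raising [delta] to
    [K / W^2] the other. An induction step therefore breaks even in [K] and multiplies the bound
    only by a constant times [B^3], where [w] is localised to windows of length about [1/B]. With
    [K = delta^(-1/J)] and [B = delta^(-1/J^2)] the [2 J] steps cost [delta^(-O(1/J))] in all. Two
    devices keep everything finite and exact. Slopes are rounded to a lattice [Z / H], so that the
    frequencies in [w] are integer multiples of [1/H] and integrals over [w] become sums over
    equidistant points, on which orthogonality is exact. The bumps are high powers of the Fejer
    kernel: their spectrum is bounded, nonnegative and flat, and the exponent [M] makes their tails
    smaller than any power of [delta] that occurs. *)

Ltac nonneg :=
  repeat match goal with
  | |- 0 <= _ ^ 2 => apply pow2_ge_0
  | |- 0 <= _ ^ _ => apply pow_le
  | |- 0 <= _ * _ => apply Rmult_le_pos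
  | |- 0 <= _ + _ => apply Rplus_le_le_0_compat
  | |- 0 <= _ => lra
  end.

Definition lsum {A : Type} (l : list A) (f : A -> R) : R :=
  fold_right (fun a s => f a + s) 0 l.

(** Cardinalities are real sums of classical indicators: counting over arbitrary predicates becomes
    linear, and double counting an exchange of sums. *)
Definition ind (P : Prop) : R :=
  if excluded_middle_informative P then 1 else 0.

Lemma ind_true (P : Prop) : P -> ind P = 1.
Proof. intro; unfold ind; destruct (excluded_middle_informative P); tauto. Qed.

Lemma ind_false (P : Prop) : ~ P -> ind P = 0.
Proof. intro; unfold ind; destruct (excluded_middle_informative P); tauto. Qed.

Lemma ind_bound (P : Prop) : 0 <= ind P <= 1.
Proof. unfold ind; destruct (excluded_middle_informative P); lra. Qed.

Lemma ind_imp (P Q : Prop) : (P -> Q) -> ind P <= ind Q.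
Proof.
  intro H; unfold ind.
  destruct (excluded_middle_informative P), (excluded_middle_informative Q);
    try lra; tauto.
Qed.

Lemma ind_iff (P Q : Prop) : (P <-> Q) -> ind P = ind Q.
Proof.
  intro H; apply Rle_antisym; apply ind_imp; tauto.
Qed.

Lemma ind_and (P Q : Prop) : ind (P /\ Q) = ind P * ind Q.
Proof.
  unfold ind.
  destruct (excluded_middle_informative P), (excluded_middle_informative Q),
    (excluded_middle_informative (P /\ Q)); try lra; tauto.
Qed.


Lemma lsum_ext {A : Type} (l : list A) f g :
  (forall a, In a l -> f a = g a) -> lsum l f = lsum l g.
Proof.
  induction l as [|a l IH]; simpl; intros H; [reflexivity|].
  rewrite H, IH; auto.
Qed.

Lemma lsum_le {A : Type} (l : list A) f g :
  (forall a, In a l -> f a <= g a) -> lsum l f <= lsum l g.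
Proof.
  induction l as [|a l IH]; simpl; intros H; [lra|].
  apply Rplus_le_compat; auto.
Qed.

Lemma lsum_zero {A : Type} (l : list A) : lsum l (fun _ => 0) = 0.
Proof. induction l; simpl; lra. Qed.

Lemma lsum_nonneg {A : Type} (l : list A) f :
  (forall a, In a l -> 0 <= f a) -> 0 <= lsum l f.
Proof. intro H; rewrite <- (lsum_zero l); apply lsum_le; auto. Qed.

Lemma lsum_plus {A : Type} (l : list A) f g :
  lsum l (fun a => f a + g a) = lsum l f + lsum l g.
Proof. induction l; simpl; lra. Qed.

Lemma lsum_scal {A : Type} (l : list A) c f : lsum l (fun a => c * f a) = c * lsum l f.
Proof. induction l as [|a l IH]; simpl; [|rewrite IH]; ring. Qed.

Lemma lsum_scal_r {A : Type} (l : list A) c f : lsum l (fun a => f a * c) = lsum l f * c.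
Proof. induction l as [|a l IH]; simpl; [|rewrite IH]; ring. Qed.

Lemma lsum_const {A : Type} (l : list A) c : lsum l (fun _ => c) = INR (length l) * c.
Proof.
  induction l as [|a l IH]; [simpl; ring|].
  change (length (a :: l)) with (S (length l)); rewrite S_INR.
  simpl; rewrite IH; ring.
Qed.

Lemma lsum_app {A : Type} (l l' : list A) f : lsum (l ++ l') f = lsum l f + lsum l' f.
Proof. induction l; simpl; lra. Qed.

Lemma lsum_map {A B : Type} (h : A -> B) l f : lsum (map h l) f = lsum l (fun a => f (h a)).
Proof. induction l as [|a l IH]; simpl; [|rewrite IH]; reflexivity. Qed.

Lemma lsum_flat_map {A B : Type} (h : A -> list B) l f :
  lsum (flat_map h l) f = lsum l (fun a => lsum (h a) f).
Proof.
  induction l as [|a l IH]; simpl; [reflexivity|].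
  rewrite lsum_app, IH; reflexivity.
Qed.

Lemma lsum_exchange {A B : Type} (l : list A) (l' : list B) f :
  lsum l (fun a => lsum l' (f a)) = lsum l' (fun b => lsum l (fun a => f a b)).
Proof.
  induction l as [|a l IH]; simpl.
  - symmetry; apply lsum_zero.
  - rewrite IH, <- lsum_plus; reflexivity.
Qed.

Lemma lsum_prod {A B : Type} (l : list A) (l' : list B) f :
  lsum (list_prod l l') f = lsum l (fun a => lsum l' (fun b => f (a, b))).
Proof.
  induction l as [|a l IH]; simpl; [reflexivity|].
  rewrite lsum_app, lsum_map, IH; reflexivity.
Qed.

Lemma lsum_filter {A : Type} (p : A -> bool) l f :
  lsum (filter p l) f = lsum l (fun a => if p a then f a else 0).
Proof.
  induction l as [|a l IH]; simpl; [reflexivity|].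
  destruct (p a); simpl; rewrite IH; ring.
Qed.

Lemma lsum_ge_term {A : Type} (l : list A) f a :
  (forall b, In b l -> 0 <= f b) -> In a l -> f a <= lsum l f.
Proof.
  induction l as [|b l IH]; simpl; intros H Ha; [tauto|].
  assert (0 <= lsum l f) by (apply lsum_nonneg; auto).
  assert (0 <= f b) by auto.
  destruct Ha as [->|Ha]; [lra|].
  specialize (IH (fun b Hb => H b (or_intror Hb)) Ha); lra.
Qed.

Lemma lsum_mul {A B : Type} (l : list A) (l' : list B) f g :
  lsum l f * lsum l' g = lsum l (fun a => lsum l' (fun b => f a * g b)).
Proof.
  rewrite <- lsum_scal_r; apply lsum_ext; intros; rewrite lsum_scal; reflexivity.
Qed.

Lemma lsum_exists_ge {A : Type} (l : list A) f c :
  INR (length l) * c < lsum l f -> exists a, In a l /\ c < f a.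
Proof.
  intro H.
  destruct (excluded_middle_informative (exists a, In a l /\ c < f a)) as [|N]; [assumption|].
  exfalso; apply (Rlt_not_le _ _ H).
  rewrite <- lsum_const; apply lsum_le; intros a Ha.
  apply Rnot_lt_le; intro; apply N; eauto.
Qed.

Lemma lsum_cauchy {A : Type} (l : list A) f :
  (lsum l f) ^ 2 <= INR (length l) * lsum l (fun a => f a ^ 2).
Proof.
  (* [2 f(a) f(b) <= f(a)^2 + f(b)^2], summed over all pairs. *)
  assert (H : lsum l (fun a => lsum l (fun b => f a * f b)) <=
              lsum l (fun a => lsum l (fun b => f a ^ 2 / 2 + f b ^ 2 / 2))).
  { apply lsum_le; intros a _; apply lsum_le; intros b _.
    pose proof (pow2_ge_0 (f a - f b)); lra. }
  replace ((lsum l f) ^ 2) with (lsum l f * lsum l f) by ring.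
  rewrite lsum_mul; eapply Rle_trans; [exact H|].
  right.
  rewrite (lsum_ext l _ (fun a => INR (length l) * (f a ^ 2 / 2) +
       lsum l (fun b => f b ^ 2 / 2))).
  2: { intros a _; rewrite lsum_plus, lsum_const; reflexivity. }
  rewrite lsum_plus, lsum_const, lsum_scal.
  unfold Rdiv; rewrite lsum_scal_r; field.
Qed.


Lemma lsum_ind_eq {A : Type} (l : list A) (a : A) (f : A -> R) :
  NoDup l -> In a l -> lsum l (fun c => ind (a = c) * f c) = f a.
Proof.
  induction l as [|b l IH]; simpl; [tauto|].
  intros ND Ha; inversion ND as [|? ? Nb ND']; subst.
  destruct Ha as [->|Ha].
  - rewrite ind_true by reflexivity.
    rewrite (lsum_ext l _ (fun _ => 0)), lsum_zero; [ring|].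
    intros c Hc; rewrite ind_false; [ring|]; intros ->; tauto.
  - rewrite IH by assumption; rewrite ind_false; [ring|].
    intros ->; tauto.
Qed.

(** Each element is counted once, at its own label. Blocks, cells and distance bins all enter
    through this identity. *)
Lemma lsum_label {A C : Type} (l : list A) (labs : list C) (lab : A -> C) f :
  NoDup labs -> (forall a, In a l -> In (lab a) labs) ->
  lsum l f = lsum labs (fun c => lsum l (fun a => ind (lab a = c) * f a)).
Proof.
  intros ND H; rewrite lsum_exchange; apply lsum_ext; intros a Ha.
  symmetry; apply (lsum_ind_eq labs (lab a) (fun _ => f a)); auto.
Qed.

(** * Integer points in intervals *)

Definition zr (a : Z) (n : nat) : list Z :=
  map (fun i => (a + Z.of_nat i)%Z) (seq 0 n).

Lemma zr_S a n : zr a (S n) = zr a n ++ [(a + Z.of_nat n)%Z].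
Proof. unfold zr; rewrite seq_S, map_app; reflexivity. Qed.

Lemma In_zr a n t : In t (zr a n) <-> (a <= t < a + Z.of_nat n)%Z.
Proof.
  unfold zr; rewrite in_map_iff; split.
  - intros [i [<- Hi]]; apply in_seq in Hi; lia.
  - intro H; exists (Z.to_nat (t - a)); split; [lia|]; apply in_seq; lia.
Qed.

Lemma NoDup_zr a n : NoDup (zr a n).
Proof.
  apply Injective_map_NoDup; [|apply seq_NoDup].
  intros x y; lia.
Qed.

Lemma length_zr a n : length (zr a n) = n.
Proof. unfold zr; rewrite length_map, length_seq; reflexivity. Qed.

Lemma zr_count_le a n (lo hi : R) :
  lo <= hi + 1 ->
  lsum (zr a n) (fun t => ind (lo <= IZR t <= hi)) <= hi - lo + 1.
Proof.
  intro Hlh.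
  (* The bound is clipped at the last point of the range; otherwise the induction on [n] could gain
     1 at each step. *)
  enough (lsum (zr a n) (fun t => ind (lo <= IZR t <= hi)) <=
          Rmax 0 (Rmin hi (IZR (a + Z.of_nat n) - 1) - lo + 1)) as E.
  { eapply Rle_trans; [exact E|]; apply Rmax_lub; [lra|].
    pose proof (Rmin_l hi (IZR (a + Z.of_nat n) - 1)); lra. }
  induction n as [|n IH]; [simpl; apply Rmax_l|].
  rewrite zr_S, lsum_app; simpl lsum at 2.
  replace (IZR (a + Z.of_nat (S n)) - 1) with (IZR (a + Z.of_nat n))
    by (rewrite Nat2Z.inj_succ, <- Z.add_1_r, !plus_IZR; ring).
  set (t := IZR (a + Z.of_nat n)) in *.
  unfold ind at 2; destruct (excluded_middle_informative (lo <= t <= hi)) as [[H1 H2]|N].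
  - revert IH; unfold Rmax, Rmin; repeat destruct Rle_dec; lra.
  - revert IH; unfold Rmax, Rmin; repeat destruct Rle_dec; lra.
Qed.

Lemma zr_count_ge a n (lo hi : R) :
  IZR a <= lo -> hi <= IZR (a + Z.of_nat n) ->
  hi - lo - 1 <= lsum (zr a n) (fun t => ind (lo <= IZR t <= hi)).
Proof.
  intros Hlo Hhi.
  enough (Rmin (hi - 1) (IZR (a + Z.of_nat n) - 1) - lo <=
      lsum (zr a n) (fun t => ind (lo <= IZR t <= hi))) as E.
  { rewrite Rmin_left in E; lra. }
  clear Hhi.
  induction n as [|n IH].
  - simpl; rewrite Z.add_0_r; pose proof (Rmin_r (hi - 1) (IZR a - 1)); lra.
  - rewrite zr_S, lsum_app; simpl lsum at 2.
    replace (IZR (a + Z.of_nat (S n)) - 1) with (IZR (a + Z.of_nat n))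
      by (rewrite Nat2Z.inj_succ, <- Z.add_1_r, !plus_IZR; ring).
    set (t := IZR (a + Z.of_nat n)) in *.
    pose proof (lsum_nonneg (zr a n) (fun t => ind (lo <= IZR t <= hi))
       (fun b _ => proj1 (ind_bound _))) as P.
    unfold ind at 2; destruct (excluded_middle_informative (lo <= t <= hi)) as [[H1 H2]|N];
    revert IH; unfold Rmin; repeat destruct Rle_dec; lra.
Qed.

Lemma floor_bounds (x : R) : IZR (Int_part x) <= x < IZR (Int_part x) + 1.
Proof. destruct (base_Int_part x); lra. Qed.

Lemma NoDup_list_prod {A C : Type} (l : list A) (l' : list C) :
  NoDup l -> NoDup l' -> NoDup (list_prod l l').
Proof.
  intros H H'; induction H as [|a l Ha H IH]; simpl; [constructor|].
  apply NoDup_app; [| assumption |].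
  - apply Injective_map_NoDup; [|assumption]; intros x y E; congruence.
  - intros [x y] H1 H2; apply in_map_iff in H1; destruct H1 as [z [E _]].
    apply in_prod_iff in H2; inversion E; subst; tauto.
Qed.

(** * Nonnegative trigonometric polynomials *)

(** A pair [(c, k)] stands for the term [c cos(k x)]. A frequency may be listed several times, so
    products are plain list operations. *)
Definition tpoly := list (R * Z).

Definition ev (l : tpoly) (x : R) : R :=
  lsum l (fun e => fst e * cos (IZR (snd e) * x)).

(** The coefficients form a probability measure on the frequencies [|k| <= d], with no atom heavier
    than [beta]. The last bound is what limits the weight of the low frequencies. *)
Definition tp_good (l : tpoly) (d : nat) (beta : R) : Prop :=
  (forall e, In e l -> 0 <= fst e) /\
  lsum l fst = 1 /\
  (forall e, In e l -> (Z.abs (snd e) <= Z.of_nat d)%Z) /\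
  (forall k, lsum l (fun e => fst e * ind (snd e = k)) <= beta).

Definition tmul (l l' : tpoly) : tpoly :=
  flat_map (fun p : (R * Z) * (R * Z) =>
    [(fst (fst p) * fst (snd p) / 2, (snd (fst p) + snd (snd p))%Z);
     (fst (fst p) * fst (snd p) / 2, (snd (fst p) - snd (snd p))%Z)])
    (list_prod l l').

Fixpoint tpow (l : tpoly) (M : nat) : tpoly :=
  match M with
  | O => [(1, 0%Z)]
  | S M => tmul l (tpow l M)
  end.

Lemma cos_mul (a b : R) : cos a * cos b = (cos (a + b) + cos (a - b)) / 2.
Proof. rewrite cos_plus, cos_minus; field. Qed.

Lemma ev_tmul l l' x : ev (tmul l l') x = ev l x * ev l' x.
Proof.
  unfold ev, tmul; rewrite lsum_flat_map, lsum_prod, lsum_mul.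
  apply lsum_ext; intros [c k] _; apply lsum_ext; intros [c' k'] _; simpl.
  rewrite plus_IZR, minus_IZR, Rmult_plus_distr_r, Rmult_minus_distr_r.
  replace (c * cos (IZR k * x) * (c' * cos (IZR k' * x)))
    with (c * c' * (cos (IZR k * x) * cos (IZR k' * x))) by ring.
  rewrite cos_mul; field.
Qed.

Lemma ev_tpow l M x : ev (tpow l M) x = ev l x ^ M.
Proof.
  induction M as [|M IH]; simpl.
  - unfold ev; simpl; rewrite Rmult_0_l, cos_0; ring.
  - rewrite ev_tmul, IH; reflexivity.
Qed.

(** Frequencies are convolved, and averaging translates of the first measure against a probability
    measure cannot create a heavier atom; hence [b] survives. *)
Lemma tmul_good l d b l' d' b' :
  tp_good l d b -> tp_good l' d' b' -> tp_good (tmul l l') (d + d') b.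
Proof.
  intros (N1 & S1 & D1 & B1) (N2 & S2 & D2 & B2); repeat split.
  - intros e He; apply in_flat_map in He; destruct He as [[e1 e2] [H1 H2]].
    apply in_prod_iff in H1; destruct H1 as [I1 I2]; specialize (N1 _ I1); specialize (N2 _ I2).
    assert (0 <= fst e1 * fst e2) by (apply Rmult_le_pos; assumption).
    simpl in H2; destruct H2 as [<-|[<-|[]]]; simpl; lra.
  - unfold tmul; rewrite lsum_flat_map, lsum_prod.
    transitivity (lsum l fst * lsum l' fst); [|rewrite S1, S2; ring].
    rewrite lsum_mul; apply lsum_ext; intros; apply lsum_ext; intros; simpl; field.
  - intros e He; apply in_flat_map in He; destruct He as [[e1 e2] [H1 H2]].
    apply in_prod_iff in H1; destruct H1 as [I1 I2]; specialize (D1 _ I1); specialize (D2 _ I2).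
    simpl in H2; destruct H2 as [<-|[<-|[]]]; simpl; lia.
  - intro k; unfold tmul; rewrite lsum_flat_map, lsum_prod, lsum_exchange.
    rewrite (lsum_ext l' _ (fun e' => fst e' / 2 *
       (lsum l (fun e => fst e * ind (snd e = (k - snd e')%Z)) +
        lsum l (fun e => fst e * ind (snd e = (k + snd e')%Z))))).
    2: { intros [c' k'] _; rewrite <- lsum_plus, <- lsum_scal.
         apply lsum_ext; intros [c k0] _; simpl.
         rewrite (ind_iff (k0 + k' = k)%Z (k0 = k - k')%Z) by lia.
         rewrite (ind_iff (k0 - k' = k)%Z (k0 = k + k')%Z) by lia.
         field. }
    apply Rle_trans with (lsum l' (fun e' => fst e' * b)).
    + apply lsum_le; intros e' He'; specialize (N2 _ He').
      pose proof (B1 (k - snd e')%Z); pose proof (B1 (k + snd e')%Z); nra.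
    + rewrite lsum_scal_r, S2; lra.
Qed.

(** Stated from the first power on: the power 0 is the constant 1, whose spectrum is a single atom
    of weight 1. *)
Lemma tpow_good l d b M :
  tp_good l d b -> tp_good (tpow l (S M)) (S M * d) b.
Proof.
  intro G; induction M as [|M IH].
  - change (tpow l 1) with (tmul l [(1, 0%Z)]).
    replace (1 * d)%nat with (d + 0)%nat by lia.
    apply tmul_good with (b' := 1); [assumption|].
    repeat split.
    + intros e [<-|[]]; simpl; lra.
    + simpl; ring.
    + intros e [<-|[]]; simpl; lia.
    + intro k; simpl; pose proof (ind_bound (0%Z = k)); lra.
  - change (tpow l (S (S M))) with (tmul l (tpow l (S M))).
    replace (S (S M) * d)%nat with (d + S M * d)%nat by lia.
    eapply tmul_good; eassumption.
Qed.

(** The normalised square [|sum over a < n of exp(i a x)|^2 / n^2], written out over all differences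
    of frequencies. *)
Definition fejer (n : nat) : tpoly :=
  map (fun p : Z * Z => (/ INR n ^ 2, (fst p - snd p)%Z)) (list_prod (zr 0 n) (zr 0 n)).

Lemma fejer_good n : (0 < n)%nat -> tp_good (fejer n) n (/ INR n).
Proof.
  intro Hn; assert (Hn' : 0 < INR n) by (apply lt_0_INR; lia).
  repeat split.
  - intros e He; apply in_map_iff in He; destruct He as [[a b] [<- _]]; simpl.
    left; apply Rinv_0_lt_compat; nra.
  - unfold fejer; rewrite lsum_map, lsum_prod; simpl.
    rewrite lsum_const, lsum_const, length_zr; field; lra.
  - intros e He; apply in_map_iff in He; destruct He as [[a b] [<- H]]; simpl.
    apply in_prod_iff in H; rewrite !In_zr in H; lia.
  - intro k; unfold fejer; rewrite lsum_map, lsum_prod; cbn [fst snd].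
    (* For each [a] at most one [b] has [a - b = k], so [k] is hit at most [n] times with weight
       [1 / n^2]. *)
    apply Rle_trans with (lsum (zr 0 n) (fun _ : Z => / INR n ^ 2)).
    + apply lsum_le; intros a _; rewrite lsum_scal.
      rewrite <- (Rmult_1_r (/ INR n ^ 2)) at 2.
      apply Rmult_le_compat_l; [left; apply Rinv_0_lt_compat; nra|].
      apply Rle_trans with
        (lsum (zr 0 n) (fun t => ind (IZR (a - k) <= IZR t <= IZR (a - k)))).
      * apply lsum_le; intros b _; apply ind_imp; intro E.
        replace (a - k)%Z with b by lia; lra.
      * eapply Rle_trans; [apply zr_count_le|]; lra.
    + rewrite lsum_const, length_zr; right; field; lra.
Qed.

Lemma ev_fejer n x :
  ev (fejer n) x = ((lsum (zr 0 n) (fun a => cos (IZR a * x))) ^ 2 +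
                    (lsum (zr 0 n) (fun a => sin (IZR a * x))) ^ 2) / INR n ^ 2.
Proof.
  unfold ev, fejer; rewrite lsum_map, lsum_prod; cbn [fst snd].
  unfold Rdiv; simpl pow at 2 3; rewrite !Rmult_1_r, !lsum_mul, <- lsum_plus, <- lsum_scal_r.
  apply lsum_ext; intros a _.
  rewrite <- lsum_plus, <- lsum_scal_r; apply lsum_ext; intros b _.
  rewrite minus_IZR, Rmult_minus_distr_r, cos_minus; ring.
Qed.

Lemma ev_fejer_bound n x : (0 < n)%nat -> 0 <= ev (fejer n) x <= 1.
Proof.
  intro Hn; assert (Hn' : 0 < INR n) by (apply lt_0_INR; lia).
  split.
  - rewrite ev_fejer; apply Rmult_le_pos; [nra|left; apply Rinv_0_lt_compat; nra].
  - destruct (fejer_good n Hn) as (N & S & _).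
    rewrite <- S; unfold ev; apply lsum_le; intros e He.
    specialize (N e He); pose proof (COS_bound (IZR (snd e) * x)); nra.
Qed.

Lemma cos_ge_half x : Rabs x <= 1 -> 1 / 2 <= cos x.
Proof.
  intro H; rewrite <- cos_PI3.
  pose proof PI_RGT_0; pose proof PI_4; pose proof PI2_3_2.
  assert (cos (Rabs x) = cos x) as <-
    by (unfold Rabs; destruct Rcase_abs; [apply cos_neg|reflexivity]).
  pose proof (Rabs_pos x).
  apply cos_decr_1; try lra.
Qed.

(** All phases [a x] stay in [[-1, 1]], where the cosine is at least [1/2]; the real part alone
    gives [(n/2)^2 / n^2]. *)
Lemma ev_fejer_lower n x :
  (0 < n)%nat -> INR n * Rabs x <= 1 -> 1 / 4 <= ev (fejer n) x.
Proof.
  intros Hn Hx; assert (Hn' : 0 < INR n) by (apply lt_0_INR; lia).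
  rewrite ev_fejer.
  assert (INR n * (1 / 2) <= lsum (zr 0 n) (fun a => cos (IZR a * x))) as C.
  { rewrite <- (length_zr 0 n) at 1; rewrite <- lsum_const.
    apply lsum_le; intros a Ha; apply cos_ge_half.
    apply In_zr in Ha; rewrite Rabs_mult.
    apply Rle_trans with (INR n * Rabs x); [|assumption].
    apply Rmult_le_compat_r; [apply Rabs_pos|].
    rewrite <- abs_IZR, INR_IZR_INZ; apply IZR_le; lia. }
  apply Rmult_le_reg_r with (INR n ^ 2); [nra|].
  unfold Rdiv at 2; rewrite Rmult_assoc, Rinv_l by nra; nra.
Qed.

(** A weak form of Jordan's inequality. Up to 1 the cubic Taylor polynomial gives slope [5/6];
    beyond 1 monotonicity gives at least [5/6], while [2/5 y <= 4/5] because [PI / 2 <= 2]. *)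
Lemma sin_ge_linear y : 0 <= y <= PI / 2 -> 2 / 5 * y <= sin y.
Proof.
  intros [H0 H1]; pose proof PI_4; pose proof PI2_3_2.
  assert (L : forall z, 0 <= z <= 1 -> 5 / 6 * z <= sin z).
  { intros z Hz; destruct (Req_dec z 0) as [->|Nz]; [rewrite sin_0; lra|].
    destruct (sin_bound z 0) as [Hb _]; [lra|lra|].
    unfold sin_approx, sin_term in Hb; simpl in Hb.
    eapply Rle_trans; [|exact Hb]; field_simplify; nra. }
  destruct (Rle_lt_dec y 1) as [Hy|Hy].
  - specialize (L y (conj H0 Hy)); lra.
  - specialize (L 1 ltac:(lra)).
    assert (sin 1 < sin y) by (apply sin_increasing_1; lra). lra.
Qed.

(** Multiplication by [2 sin(x/2)] makes the sum telescope; likewise for the sines. *)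
Lemma geom_cos_sum n x :
  2 * sin (x / 2) * lsum (zr 0 n) (fun a => cos (IZR a * x)) =
  sin ((INR n - 1 / 2) * x) + sin (x / 2).
Proof.
  induction n as [|n IH].
  - simpl; replace ((0 - 1 / 2) * x) with (- (x / 2)) by field; rewrite sin_neg; ring.
  - rewrite zr_S, lsum_app, Rmult_plus_distr_l, IH.
    unfold lsum at 1; cbn [fold_right]; rewrite Z.add_0_l, <- INR_IZR_INZ, S_INR, Rplus_0_r.
    replace ((INR n - 1 / 2) * x) with (INR n * x - x / 2) by field.
    replace ((INR n + 1 - 1 / 2) * x) with (INR n * x + x / 2) by field.
    rewrite sin_plus, sin_minus; ring.
Qed.

Lemma geom_sin_sum n x :
  2 * sin (x / 2) * lsum (zr 0 n) (fun a => sin (IZR a * x)) =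
  cos (x / 2) - cos ((INR n - 1 / 2) * x).
Proof.
  induction n as [|n IH].
  - simpl; replace ((0 - 1 / 2) * x) with (- (x / 2)) by field; rewrite cos_neg; ring.
  - rewrite zr_S, lsum_app, Rmult_plus_distr_l, IH.
    unfold lsum at 1; cbn [fold_right]; rewrite Z.add_0_l, <- INR_IZR_INZ, S_INR, Rplus_0_r.
    replace ((INR n - 1 / 2) * x) with (INR n * x - x / 2) by field.
    replace ((INR n + 1 - 1 / 2) * x) with (INR n * x + x / 2) by field.
    rewrite cos_plus, cos_minus; ring.
Qed.

(** The two closed forms bound [(2 sin(x/2))^2] times the squared modulus by [4 + 4], and
    [|sin(x/2)| >= |x| / 5]; the constant is [8 * 25 / 4]. *)
Lemma ev_fejer_tail n x :
  (0 < n)%nat -> x <> 0 -> Rabs x <= PI ->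
  ev (fejer n) x <= 50 / (INR n * Rabs x) ^ 2.
Proof.
  intros Hn Hx Hpi; assert (Hn' : 0 < INR n) by (apply lt_0_INR; lia).
  assert (Ax : 0 < Rabs x) by (apply Rabs_pos_lt; assumption).
  assert (Hs : (Rabs x / 5) ^ 2 <= sin (x / 2) ^ 2).
  { assert (sin (x / 2) ^ 2 = sin (Rabs x / 2) ^ 2) as ->.
    { unfold Rabs; destruct Rcase_abs; [|reflexivity].
      replace (- x / 2) with (- (x / 2)) by field; rewrite sin_neg; ring. }
    apply pow_incr; split; [lra|].
    pose proof (sin_ge_linear (Rabs x / 2)); lra. }
  pose proof (geom_cos_sum n x) as GC; pose proof (geom_sin_sum n x) as GS.
  rewrite ev_fejer.
  set (c := lsum (zr 0 n) (fun a => cos (IZR a * x))) in *.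
  set (s := lsum (zr 0 n) (fun a => sin (IZR a * x))) in *.
  pose proof (SIN_bound ((INR n - 1 / 2) * x)); pose proof (SIN_bound (x / 2)).
  pose proof (COS_bound ((INR n - 1 / 2) * x)); pose proof (COS_bound (x / 2)).
  assert (E : (2 * sin (x / 2)) ^ 2 * (c ^ 2 + s ^ 2) <= 8).
  { replace ((2 * sin (x / 2)) ^ 2 * (c ^ 2 + s ^ 2)) with
      ((2 * sin (x / 2) * c) ^ 2 + (2 * sin (x / 2) * s) ^ 2) by ring.
    rewrite GC, GS; nra. }
  assert (F : Rabs x ^ 2 * (c ^ 2 + s ^ 2) <= 50) by nra.
  apply Rmult_le_reg_r with ((INR n * Rabs x) ^ 2); [apply pow_lt; nra|].
  replace (50 / (INR n * Rabs x) ^ 2 * (INR n * Rabs x) ^ 2) with 50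
    by (field; split; lra).
  replace ((c ^ 2 + s ^ 2) / INR n ^ 2 * (INR n * Rabs x) ^ 2)
    with (Rabs x ^ 2 * (c ^ 2 + s ^ 2)) by (field; lra).
  exact F.
Qed.

(** * Exact orthogonality on an equidistant net *)

(** For [0 <= j < P] these are [P] equidistant points of [[-PI, PI)], a full period. *)
Definition net (P : nat) (j : Z) : R := 2 * PI * IZR j / INR P - PI.

(** A nontrivial character sums to zero over the [P]-th roots of unity. Nontriviality is
    [0 < |h| < PI], so that the factor [2 sin h] of the telescoping sum does not vanish. *)
Lemma net_cos_sum P q b :
  (0 < P)%nat -> q <> 0%Z -> (Z.abs q < Z.of_nat P)%Z ->
  lsum (zr 0 P) (fun j => cos (b - IZR q * net P j)) = 0.
Proof.
  intros HP Hq Hqp; assert (HP' : 0 < INR P) by (apply lt_0_INR; lia).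
  set (h := PI * IZR q / INR P).
  set (c := b + IZR q * PI).
  assert (Hs : sin h <> 0).
  { pose proof PI_RGT_0 as Hpi.
    assert (Hlt : Rabs h < PI).
    { unfold h, Rdiv; rewrite !Rabs_mult, (Rabs_pos_eq PI), (Rabs_pos_eq (/ INR P)), Rmult_assoc;
        [|left; apply Rinv_0_lt_compat; lra|lra].
      rewrite <- (Rmult_1_r PI) at 2; apply Rmult_lt_compat_l; [lra|].
      apply Rmult_lt_reg_r with (INR P); [lra|].
      rewrite Rmult_assoc, Rinv_l, Rmult_1_r, Rmult_1_l by lra.
      rewrite <- abs_IZR, INR_IZR_INZ; apply IZR_lt; lia. }
    assert (Hne : h <> 0).
    { unfold h, Rdiv; apply Rmult_integral_contrapositive_currified.
      - apply Rmult_integral_contrapositive_currified; [lra|apply not_0_IZR; assumption].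
      - apply Rinv_neq_0_compat; lra. }
    destruct (Rtotal_order h 0) as [Hh|[Hh|Hh]]; [|tauto|].
    - rewrite Rabs_left in Hlt by assumption.
      assert (0 < sin (- h)) by (apply sin_gt_0; lra).
      rewrite sin_neg in *; lra.
    - rewrite Rabs_right in Hlt by lra.
      assert (0 < sin h) by (apply sin_gt_0; lra); lra. }
  assert (Tel : forall n, 2 * sin h *
     lsum (zr 0 n) (fun j => cos (c - 2 * h * IZR j)) =
     sin (c + h) - sin (c - (2 * INR n - 1) * h)).
  { induction n as [|n IH].
    - simpl; replace (c - (2 * 0 - 1) * h) with (c + h) by ring; ring.
    - rewrite zr_S, lsum_app, Rmult_plus_distr_l, IH.
      unfold lsum at 1; cbn [fold_right]; rewrite Z.add_0_l, <- INR_IZR_INZ, S_INR, Rplus_0_r.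
      replace (c - (2 * INR n - 1) * h) with ((c - 2 * h * INR n) + h) by ring.
      replace (c - (2 * (INR n + 1) - 1) * h) with ((c - 2 * h * INR n) - h) by ring.
      rewrite (sin_plus (c - 2 * h * INR n)), (sin_minus (c - 2 * h * INR n)); ring. }
  rewrite (lsum_ext _ _ (fun j => cos (c - 2 * h * IZR j))).
  2: { intros j _; f_equal; unfold c, h, net; field; lra. }
  specialize (Tel P).
  assert (Z0 : sin (c + h) - sin (c - (2 * INR P - 1) * h) = 0).
  { replace (c - (2 * INR P - 1) * h) with ((c + h) - 2 * INR P * h) by ring.
    replace (2 * INR P * h) with (2 * IZR q * PI) by (unfold h; field; lra).
    assert (Per : forall y (k : nat), sin (y - 2 * INR k * PI) = sin y).
    { intros y k; rewrite <- (sin_period (y - 2 * INR k * PI) k); f_equal; ring. }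
    destruct (Z_le_gt_dec 0 q) as [H|H].
    - rewrite <- (Z2Nat.id q), <- INR_IZR_INZ, Per by lia; ring.
    - replace (IZR q) with (- INR (Z.to_nat (- q)))
        by (rewrite INR_IZR_INZ, Z2Nat.id, opp_IZR by lia; ring).
      replace (c + h - 2 * - INR (Z.to_nat (- q)) * PI)
        with (c + h + 2 * INR (Z.to_nat (- q)) * PI) by ring.
      rewrite sin_period; ring. }
  rewrite Z0 in Tel.
  apply Rmult_integral in Tel; destruct Tel as [Tel|Tel]; [lra|exact Tel].
Qed.

(** The product has frequencies [kappa + k] and [kappa - k] with [|k| <= d]: the first bound on
    [kappa] excludes frequency 0, the second excludes aliasing modulo [P]. *)
Lemma net_orthogonal l d b P kappa alpha :
  tp_good l d b -> (0 < P)%nat ->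
  (Z.of_nat d < Z.abs kappa)%Z -> (Z.abs kappa + Z.of_nat d < Z.of_nat P)%Z ->
  lsum (zr 0 P) (fun j => ev l (net P j) * cos (alpha - IZR kappa * net P j)) = 0.
Proof.
  intros (_ & _ & D & _) HP H1 H2.
  rewrite (lsum_ext _ _ (fun j => lsum l (fun e =>
     fst e / 2 * (cos (alpha - IZR (kappa - snd e) * net P j) +
                  cos (alpha - IZR (kappa + snd e) * net P j))))).
  2: { intros j _; unfold ev; rewrite <- lsum_scal_r; apply lsum_ext; intros [c k] _; simpl.
       rewrite Rmult_assoc, cos_mul, minus_IZR, plus_IZR.
       replace (IZR k * net P j + (alpha - IZR kappa * net P j))
         with (alpha - (IZR kappa - IZR k) * net P j) by ring.
       replace (IZR k * net P j - (alpha - IZR kappa * net P j))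
         with (- (alpha - (IZR kappa + IZR k) * net P j)) by ring.
       rewrite cos_neg; field. }
  rewrite lsum_exchange, (lsum_ext l _ (fun _ => 0)); [apply lsum_zero|].
  intros e He; specialize (D e He).
  rewrite lsum_scal, lsum_plus, !net_cos_sum by (lia || assumption); ring.
Qed.

(** * Almost orthogonality of blocks *)

(** [C p] and [S p] are the real and imaginary parts of a vector attached to [p]; the left side sums
    the squared norms of the block vectors. For nonnegative weights [g] this exhibits the energy of
    equal-label pairs as nonnegative. *)
Lemma block_gram {A I Lb : Type} (L : list A) (J : list I) (g : I -> R)
    (C S : A -> I -> R) (labs : list Lb) (lab : A -> Lb) :
  NoDup labs -> (forall p, In p L -> In (lab p) labs) ->
  lsum labs (fun c => lsum J (fun j => g j *
     ((lsum L (fun p => ind (lab p = c) * C p j)) ^ 2 +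
      (lsum L (fun p => ind (lab p = c) * S p j)) ^ 2))) =
  lsum L (fun p => lsum L (fun q => ind (lab p = lab q) *
     lsum J (fun j => g j * (C p j * C q j + S p j * S q j)))).
Proof.
  intros ND Hlab.
  rewrite (lsum_ext labs _ (fun c => lsum L (fun p => lsum L (fun q =>
     ind (lab p = c) * (ind (lab q = c) *
        lsum J (fun j => g j * (C p j * C q j + S p j * S q j))))))).
  2: { intros c _.
    rewrite (lsum_ext J _ (fun j => lsum L (fun p => lsum L (fun q =>
       ind (lab p = c) * (ind (lab q = c) * (g j * (C p j * C q j + S p j * S q j))))))).
    2: { intros j _.
         replace ((lsum L (fun p => ind (lab p = c) * C p j)) ^ 2) with
           (lsum L (fun p => ind (lab p = c) * C p j) * lsum L (fun p => ind (lab p = c) * C p j)) by ring.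
         replace ((lsum L (fun p => ind (lab p = c) * S p j)) ^ 2) with
           (lsum L (fun p => ind (lab p = c) * S p j) * lsum L (fun p => ind (lab p = c) * S p j)) by ring.
         rewrite !lsum_mul, <- lsum_plus, <- lsum_scal.
         apply lsum_ext; intros p _; rewrite <- lsum_plus, <- lsum_scal.
         apply lsum_ext; intros q _; ring. }
    rewrite lsum_exchange; apply lsum_ext; intros p _.
    rewrite lsum_exchange; apply lsum_ext; intros q _.
    rewrite !lsum_scal; reflexivity. }
  rewrite lsum_exchange; apply lsum_ext; intros p Hp.
  rewrite lsum_exchange; apply lsum_ext; intros q Hq.
  set (kap := lsum J _).
  rewrite (lsum_ind_eq labs (lab p) (fun c => ind (lab q = c) * kap)) by auto.
  f_equal; apply ind_iff; split; congruence.
Qed.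

(** Schur's test for the block vectors: nonadjacent blocks are orthogonal, an adjacent pair
    contributes at most the mean of its two squared norms, and each block has at most [Deg]
    neighbours. *)
Lemma block_orthogonality {A I Lb : Type} (L : list A) (J : list I) (g : I -> R)
    (C S : A -> I -> R) (labs : list Lb) (lab : A -> Lb)
    (adj : Lb -> Lb -> Prop) (Deg : R) :
  (forall j, In j J -> 0 <= g j) ->
  NoDup labs -> (forall p, In p L -> In (lab p) labs) ->
  (forall c c', adj c c' -> adj c' c) ->
  (forall c, In c labs -> lsum labs (fun c' => ind (adj c c')) <= Deg) ->
  (forall p q, In p L -> In q L -> ~ adj (lab p) (lab q) ->
     lsum J (fun j => g j * (C p j * C q j + S p j * S q j)) = 0) ->
  lsum L (fun p => lsum L (fun q => lsum J (fun j => g j * (C p j * C q j + S p j * S q j)))) <=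
  Deg * lsum L (fun p => lsum L (fun q => ind (lab p = lab q) *
     lsum J (fun j => g j * (C p j * C q j + S p j * S q j)))).
Proof.
  intros Hg ND Hlab Hsym Hdeg Hvan.
  rewrite <- (block_gram L J g C S labs lab ND Hlab).
  set (F := fun c j => lsum L (fun p => ind (lab p = c) * C p j)).
  set (G := fun c j => lsum L (fun p => ind (lab p = c) * S p j)).
  set (D := fun c => lsum J (fun j => g j * (F c j ^ 2 + G c j ^ 2))).
  change (lsum labs _) with (lsum labs D).
  assert (HD : forall c, 0 <= D c).
  { intro c; apply lsum_nonneg; intros j Hj; specialize (Hg j Hj); nra. }
  assert (E : lsum L (fun p => lsum L (fun q => lsum J (fun j => g j * (C p j * C q j + S p j * S q j))))
    = lsum labs (fun c => lsum labs (fun c' => lsum J (fun j => g j * (F c j * F c' j + G c j * G c' j))))).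
  { transitivity (lsum J (fun j => g j * ((lsum L (fun p => C p j)) * (lsum L (fun p => C p j))
       + (lsum L (fun p => S p j)) * (lsum L (fun p => S p j))))).
    - rewrite (lsum_ext L _ (fun p => lsum J (fun j => lsum L (fun q =>
         g j * (C p j * C q j + S p j * S q j))))) by (intros; apply lsum_exchange).
      rewrite lsum_exchange; apply lsum_ext; intros j _.
      rewrite !lsum_mul, <- lsum_plus, <- lsum_scal; apply lsum_ext; intros p _.
      rewrite <- lsum_plus, <- lsum_scal; reflexivity.
    - rewrite (lsum_ext labs _ (fun c => lsum J (fun j => lsum labs (fun c' =>
         g j * (F c j * F c' j + G c j * G c' j))))) by (intros; apply lsum_exchange).
      rewrite (lsum_exchange labs J); apply lsum_ext; intros j _.
      rewrite (lsum_label L labs lab (fun p => C p j)) by auto.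
      rewrite (lsum_label L labs lab (fun p => S p j)) by auto.
      change (lsum labs (fun c => lsum L (fun a => ind (lab a = c) * C a j)))
        with (lsum labs (fun c => F c j)).
      change (lsum labs (fun c => lsum L (fun a => ind (lab a = c) * S a j)))
        with (lsum labs (fun c => G c j)).
      rewrite !lsum_mul, <- lsum_plus, <- lsum_scal; apply lsum_ext; intros c _.
      rewrite <- lsum_plus, <- lsum_scal; reflexivity. }
  rewrite E.
  apply Rle_trans with (lsum labs (fun c => lsum labs (fun c' =>
     ind (adj c c') * (D c / 2) + ind (adj c' c) * (D c' / 2)))).
  - apply lsum_le; intros c Hc; apply lsum_le; intros c' Hc'.
    destruct (excluded_middle_informative (adj c c')) as [Ha|Na].
    + rewrite !ind_true by auto.
      apply Rle_trans with (lsum J (fun j => / 2 * (g j * (F c j ^ 2 + G c j ^ 2)) +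
                                             / 2 * (g j * (F c' j ^ 2 + G c' j ^ 2)))).
      * apply lsum_le; intros j Hj; specialize (Hg j Hj).
        pose proof (pow2_ge_0 (F c j - F c' j)); pose proof (pow2_ge_0 (G c j - G c' j)); nra.
      * rewrite lsum_plus, !lsum_scal; unfold D; lra.
    + rewrite !ind_false by auto.
      right; rewrite !Rmult_0_l, Rplus_0_l.
      transitivity (lsum L (fun p => lsum L (fun q => ind (lab p = c) * (ind (lab q = c') *
          lsum J (fun j => g j * (C p j * C q j + S p j * S q j)))))).
      * rewrite (lsum_ext J _ (fun j => lsum L (fun p => lsum L (fun q =>
          ind (lab p = c) * (ind (lab q = c') * (g j * (C p j * C q j + S p j * S q j))))))).
        2: { intros j _; unfold F, G; rewrite !lsum_mul, <- lsum_plus, <- lsum_scal.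
             apply lsum_ext; intros p _; rewrite <- lsum_plus, <- lsum_scal.
             apply lsum_ext; intros q _; ring. }
        rewrite lsum_exchange; apply lsum_ext; intros p _.
        rewrite lsum_exchange; apply lsum_ext; intros q _.
        rewrite !lsum_scal; reflexivity.
      * rewrite (lsum_ext L _ (fun _ => 0)); [apply lsum_zero|]; intros p Hp.
        rewrite (lsum_ext L _ (fun _ => 0)); [apply lsum_zero|]; intros q Hq.
        destruct (excluded_middle_informative (lab p = c)) as [<-|]; [|rewrite ind_false by assumption; ring].
        destruct (excluded_middle_informative (lab q = c')) as [<-|]; [|rewrite (ind_false (lab q = c')) by assumption; ring].
        rewrite (Hvan p q) by assumption; ring.
  - rewrite (lsum_ext labs _ (fun c => lsum labs (fun c' => ind (adj c c') * (D c / 2)) +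
        lsum labs (fun c' => ind (adj c' c) * (D c' / 2)))) by (intros; apply lsum_plus).
    rewrite lsum_plus, (lsum_exchange labs labs (fun c c' => ind (adj c' c) * (D c' / 2))).
    assert (lsum labs (fun c => lsum labs (fun c' => ind (adj c c') * (D c / 2))) <=
            Deg * lsum labs D / 2) as HH; [|lra].
    replace (Deg * lsum labs D / 2) with (lsum labs (fun c => Deg * (D c / 2)))
      by (rewrite lsum_scal; unfold Rdiv; rewrite lsum_scal_r; ring).
    apply lsum_le; intros c Hc; rewrite lsum_scal_r.
    apply Rmult_le_compat_r; [specialize (HD c); lra|auto].
Qed.

(** * The kernel *)

(* [((v1, v2), (z1, z2))] stands for the line [w |-> v - w m] with [m = z / H]. *)
Definition line := ((R * R) * (Z * Z))%type.

Definition pv1 (p : line) : R := fst (fst p).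
Definition pv2 (p : line) : R := snd (fst p).
Definition pm1 (H : R) (p : line) : R := IZR (fst (snd p)) / H.
Definition pm2 (H : R) (p : line) : R := IZR (snd (snd p)) / H.

(** The factor [H] undoes the denominator of the slopes: at a frequency [k] the phase difference of
    two lines depends on [j] through the integer [k . (z - z')] times [net P j]. *)
Definition wnet (H u : R) (P : nat) (j : Z) : R := u + H * net P j.

(** A smooth count of the times [w] near [u] at which two lines are close: [gam] localises [w], and
    [l] tests each coordinate of the difference. *)
Definition kern (l gam : tpoly) (H u : R) (P : nat) (p q : line) : R :=
  lsum (zr 0 P) (fun j => ev gam (net P j) *
    (ev l (pv1 p - pv1 q - wnet H u P j * (pm1 H p - pm1 H q)) *
     ev l (pv2 p - pv2 q - wnet H u P j * (pm2 H p - pm2 H q)))).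

Definition phase (H u : R) (P : nat) (k1 k2 : Z) (p : line) (j : Z) : R :=
  IZR k1 * (pv1 p - wnet H u P j * pm1 H p) + IZR k2 * (pv2 p - wnet H u P j * pm2 H p).

Definition fkern (gam : tpoly) (H u : R) (P : nat) (k1 k2 : Z) (p q : line) : R :=
  lsum (zr 0 P) (fun j => ev gam (net P j) *
    (cos (phase H u P k1 k2 p j) * cos (phase H u P k1 k2 q j) +
     sin (phase H u P k1 k2 p j) * sin (phase H u P k1 k2 q j))).

(** Both spatial factors are sums of cosines; the product formula turns a pair of frequencies into
    the two plane waves [(k, k')] and [(k, -k')]. *)
Lemma kern_expand l gam H u P p q :
  kern l gam H u P p q =
  lsum l (fun e => lsum l (fun e' => fst e * fst e' / 2 *
    (fkern gam H u P (snd e) (snd e') p q + fkern gam H u P (snd e) (- snd e') p q))).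
Proof.
  unfold kern, fkern.
  rewrite (lsum_ext (zr 0 P) _ (fun j => lsum l (fun e => lsum l (fun e' =>
    fst e * fst e' / 2 * (ev gam (net P j) *
     (cos (phase H u P (snd e) (snd e') p j) * cos (phase H u P (snd e) (snd e') q j) +
      sin (phase H u P (snd e) (snd e') p j) * sin (phase H u P (snd e) (snd e') q j)) +
     ev gam (net P j) *
     (cos (phase H u P (snd e) (- snd e') p j) * cos (phase H u P (snd e) (- snd e') q j) +
      sin (phase H u P (snd e) (- snd e') p j) * sin (phase H u P (snd e) (- snd e') q j))))))).
  - rewrite lsum_exchange; apply lsum_ext; intros e _.
    rewrite lsum_exchange; apply lsum_ext; intros e' _.
    rewrite lsum_scal, lsum_plus; reflexivity.
  - intros j _; unfold ev at 2 3; rewrite lsum_mul, <- lsum_scal.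
    apply lsum_ext; intros [c k] _; rewrite <- lsum_scal.
    apply lsum_ext; intros [c' k'] _; cbn [fst snd].
    rewrite <- !cos_minus.
    set (x1 := pv1 p - _ - _); set (x2 := pv2 p - _ - _).
    replace (phase H u P k k' p j - phase H u P k k' q j) with (IZR k * x1 + IZR k' * x2)
      by (unfold phase, x1, x2; ring).
    replace (phase H u P k (- k') p j - phase H u P k (- k') q j) with (IZR k * x1 - IZR k' * x2)
      by (unfold phase, x1, x2; rewrite opp_IZR; ring).
    replace (c * cos (IZR k * x1) * (c' * cos (IZR k' * x2)))
      with (c * c' * (cos (IZR k * x1) * cos (IZR k' * x2))) by ring.
    rewrite cos_mul; field.
Qed.

Definition mlab (H K : R) (p : line) : Z * Z :=
  (Int_part (K * pm1 H p), Int_part (K * pm2 H p)).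

(** Along the axis of the larger of [|k1|], [|k2|] the strip meets each grid line in an interval of
    length at most 6, hence in at most 7 grid points. *)
Lemma strip_degree (k1 k2 a1 a2 : Z) (nn : nat) (c : Z * Z) :
  (0 < Z.max (Z.abs k1) (Z.abs k2))%Z ->
  lsum (list_prod (zr a1 nn) (zr a2 nn)) (fun c' =>
    ind (Rabs (IZR k1 * (IZR (fst c) - IZR (fst c')) + IZR k2 * (IZR (snd c) - IZR (snd c'))) <=
         3 * IZR (Z.max (Z.abs k1) (Z.abs k2)))) <= 7 * INR nn.
Proof.
  intros Hpos; rewrite lsum_prod; cbn [fst snd].
  assert (Col : forall (k : Z) (a : Z) (y : R), k <> 0%Z ->
     lsum (zr a nn) (fun t => ind (Rabs (IZR k * (y - IZR t)) <= 3 * IZR (Z.abs k))) <= 7).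
  { intros k a y Hk.
    assert (0 < IZR (Z.abs k)) by (apply IZR_lt; lia).
    apply Rle_trans with (lsum (zr a nn) (fun t => ind (y - 3 <= IZR t <= y + 3))).
    - apply lsum_le; intros t _; apply ind_imp; rewrite Rabs_mult, <- abs_IZR; intro E.
      assert (Rabs (y - IZR t) <= 3) by nra.
      revert H0; unfold Rabs; destruct Rcase_abs; lra.
    - eapply Rle_trans; [apply zr_count_le|]; lra. }
  destruct (Z_le_gt_dec (Z.abs k2) (Z.abs k1)) as [Hc|Hc].
  - rewrite Z.max_l in * by assumption.
    assert (Hk : k1 <> 0%Z) by lia.
    assert (0 < Rabs (IZR k1)) by (apply Rabs_pos_lt, not_0_IZR; assumption).
    rewrite lsum_exchange.
    apply Rle_trans with (lsum (zr a2 nn) (fun _ => 7)); [|rewrite lsum_const, length_zr; lra].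
    apply lsum_le; intros t2 _.
    eapply Rle_trans; [|apply (Col k1 a1
      (IZR (fst c) + IZR k2 / IZR k1 * (IZR (snd c) - IZR t2)) Hk)].
    right; apply lsum_ext; intros t _; do 3 f_equal; field; apply not_0_IZR; assumption.
  - rewrite Z.max_r in * by lia.
    assert (Hk : k2 <> 0%Z) by lia.
    apply Rle_trans with (lsum (zr a1 nn) (fun _ => 7)); [|rewrite lsum_const, length_zr; lra].
    apply lsum_le; intros t1 _.
    eapply Rle_trans; [|apply (Col k2 a2
      (IZR (snd c) + IZR k1 / IZR k2 * (IZR (fst c) - IZR t1)) Hk)].
    right; apply lsum_ext; intros t _; do 3 f_equal; field; apply not_0_IZR; assumption.
Qed.

(* Frequencies [k] with [|k| >= X] only see pairs whose difference [m - m']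
   lies in the strip [|k . (m - m')| <= d / H], which has width at most [1 / K];
   this is the only place where cancellation is used. *)
Lemma fkern_high gam d b H u P (k1 k2 X : Z) (K : R) (L : list line) (a1 a2 : Z) (nn : nat) :
  tp_good gam d b -> (forall x, 0 <= ev gam x) -> 0 < H -> 0 < K -> (0 < P)%nat ->
  (0 < X)%Z -> (X <= Z.max (Z.abs k1) (Z.abs k2))%Z ->
  K * INR d <= H * IZR X ->
  (forall p, In p L -> In (mlab H K p) (list_prod (zr a1 nn) (zr a2 nn))) ->
  (forall p q, In p L -> In q L ->
     (Z.abs (k1 * (fst (snd p) - fst (snd q)) + k2 * (snd (snd p) - snd (snd q))) + Z.of_nat d
       < Z.of_nat P)%Z) ->
  lsum L (fun p => lsum L (fun q => fkern gam H u P k1 k2 p q)) <=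
  7 * INR nn * lsum L (fun p => lsum L (fun q =>
     ind (mlab H K p = mlab H K q) * fkern gam H u P k1 k2 p q)).
Proof.
  intros G Gp HH HK HP HX Hk Hd Hlab HPb.
  set (kap := Z.max (Z.abs k1) (Z.abs k2)) in *.
  set (adj := fun c c' : Z * Z =>
    Rabs (IZR k1 * (IZR (fst c) - IZR (fst c')) + IZR k2 * (IZR (snd c) - IZR (snd c'))) <= 3 * IZR kap).
  unfold fkern.
  apply (block_orthogonality L (zr 0 P) (fun j => ev gam (net P j))
     (fun p j => cos (phase H u P k1 k2 p j)) (fun p j => sin (phase H u P k1 k2 p j))
     (list_prod (zr a1 nn) (zr a2 nn)) (mlab H K) adj); auto.
  - apply NoDup_list_prod; apply NoDup_zr.
  - intros c c' E; unfold adj in *; rewrite <- Rabs_Ropp; eapply Rle_trans; [|exact E].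
    right; f_equal; ring.
  - intros c _; apply (strip_degree k1 k2 a1 a2); lia.
  - intros p q Hp Hq Nadj.
    set (ka := (k1 * (fst (snd p) - fst (snd q)) + k2 * (snd (snd p) - snd (snd q)))%Z).
    set (al := IZR k1 * (pv1 p - pv1 q - u * (pm1 H p - pm1 H q)) +
               IZR k2 * (pv2 p - pv2 q - u * (pm2 H p - pm2 H q))).
    rewrite (lsum_ext _ _ (fun j => ev gam (net P j) * cos (al - IZR ka * net P j))).
    2: { intros j _; rewrite <- cos_minus; do 2 f_equal.
         unfold phase, al, ka, wnet, pm1, pm2; rewrite plus_IZR, !mult_IZR, !minus_IZR.
         field; lra. }
    apply (net_orthogonal gam d b); auto.
    2: { apply HPb; auto. }
    (* Contraposition: if [|ka| <= d], then [m - m'] lies in the strip. Passing to integer labels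
       adds at most [|k1| + |k2|], which is why adjacency allows 3 in place of 1. *)
    apply Z.nle_gt; intro Hka; apply Nadj; clear Nadj.
    assert (Hkap : 0 < IZR kap) by (apply IZR_lt; lia).
    assert (HkX : IZR X <= IZR kap) by (apply IZR_le; lia).
    assert (A1 : Rabs (IZR k1) <= IZR kap) by (rewrite <- abs_IZR; apply IZR_le; lia).
    assert (A2 : Rabs (IZR k2) <= IZR kap) by (rewrite <- abs_IZR; apply IZR_le; lia).
    assert (Hs : Rabs (K * (IZR k1 * (pm1 H p - pm1 H q) + IZR k2 * (pm2 H p - pm2 H q))) <= IZR kap).
    { replace (K * (IZR k1 * (pm1 H p - pm1 H q) + IZR k2 * (pm2 H p - pm2 H q)))
        with (K / H * IZR ka)
        by (unfold ka, pm1, pm2; rewrite plus_IZR, !mult_IZR, !minus_IZR; field; lra).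
      rewrite Rabs_mult, <- abs_IZR, Rabs_pos_eq
        by (apply Rmult_le_pos; [lra|left; apply Rinv_0_lt_compat; lra]).
      apply IZR_le in Hka; rewrite <- INR_IZR_INZ in Hka.
      apply Rle_trans with (K / H * INR d).
      - apply Rmult_le_compat_l; [|assumption].
        apply Rmult_le_pos; [lra|left; apply Rinv_0_lt_compat; lra].
      - apply Rmult_le_reg_l with H; [assumption|].
        replace (H * (K / H * INR d)) with (K * INR d) by (field; lra).
        nra. }
    unfold adj, mlab; cbn [fst snd].
    pose proof (floor_bounds (K * pm1 H p)); pose proof (floor_bounds (K * pm1 H q)).
    pose proof (floor_bounds (K * pm2 H p)); pose proof (floor_bounds (K * pm2 H q)).
    set (t1 := IZR (Int_part (K * pm1 H p))) in *; set (t1' := IZR (Int_part (K * pm1 H q))) in *.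
    set (t2 := IZR (Int_part (K * pm2 H p))) in *; set (t2' := IZR (Int_part (K * pm2 H q))) in *.
    replace (IZR k1 * (t1 - t1') + IZR k2 * (t2 - t2')) with
      (K * (IZR k1 * (pm1 H p - pm1 H q) + IZR k2 * (pm2 H p - pm2 H q)) +
       (IZR k1 * ((t1 - t1') - (K * pm1 H p - K * pm1 H q)) +
        IZR k2 * ((t2 - t2') - (K * pm2 H p - K * pm2 H q)))) by ring.
    eapply Rle_trans; [apply Rabs_triang|].
    replace (3 * IZR kap) with (IZR kap + (IZR kap * 1 + IZR kap * 1)) by ring.
    apply Rplus_le_compat; [assumption|].
    eapply Rle_trans; [apply Rabs_triang|]; rewrite !Rabs_mult.
    apply Rplus_le_compat; apply Rmult_le_compat; try apply Rabs_pos; try assumption;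
      apply Rabs_le; lra.
Qed.

Lemma low_mass l d beta (X : Z) :
  tp_good l d beta -> (0 < X)%Z ->
  lsum l (fun e => fst e * ind (Z.abs (snd e) < X)%Z) <= 2 * IZR X * beta.
Proof.
  intros (N & S & D & B) HX.
  apply Rle_trans with (lsum l (fun e => lsum (zr (- X) (Z.to_nat (2 * X)))
      (fun k => fst e * ind (snd e = k)))).
  - apply lsum_le; intros e He; rewrite lsum_scal; apply Rmult_le_compat_l; [auto|].
    destruct (excluded_middle_informative (Z.abs (snd e) < X)%Z) as [Hl|Hl].
    + rewrite ind_true by assumption.
      pose proof (lsum_ind_eq (zr (- X) (Z.to_nat (2 * X))) (snd e) (fun _ => 1)) as E.
      cbv beta in E; rewrite <- E at 1.
      * right; apply lsum_ext; intros; ring.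
      * apply NoDup_zr.
      * apply In_zr; lia.
    + rewrite ind_false by assumption; apply lsum_nonneg; intros; apply ind_bound.
  - rewrite lsum_exchange.
    apply Rle_trans with (lsum (zr (- X) (Z.to_nat (2 * X))) (fun _ => beta)).
    + apply lsum_le; auto.
    + rewrite lsum_const, length_zr, INR_IZR_INZ, Z2Nat.id, mult_IZR by lia; lra.
Qed.

(** Frequencies with both entries below [X] are estimated trivially, their total weight being
    controlled by [beta]; all others fall under [fkern_high]. Block energies are nonnegative at
    every frequency, so the low ones may be added back on the right to reassemble the kernel. *)
Lemma kern_energy l dl beta gam d b H u P (X : Z) (K : R) (L : list line) (a1 a2 : Z) (nn : nat) :
  tp_good l dl beta ->
  tp_good gam d b -> (forall x, 0 <= ev gam x) -> 0 < H -> 0 < K -> (0 < P)%nat ->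
  (0 < X)%Z -> K * INR d <= H * IZR X ->
  (forall p, In p L -> In (mlab H K p) (list_prod (zr a1 nn) (zr a2 nn))) ->
  (forall k1 k2 p q, (Z.abs k1 <= Z.of_nat dl)%Z -> (Z.abs k2 <= Z.of_nat dl)%Z ->
     In p L -> In q L ->
     (Z.abs (k1 * (fst (snd p) - fst (snd q)) + k2 * (snd (snd p) - snd (snd q))) + Z.of_nat d
       < Z.of_nat P)%Z) ->
  lsum L (fun p => lsum L (fun q => kern l gam H u P p q)) <=
  (2 * IZR X * beta) ^ 2 * (INR (length L) ^ 2 * lsum (zr 0 P) (fun j => ev gam (net P j))) +
  7 * INR nn * lsum L (fun p => lsum L (fun q =>
     ind (mlab H K p = mlab H K q) * kern l gam H u P p q)).
Proof.
  intros Gl G Gp HH HK HP HX Hd Hlab HPb.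
  set (Gs := lsum (zr 0 P) (fun j => ev gam (net P j))).
  assert (HGs : 0 <= Gs) by (apply lsum_nonneg; auto).
  set (Q := fun k1 k2 => lsum L (fun p => lsum L (fun q => fkern gam H u P k1 k2 p q))).
  set (R0 := fun k1 k2 => lsum L (fun p => lsum L (fun q =>
     ind (mlab H K p = mlab H K q) * fkern gam H u P k1 k2 p q))).
  assert (E1 : lsum L (fun p => lsum L (fun q => kern l gam H u P p q)) =
    lsum l (fun e => lsum l (fun e' => fst e * fst e' / 2 * (Q (snd e) (snd e') + Q (snd e) (- snd e')%Z)))).
  { rewrite (lsum_ext L _ (fun p => lsum l (fun e => lsum l (fun e' => lsum L (fun q =>
       fst e * fst e' / 2 * (fkern gam H u P (snd e) (snd e') p q + fkern gam H u P (snd e) (- snd e') p q)))))).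
    2: { intros p _; rewrite (lsum_ext L _ (fun q => lsum l (fun e => lsum l (fun e' =>
           fst e * fst e' / 2 * (fkern gam H u P (snd e) (snd e') p q + fkern gam H u P (snd e) (- snd e') p q)))))
           by (intros; apply kern_expand).
         rewrite lsum_exchange; apply lsum_ext; intros e _; apply lsum_exchange. }
    rewrite lsum_exchange; apply lsum_ext; intros e _.
    rewrite lsum_exchange; apply lsum_ext; intros e' _.
    unfold Q; rewrite <- lsum_plus, <- lsum_scal; apply lsum_ext; intros p _.
    rewrite <- lsum_plus, <- lsum_scal; reflexivity. }
  assert (E2 : lsum L (fun p => lsum L (fun q => ind (mlab H K p = mlab H K q) * kern l gam H u P p q)) =
    lsum l (fun e => lsum l (fun e' => fst e * fst e' / 2 * (R0 (snd e) (snd e') + R0 (snd e) (- snd e')%Z)))).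
  { rewrite (lsum_ext L _ (fun p => lsum l (fun e => lsum l (fun e' => lsum L (fun q =>
       fst e * fst e' / 2 * (ind (mlab H K p = mlab H K q) * fkern gam H u P (snd e) (snd e') p q +
         ind (mlab H K p = mlab H K q) * fkern gam H u P (snd e) (- snd e') p q)))))).
    2: { intros p _; rewrite (lsum_ext L _ (fun q => lsum l (fun e => lsum l (fun e' =>
           fst e * fst e' / 2 * (ind (mlab H K p = mlab H K q) * fkern gam H u P (snd e) (snd e') p q +
         ind (mlab H K p = mlab H K q) * fkern gam H u P (snd e) (- snd e') p q))))).
         2: { intros q _; rewrite kern_expand, <- lsum_scal; apply lsum_ext; intros e _.
              rewrite <- lsum_scal; apply lsum_ext; intros e' _; ring. }
         rewrite lsum_exchange; apply lsum_ext; intros e _; apply lsum_exchange. }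
    rewrite lsum_exchange; apply lsum_ext; intros e _.
    rewrite lsum_exchange; apply lsum_ext; intros e' _.
    unfold R0; rewrite <- lsum_plus, <- lsum_scal; apply lsum_ext; intros p _.
    rewrite <- lsum_plus, <- lsum_scal; reflexivity. }
  assert (HR0 : forall k1 k2, 0 <= R0 k1 k2).
  { intros k1 k2; unfold R0, fkern.
    rewrite <- (block_gram L (zr 0 P) (fun j => ev gam (net P j))
      (fun p j => cos (phase H u P k1 k2 p j)) (fun p j => sin (phase H u P k1 k2 p j))
      (list_prod (zr a1 nn) (zr a2 nn)) (mlab H K)); auto.
    - apply lsum_nonneg; intros c _; apply lsum_nonneg; intros j _.
      apply Rmult_le_pos; [auto|]; apply Rplus_le_le_0_compat; apply pow2_ge_0.
    - apply NoDup_list_prod; apply NoDup_zr. }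
  assert (HQ : forall k1 k2, Q k1 k2 <= INR (length L) ^ 2 * Gs).
  { intros k1 k2; unfold Q.
    replace (INR (length L) ^ 2 * Gs) with (lsum L (fun _ => lsum L (fun _ => Gs)))
      by (rewrite !lsum_const; ring).
    apply lsum_le; intros p _; apply lsum_le; intros q _; unfold fkern, Gs.
    apply lsum_le; intros j _; rewrite <- cos_minus.
    pose proof (COS_bound (phase H u P k1 k2 p j - phase H u P k1 k2 q j)).
    pose proof (Gp (net P j)); nra. }
  assert (HN : 0 <= INR (length L) ^ 2 * Gs) by (apply Rmult_le_pos; [apply pow2_ge_0|assumption]).
  assert (HQ2 : forall k1 k2, (Z.abs k1 <= Z.of_nat dl)%Z -> (Z.abs k2 <= Z.of_nat dl)%Z ->
    Q k1 k2 <= ind (Z.abs k1 < X)%Z * ind (Z.abs k2 < X)%Z * (INR (length L) ^ 2 * Gs) +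
       7 * INR nn * R0 k1 k2).
  { intros k1 k2 H1 H2.
    assert (0 <= 7 * INR nn * R0 k1 k2)
      by (apply Rmult_le_pos; [apply Rmult_le_pos; [lra|apply pos_INR]|auto]).
    destruct (Z_lt_le_dec (Z.max (Z.abs k1) (Z.abs k2)) X) as [Hl|Hl].
    - rewrite !ind_true by lia; specialize (HQ k1 k2); lra.
    - pose proof (ind_bound (Z.abs k1 < X)%Z); pose proof (ind_bound (Z.abs k2 < X)%Z).
      assert (Q k1 k2 <= 7 * INR nn * R0 k1 k2)
        by (apply (fkern_high gam d b H u P k1 k2 X K L a1 a2 nn); auto).
      assert (0 <= ind (Z.abs k1 < X)%Z * ind (Z.abs k2 < X)%Z * (INR (length L) ^ 2 * Gs))
        by (apply Rmult_le_pos; [apply Rmult_le_pos; tauto|assumption]); lra. }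
  rewrite E1, E2.
  pose proof (low_mass l dl beta X Gl HX) as LM.
  destruct Gl as (N & S1 & D & B).
  apply Rle_trans with (lsum l (fun e => lsum l (fun e' =>
     (fst e * ind (Z.abs (snd e) < X)%Z) * (fst e' * ind (Z.abs (snd e') < X)%Z) * (INR (length L) ^ 2 * Gs) +
     7 * INR nn * (fst e * fst e' / 2 * (R0 (snd e) (snd e') + R0 (snd e) (- snd e')%Z))))).
  - apply lsum_le; intros e He; apply lsum_le; intros e' He'.
    pose proof (D e He) as De; pose proof (D e' He') as De'.
    pose proof (HQ2 (snd e) (snd e') De De') as U1.
    pose proof (HQ2 (snd e) (- snd e')%Z De ltac:(lia)) as U2.
    rewrite Z.abs_opp in U2.
    pose proof (N e He); pose proof (N e' He').
    assert (0 <= fst e * fst e' / 2) by (apply Rmult_le_pos; [apply Rmult_le_pos; auto|lra]).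
    apply Rle_trans with (fst e * fst e' / 2 *
       (2 * (ind (Z.abs (snd e) < X)%Z * ind (Z.abs (snd e') < X)%Z * (INR (length L) ^ 2 * Gs)) +
        7 * INR nn * (R0 (snd e) (snd e') + R0 (snd e) (- snd e')%Z))).
    + apply Rmult_le_compat_l; [assumption|lra].
    + right; field.
  - rewrite (lsum_ext l _ (fun e =>
      (fst e * ind (Z.abs (snd e) < X)%Z) * lsum l (fun e' => fst e' * ind (Z.abs (snd e') < X)%Z) * (INR (length L) ^ 2 * Gs) +
      7 * INR nn * lsum l (fun e' => fst e * fst e' / 2 * (R0 (snd e) (snd e') + R0 (snd e) (- snd e')%Z)))).
    2: { intros e _; rewrite lsum_plus, lsum_scal_r, !lsum_scal; reflexivity. }
    rewrite lsum_plus, lsum_scal_r, lsum_scal_r, lsum_scal.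
    apply Rplus_le_compat_r, Rmult_le_compat_r; [assumption|].
    set (lm := lsum l (fun e => fst e * ind (Z.abs (snd e) < X)%Z)) in *.
    assert (0 <= lm) by (apply lsum_nonneg; intros e He; apply Rmult_le_pos; [auto|apply ind_bound]).
    nra.
Qed.

(** * Pointwise bounds for the kernel *)

(** Applied to differences of parameters: two lines come within [delta] of each other, in the
    maximum norm, at some time [|w| <= T]. *)
Definition inc (T delta v1 v2 m1 m2 : R) : Prop :=
  exists w, Rabs w <= T /\ Rabs (v1 - w * m1) <= delta /\ Rabs (v2 - w * m2) <= delta.

Lemma inc_mono T T' d d' v1 v2 m1 m2 :
  T <= T' -> d <= d' -> inc T d v1 v2 m1 m2 -> inc T' d' v1 v2 m1 m2.
Proof. intros HT Hd (w & H1 & H2 & H3); exists w; repeat split; lra. Qed.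

(** A power keeps a peak of width about [1/n] while the exponent shrinks the tail; the price is a
    degree multiplied by [M + 1] and a height of only [4^(-(M+1))] near the centre. *)
Definition fpow (n M : nat) : tpoly := tpow (fejer n) (S M).

Lemma fpow_good n M : (0 < n)%nat -> tp_good (fpow n M) (S M * n) (/ INR n).
Proof. intro; apply tpow_good, fejer_good; assumption. Qed.

Lemma fpow_bound n M x : (0 < n)%nat -> 0 <= ev (fpow n M) x <= 1.
Proof.
  intro Hn; unfold fpow; rewrite ev_tpow.
  pose proof (ev_fejer_bound n x Hn); split; [apply pow_le; tauto|].
  rewrite <- (pow1 (S M)); apply pow_incr; assumption.
Qed.

Lemma fpow_lower n M x :
  (0 < n)%nat -> INR n * Rabs x <= 1 -> (1 / 4) ^ S M <= ev (fpow n M) x.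
Proof.
  intros Hn Hx; unfold fpow; rewrite ev_tpow; apply pow_incr; split; [lra|].
  apply ev_fejer_lower; assumption.
Qed.

Lemma fpow_tail n M x y :
  (0 < n)%nat -> 0 < y -> y <= Rabs x -> Rabs x <= PI ->
  ev (fpow n M) x <= (50 / (INR n * y) ^ 2) ^ S M.
Proof.
  intros Hn Hy Hyx Hx; unfold fpow; rewrite ev_tpow; apply pow_incr.
  assert (Hn' : 0 < INR n) by (apply lt_0_INR; lia).
  split; [apply ev_fejer_bound; assumption|].
  eapply Rle_trans; [apply ev_fejer_tail; auto|].
  - intros ->; rewrite Rabs_R0 in Hyx; lra.
  - apply Rmult_le_compat_l; [lra|].
    apply Rinv_le_contravar; [apply pow_lt; nra|].
    apply pow_incr; split; nra.
Qed.

Lemma net_step_pos H P : 0 < H -> (0 < P)%nat -> 0 < 2 * PI * H / INR P.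
Proof.
  intros HH HP; pose proof PI_RGT_0.
  apply Rdiv_lt_0_compat; [nra|apply lt_0_INR; lia].
Qed.

Lemma wnet_index H u P j : 0 < H -> (0 < P)%nat ->
  IZR j = (wnet H u P j - u + PI * H) / (2 * PI * H / INR P).
Proof.
  intros HH HP; assert (0 < INR P) by (apply lt_0_INR; lia); pose proof PI_RGT_0.
  unfold wnet, net; field; repeat split; lra.
Qed.

Lemma net_range P j : (0 < P)%nat -> In j (zr 0 P) -> Rabs (net P j) <= PI.
Proof.
  intros HP Hj; apply In_zr in Hj; assert (0 < INR P) by (apply lt_0_INR; lia).
  pose proof PI_RGT_0.
  assert (0 <= IZR j / INR P <= 1).
  { assert (0 <= IZR j) by (apply IZR_le; lia).
    assert (IZR j <= INR P) by (rewrite INR_IZR_INZ; apply IZR_le; lia).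
    split; [apply Rmult_le_pos; [lra|left; apply Rinv_0_lt_compat; lra]|].
    apply Rmult_le_reg_r with (INR P); [lra|].
    unfold Rdiv; rewrite Rmult_assoc, Rinv_l; lra. }
  unfold net; replace (2 * PI * IZR j / INR P - PI) with (PI * (2 * (IZR j / INR P) - 1)) by (field; lra).
  apply Rabs_le; nra.
Qed.

Lemma wnet_count_le H u P a b : 0 < H -> (0 < P)%nat -> a <= b ->
  lsum (zr 0 P) (fun j => ind (a <= wnet H u P j <= b)) <=
  (b - a) / (2 * PI * H / INR P) + 1.
Proof.
  intros HH HP Hab; assert (0 < INR P) by (apply lt_0_INR; lia); pose proof PI_RGT_0.
  set (om := 2 * PI * H / INR P).
  assert (Hom : 0 < om) by (apply net_step_pos; assumption).
  assert (Hi : 0 < / om) by (apply Rinv_0_lt_compat; lra).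
  apply Rle_trans with (lsum (zr 0 P) (fun j =>
     ind ((a - u + PI * H) / om <= IZR j <= (b - u + PI * H) / om))).
  - apply lsum_le; intros j _; apply ind_imp; intros [Ha1 Ha2].
    rewrite (wnet_index H u P j) by assumption; fold om.
    unfold Rdiv; split; apply Rmult_le_compat_r; lra.
  - eapply Rle_trans; [apply zr_count_le|].
    + assert ((a - u + PI * H) / om <= (b - u + PI * H) / om); [|lra].
      unfold Rdiv; apply Rmult_le_compat_r; lra.
    + right; field; lra.
Qed.

Lemma wnet_count_ge H u P a b : 0 < H -> (0 < P)%nat ->
  u - PI * H <= a -> b <= u + PI * H ->
  (b - a) / (2 * PI * H / INR P) - 1 <=
  lsum (zr 0 P) (fun j => ind (a <= wnet H u P j <= b)).
Proof.
  intros HH HP Ha Hb; assert (HP' : 0 < INR P) by (apply lt_0_INR; lia); pose proof PI_RGT_0.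
  set (om := 2 * PI * H / INR P).
  assert (Hom : 0 < om) by (apply net_step_pos; assumption).
  assert (Hi : 0 < / om) by (apply Rinv_0_lt_compat; lra).
  apply Rle_trans with (lsum (zr 0 P) (fun j =>
     ind ((a - u + PI * H) / om <= IZR j <= (b - u + PI * H) / om))).
  - eapply Rle_trans; [|apply zr_count_ge].
    + right; field; lra.
    + apply Rmult_le_pos; lra.
    + rewrite Z.add_0_l, <- INR_IZR_INZ.
      replace (INR P) with (2 * PI * H / om) by (unfold om; field; repeat split; lra).
      unfold Rdiv; apply Rmult_le_compat_r; lra.
  - apply lsum_le; intros j _; apply ind_imp.
    rewrite (wnet_index H u P j) by assumption; fold om.
    unfold Rdiv; intros [H1 H2].
    apply Rmult_le_reg_r in H1; [|assumption]; apply Rmult_le_reg_r in H2; [|assumption]; lra.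
Qed.

Lemma kern_nonneg n nw M H u P p q :
  (0 < n)%nat -> (0 < nw)%nat -> 0 <= kern (fpow n M) (fpow nw M) H u P p q.
Proof.
  intros Hn Hnw; apply lsum_nonneg; intros j _.
  repeat apply Rmult_le_pos; apply fpow_bound; assumption.
Qed.

(** Slopes differ by at most 1, so closeness at [w0] persists up to [2 delta] for
    [|w - w0| <= delta]. At least [delta] divided by the mesh many net points lie there, and each of
    the three factors is at least [(1/4)^(M+1)]. *)
Lemma kern_lower n nw M H u P p q w0 delta :
  (0 < n)%nat -> (0 < nw)%nat -> (0 < P)%nat -> 0 < H -> 0 < delta ->
  INR nw * (Rabs (w0 - u) + delta) <= H ->
  INR n * (2 * delta) <= 1 ->
  2 * PI * H / INR P <= delta ->
  Rabs (pm1 H p - pm1 H q) <= 1 -> Rabs (pm2 H p - pm2 H q) <= 1 ->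
  Rabs (pv1 p - pv1 q - w0 * (pm1 H p - pm1 H q)) <= delta ->
  Rabs (pv2 p - pv2 q - w0 * (pm2 H p - pm2 H q)) <= delta ->
  (1 / 4) ^ (3 * S M) * (delta / (2 * PI * H / INR P)) <=
  kern (fpow n M) (fpow nw M) H u P p q.
Proof.
  intros Hn Hnw HP HH Hd Hw Hnd Hom M1 M2 V1 V2.
  assert (HP' : 0 < INR P) by (apply lt_0_INR; lia); pose proof PI_RGT_0.
  set (om := 2 * PI * H / INR P) in *.
  assert (Hom0 : 0 < om) by (apply net_step_pos; assumption).
  assert (Hnw' : 1 <= INR nw) by (change 1 with (INR 1); apply le_INR; lia).
  assert (Hn' : 0 < INR n) by (apply lt_0_INR; lia).
  pose proof (Rabs_pos (w0 - u)).
  assert (P1 : 1 < PI) by (pose proof PI2_3_2; lra).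
  assert (HwH : Rabs (w0 - u) + delta <= H) by nra.
  apply Rle_trans with ((1 / 4) ^ (3 * S M) *
     lsum (zr 0 P) (fun j => ind (w0 - delta <= wnet H u P j <= w0 + delta))).
  - apply Rmult_le_compat_l; [apply pow_le; lra|].
    pose proof (Rle_abs (w0 - u)); pose proof (Rle_abs (- (w0 - u))) as R2; rewrite Rabs_Ropp in R2.
    eapply Rle_trans; [|apply wnet_count_ge; auto; nra].
    fold om.
    assert (1 <= delta / om).
    { apply Rmult_le_reg_r with om; [lra|]; unfold Rdiv; rewrite Rmult_assoc, Rinv_l; lra. }
    replace ((w0 + delta - (w0 - delta)) / om) with (2 * (delta / om)) by (field; lra); lra.
  - rewrite <- lsum_scal; unfold kern; apply lsum_le; intros j Hj.
    set (w := wnet H u P j).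
    destruct (excluded_middle_informative (w0 - delta <= w <= w0 + delta)) as [Hin|Nin].
    2: { rewrite ind_false by assumption; rewrite Rmult_0_r.
         repeat apply Rmult_le_pos; apply fpow_bound; assumption. }
    rewrite ind_true, Rmult_1_r by assumption.
    replace (3 * S M)%nat with (S M + (S M + S M))%nat by lia.
    rewrite !pow_add.
    assert (Q4 : 0 <= (1 / 4) ^ S M) by (apply pow_le; lra).
    assert (Hww : Rabs (w - w0) <= delta) by (apply Rabs_le; lra).
    assert (Gen : forall v m, Rabs m <= 1 -> Rabs (v - w0 * m) <= delta ->
       (1 / 4) ^ S M <= ev (fpow n M) (v - w * m)).
    { intros v m Hm Hv; apply fpow_lower; [assumption|].
      apply Rle_trans with (INR n * (2 * delta)); [|assumption].
      apply Rmult_le_compat_l; [lra|].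
      replace (v - w * m) with ((v - w0 * m) + - ((w - w0) * m)) by ring.
      eapply Rle_trans; [apply Rabs_triang|]; rewrite Rabs_Ropp, Rabs_mult.
      pose proof (Rabs_pos (w - w0)); pose proof (Rabs_pos m); nra. }
    apply Rmult_le_compat; [assumption|apply Rmult_le_pos; assumption| |].
    + apply fpow_lower; [assumption|].
      apply Rmult_le_reg_r with H; [assumption|]; rewrite Rmult_1_l.
      replace (INR nw * Rabs (net P j) * H) with (INR nw * Rabs (w - u)).
      * apply Rle_trans with (INR nw * (Rabs (w0 - u) + delta)); [|assumption].
        apply Rmult_le_compat_l; [lra|].
        replace (w - u) with ((w0 - u) + (w - w0)) by ring.
        eapply Rle_trans; [apply Rabs_triang|lra].
      * unfold w, wnet; replace (u + H * net P j - u) with (H * net P j) by ring.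
        rewrite Rabs_mult, (Rabs_pos_eq H) by lra; ring.
    + apply Rmult_le_compat; auto.
Qed.

Lemma gam_tail nw M H u P j tau :
  (0 < nw)%nat -> (0 < P)%nat -> 0 < H -> In j (zr 0 P) ->
  (50 / (INR nw / H) ^ 2) ^ S M <= tau -> 1 < Rabs (wnet H u P j - u) ->
  ev (fpow nw M) (net P j) <= tau.
Proof.
  intros Hnw HP HH Hj Ht Hw.
  replace (INR nw / H) with (INR nw * / H) in Ht by reflexivity.
  eapply Rle_trans; [apply (fpow_tail nw M (net P j) (/ H))|exact Ht]; auto.
  - apply Rinv_0_lt_compat; assumption.
  - unfold wnet in Hw; replace (u + H * net P j - u) with (H * net P j) in Hw by ring.
    rewrite Rabs_mult, (Rabs_pos_eq H) in Hw by lra.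
    apply Rmult_le_reg_l with H; [assumption|]; rewrite Rinv_r; lra.
  - apply net_range; assumption.
Qed.

Lemma gam_mass nw M H P tau :
  (0 < nw)%nat -> (0 < P)%nat -> 0 < H -> 0 <= tau ->
  (50 / (INR nw / H) ^ 2) ^ S M <= tau ->
  lsum (zr 0 P) (fun j => ev (fpow nw M) (net P j)) <=
  2 / (2 * PI * H / INR P) + 1 + INR P * tau.
Proof.
  intros Hnw HP HH Ht0 Ht; pose (u := 0).
  apply Rle_trans with (lsum (zr 0 P) (fun j => ind (u - 1 <= wnet H u P j <= u + 1) + tau)).
  - apply lsum_le; intros j Hj.
    destruct (Rle_lt_dec (Rabs (wnet H u P j - u)) 1) as [H1|H1].
    + rewrite ind_true.
      * pose proof (fpow_bound nw M (net P j) Hnw); lra.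
      * revert H1; unfold Rabs; destruct Rcase_abs; lra.
    + pose proof (gam_tail nw M H u P j tau Hnw HP HH Hj Ht H1).
      pose proof (ind_bound (u - 1 <= wnet H u P j <= u + 1)); lra.
  - rewrite lsum_plus, lsum_const, length_zr.
    apply Rplus_le_compat_r.
    eapply Rle_trans; [apply wnet_count_le; auto; lra|].
    right; do 2 f_equal; ring.
Qed.

(** If one of the three factors is in its tail, the product is at most [tau]. The bounds on [v] and
    on the slopes keep the arguments within one period, where the tail estimate is valid; outside,
    the periodic kernel would see false incidences. *)
Lemma kern_upper n nw M H u P p q T dp tau :
  (0 < n)%nat -> (0 < nw)%nat -> (0 < P)%nat -> 0 < H -> 0 < dp -> 0 <= tau ->
  Rabs u <= T ->
  (50 / (INR nw / H) ^ 2) ^ S M <= tau -> (50 / (INR n * dp) ^ 2) ^ S M <= tau ->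
  Rabs (pv1 p - pv1 q) <= 1 -> Rabs (pv2 p - pv2 q) <= 1 ->
  (T + 1) * Rabs (pm1 H p - pm1 H q) <= 1 -> (T + 1) * Rabs (pm2 H p - pm2 H q) <= 1 ->
  kern (fpow n M) (fpow nw M) H u P p q <=
  INR P * tau + lsum (zr 0 P) (fun j => ind (Rabs (wnet H u P j) <= T + 1 /\
     Rabs (pv1 p - pv1 q - wnet H u P j * (pm1 H p - pm1 H q)) <= dp /\
     Rabs (pv2 p - pv2 q - wnet H u P j * (pm2 H p - pm2 H q)) <= dp)).
Proof.
  intros Hn Hnw HP HH Hdp Ht0 Hu Ht1 Ht2 V1 V2 M1 M2.
  apply Rle_trans with (lsum (zr 0 P) (fun j => tau + ind (Rabs (wnet H u P j) <= T + 1 /\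
     Rabs (pv1 p - pv1 q - wnet H u P j * (pm1 H p - pm1 H q)) <= dp /\
     Rabs (pv2 p - pv2 q - wnet H u P j * (pm2 H p - pm2 H q)) <= dp))).
  2: { rewrite lsum_plus, lsum_const, length_zr; lra. }
  unfold kern; apply lsum_le; intros j Hj.
  set (w := wnet H u P j).
  set (x1 := pv1 p - _ - _); set (x2 := pv2 p - _ - _).
  pose proof (fpow_bound nw M (net P j) Hnw) as Bg.
  pose proof (fpow_bound n M x1 Hn) as B1; pose proof (fpow_bound n M x2 Hn) as B2.
  set (g := ev (fpow nw M) (net P j)) in *.
  set (e1 := ev (fpow n M) x1) in *; set (e2 := ev (fpow n M) x2) in *.
  pose proof (ind_bound (Rabs w <= T + 1 /\ Rabs x1 <= dp /\ Rabs x2 <= dp)) as Bi.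
  assert (Prod : forall a b : R, 0 <= a <= 1 -> 0 <= b <= 1 -> 0 <= a * b <= 1).
  { intros a b Ha Hb; split; nra. }
  destruct (Rle_lt_dec (Rabs (w - u)) 1) as [Hw|Hw].
  - assert (HwT : Rabs w <= T + 1).
    { replace w with (u + (w - u)) by ring; eapply Rle_trans; [apply Rabs_triang|lra]. }
    assert (Xb : forall v m, Rabs v <= 1 -> (T + 1) * Rabs m <= 1 -> Rabs (v - w * m) <= PI).
    { intros v m Hv Hm; pose proof PI2_3_2.
      unfold Rminus; eapply Rle_trans; [apply Rabs_triang|]; rewrite Rabs_Ropp, Rabs_mult.
      pose proof (Rabs_pos m); nra. }
    assert (X1 : Rabs x1 <= PI) by (apply Xb; assumption).
    assert (X2 : Rabs x2 <= PI) by (apply Xb; assumption).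
    destruct (Rle_lt_dec (Rabs x1) dp) as [D1|D1].
    + destruct (Rle_lt_dec (Rabs x2) dp) as [D2|D2].
      * rewrite ind_true by tauto.
        pose proof (Prod _ _ Bg (Prod _ _ B1 B2)); lra.
      * assert (e2 <= tau).
        { eapply Rle_trans; [apply (fpow_tail n M x2 dp); auto; lra|assumption]. }
        pose proof (Prod _ _ Bg B1).
        replace (g * (e1 * e2)) with (g * e1 * e2) by ring; nra.
    + assert (e1 <= tau).
      { eapply Rle_trans; [apply (fpow_tail n M x1 dp); auto; lra|assumption]. }
      pose proof (Prod _ _ Bg B2).
      replace (g * (e1 * e2)) with (g * e2 * e1) by ring; nra.
  - assert (g <= tau) by (apply (gam_tail nw M H u P j tau); auto).
    pose proof (Prod _ _ B1 B2); nra.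
Qed.

Lemma inc_net_count H u P T dp v1 v2 m1 m2 :
  0 < H -> (0 < P)%nat -> 0 <= T -> 0 <= dp ->
  lsum (zr 0 P) (fun j => ind (Rabs (wnet H u P j) <= T /\
     Rabs (v1 - wnet H u P j * m1) <= dp /\ Rabs (v2 - wnet H u P j * m2) <= dp)) <=
  ind (inc T dp v1 v2 m1 m2) * (2 * T / (2 * PI * H / INR P) + 1).
Proof.
  intros HH HP HT Hdp.
  destruct (excluded_middle_informative (inc T dp v1 v2 m1 m2)) as [Hi|Hi].
  - rewrite ind_true, Rmult_1_l by assumption.
    apply Rle_trans with (lsum (zr 0 P) (fun j => ind (- T <= wnet H u P j <= T))).
    + apply lsum_le; intros j _; apply ind_imp; intros (H1 & _).
      revert H1; unfold Rabs; destruct Rcase_abs; lra.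
    + eapply Rle_trans; [apply wnet_count_le; auto; lra|]; right; do 2 f_equal; ring.
  - rewrite (ind_false (inc _ _ _ _ _ _)), Rmult_0_l by assumption.
    rewrite (lsum_ext _ _ (fun _ => 0)), lsum_zero; [lra|].
    intros j _; apply ind_false; intro H0; apply Hi; eexists; exact H0.
Qed.

(** In a coordinate where the slope is at least [rho] in absolute value, closeness confines [w] to
    an interval of length [2 dp / rho]. *)
Lemma inc_net_count_transversal H u P T dp v1 v2 m1 m2 rho :
  0 < H -> (0 < P)%nat -> 0 <= dp -> 0 < rho ->
  (rho <= Rabs m1 \/ rho <= Rabs m2) ->
  lsum (zr 0 P) (fun j => ind (Rabs (wnet H u P j) <= T /\
     Rabs (v1 - wnet H u P j * m1) <= dp /\ Rabs (v2 - wnet H u P j * m2) <= dp)) <=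
  ind (inc T dp v1 v2 m1 m2) * (2 * dp / rho / (2 * PI * H / INR P) + 1).
Proof.
  intros HH HP Hdp Hrho Hm.
  destruct (excluded_middle_informative (inc T dp v1 v2 m1 m2)) as [Hi|Hi].
  - rewrite ind_true, Rmult_1_l by assumption.
    assert (Sol : forall w v m, rho <= Rabs m -> Rabs (v - w * m) <= dp ->
       v / m - dp / rho <= w <= v / m + dp / rho).
    { intros w v m Hmr Hv.
      assert (m <> 0) by (intros ->; rewrite Rabs_R0 in Hmr; lra).
      assert (Rabs (w - v / m) <= dp / rho).
      { replace (w - v / m) with (- ((v - w * m) / m)) by (field; assumption).
        rewrite Rabs_Ropp; unfold Rdiv; rewrite Rabs_mult, Rabs_inv.
        apply Rmult_le_compat; [apply Rabs_pos|left; apply Rinv_0_lt_compat; lra|assumption|].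
        apply Rinv_le_contravar; assumption. }
      revert H1; unfold Rabs; destruct Rcase_abs; lra. }
    assert (0 <= dp / rho) by (apply Rmult_le_pos; [lra|left; apply Rinv_0_lt_compat; lra]).
    destruct Hm as [Hm|Hm].
    + apply Rle_trans with (lsum (zr 0 P) (fun j =>
         ind (v1 / m1 - dp / rho <= wnet H u P j <= v1 / m1 + dp / rho))).
      * apply lsum_le; intros j _; apply ind_imp; intros (_ & H1 & _); apply Sol; assumption.
      * eapply Rle_trans; [apply wnet_count_le; auto; lra|]; right; do 2 f_equal; unfold Rdiv; ring.
    + apply Rle_trans with (lsum (zr 0 P) (fun j =>
         ind (v2 / m2 - dp / rho <= wnet H u P j <= v2 / m2 + dp / rho))).
      * apply lsum_le; intros j _; apply ind_imp; intros (_ & _ & H1); apply Sol; assumption.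
      * eapply Rle_trans; [apply wnet_count_le; auto; lra|]; right; do 2 f_equal; unfold Rdiv; ring.
  - rewrite (ind_false (inc _ _ _ _ _ _)), Rmult_0_l by assumption.
    rewrite (lsum_ext _ _ (fun _ => 0)), lsum_zero; [lra|].
    intros j _; apply ind_false; intro H0; apply Hi; eexists; exact H0.
Qed.

(** * Counting in spaced families *)

Definition cube (H r x1 x2 x3 x4 : R) (p : line) : Prop :=
  (x1 <= pv1 p < x1 + r) /\ (x2 <= pv2 p < x2 + r) /\
  (x3 <= pm1 H p < x3 + r) /\ (x4 <= pm2 H p < x4 + r).

Definition spaced (H r C0 : R) (L : list line) : Prop :=
  forall x1 x2 x3 x4, lsum L (fun p => ind (cube H r x1 x2 x3 x4 p)) <= C0.

Definition near (H r : R) (p q : line) : Prop :=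
  Rabs (pv1 p - pv1 q) <= r /\ Rabs (pv2 p - pv2 q) <= r /\
  Rabs (pm1 H p - pm1 H q) <= r /\ Rabs (pm2 H p - pm2 H q) <= r.

Definition small (H : R) (L : list line) : Prop :=
  forall p q, In p L -> In q L -> near H 1 p q.

Definition transv (H r : R) (p q : line) : Prop :=
  r < Rabs (pm1 H p - pm1 H q) \/ r < Rabs (pm2 H p - pm2 H q).

Definition incp (H T d : R) (p q : line) : Prop :=
  inc T d (pv1 p - pv1 q) (pv2 p - pv2 q) (pm1 H p - pm1 H q) (pm2 H p - pm2 H q).

Definition count (H r : R) (L : list line) (T d : R) : R :=
  lsum L (fun p => lsum L (fun q => ind (transv H r p q /\ incp H T d p q))).

Lemma count_mono H r L T d d' : d <= d' -> count H r L T d <= count H r L T d'.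
Proof.
  intro Hd; apply lsum_le; intros p _; apply lsum_le; intros q _; apply ind_imp.
  intros [H1 H2]; split; [assumption|]; eapply inc_mono; [| |exact H2]; lra.
Qed.

Lemma count_le_square H r L T d : count H r L T d <= INR (length L) ^ 2.
Proof.
  replace (INR (length L) ^ 2) with (lsum L (fun _ => lsum L (fun _ => 1)))
    by (rewrite !lsum_const; ring).
  apply lsum_le; intros p _; apply lsum_le; intros q _; apply ind_bound.
Qed.

(** [Q] carries the constraints on the remaining coordinates, so that a box is subdivided one
    coordinate at a time. *)
Lemma interval_count {A : Type} (L : list A) (Q : A -> Prop) (f : A -> R) (r c : R) :
  0 < r ->
  (forall x, lsum L (fun a => ind ((x <= f a < x + r) /\ Q a)) <= c) ->
  forall x (k : nat), lsum L (fun a => ind ((x <= f a < x + INR k * r) /\ Q a)) <= INR k * c.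
Proof.
  intros Hr Hc x k; induction k as [|k IH].
  - rewrite (lsum_ext _ _ (fun _ => 0)), lsum_zero; [simpl; lra|].
    intros a _; apply ind_false; simpl; lra.
  - apply Rle_trans with (lsum L (fun a => ind ((x <= f a < x + INR k * r) /\ Q a) +
       ind ((x + INR k * r <= f a < x + INR k * r + r) /\ Q a))).
    + apply lsum_le; intros a _.
      pose proof (ind_bound ((x <= f a < x + INR k * r) /\ Q a)).
      pose proof (ind_bound ((x + INR k * r <= f a < x + INR k * r + r) /\ Q a)).
      destruct (excluded_middle_informative ((x <= f a < x + INR (S k) * r) /\ Q a)) as [[Hi Hq]|N].
      * rewrite (ind_true ((x <= f a < x + INR (S k) * r) /\ Q a)) by tauto.
        rewrite S_INR in Hi.
        destruct (Rlt_le_dec (f a) (x + INR k * r)).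
        -- rewrite ind_true; [lra|split; [lra|assumption]].
        -- rewrite (ind_true ((x + INR k * r <= f a < x + INR k * r + r) /\ Q a)); [lra|].
           split; [lra|assumption].
      * rewrite ind_false by assumption; lra.
    + rewrite lsum_plus, S_INR; specialize (Hc (x + INR k * r)); lra.
Qed.

Lemma box_count H r C0 L x1 x2 x3 x4 (k : nat) :
  0 < r -> spaced H r C0 L ->
  lsum L (fun p => ind (cube H (INR k * r) x1 x2 x3 x4 p)) <= INR k ^ 4 * C0.
Proof.
  intros Hr Hs.
  assert (S1 : forall y1 y2 y3 y4, lsum L (fun p => ind ((y4 <= pm2 H p < y4 + INR k * r) /\
      ((y1 <= pv1 p < y1 + r) /\ (y2 <= pv2 p < y2 + r) /\ (y3 <= pm1 H p < y3 + r)))) <= INR k * C0).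
  { intros; apply (interval_count L _ (pm2 H)); [assumption|]; intro x.
    eapply Rle_trans; [|apply (Hs y1 y2 y3 x)].
    apply lsum_le; intros p _; apply ind_imp; unfold cube; tauto. }
  assert (S2 : forall y1 y2 y3 y4, lsum L (fun p => ind ((y3 <= pm1 H p < y3 + INR k * r) /\
      ((y1 <= pv1 p < y1 + r) /\ (y2 <= pv2 p < y2 + r) /\ (y4 <= pm2 H p < y4 + INR k * r)))) <=
      INR k * (INR k * C0)).
  { intros; apply (interval_count L _ (pm1 H)); [assumption|]; intro x.
    eapply Rle_trans; [|apply (S1 y1 y2 x y4)].
    apply lsum_le; intros p _; apply ind_imp; tauto. }
  assert (S3 : forall y1 y2 y3 y4, lsum L (fun p => ind ((y2 <= pv2 p < y2 + INR k * r) /\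
      ((y1 <= pv1 p < y1 + r) /\ (y3 <= pm1 H p < y3 + INR k * r) /\ (y4 <= pm2 H p < y4 + INR k * r)))) <=
      INR k * (INR k * (INR k * C0))).
  { intros; apply (interval_count L _ pv2); [assumption|]; intro x.
    eapply Rle_trans; [|apply (S2 y1 x y3 y4)].
    apply lsum_le; intros p _; apply ind_imp; tauto. }
  eapply Rle_trans; [|right; instantiate (1 := INR k * (INR k * (INR k * (INR k * C0)))); ring].
  eapply Rle_trans; [|apply (interval_count L (fun p => (x2 <= pv2 p < x2 + INR k * r) /\
     (x3 <= pm1 H p < x3 + INR k * r) /\ (x4 <= pm2 H p < x4 + INR k * r)) pv1 r
      (INR k * (INR k * (INR k * C0))) Hr)].
  - apply lsum_le; intros p _; apply ind_imp; unfold cube; intro E; exact E.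
  - intro x; eapply Rle_trans; [|apply (S3 x x2 x3 x4)].
    apply lsum_le; intros p _; apply ind_imp; tauto.
Qed.

Lemma nat_between (x : R) : 0 <= x -> exists k : nat, x < INR k <= x + 1.
Proof.
  intro Hx; destruct (archimed x) as [H1 H2].
  exists (Z.to_nat (up x)); rewrite INR_IZR_INZ, Z2Nat.id; [lra|].
  apply le_IZR; lra.
Qed.

Lemma near_count H W C0 L p rad :
  0 < W -> 0 <= C0 -> spaced H (/ W) C0 L -> 1 <= rad * W ->
  lsum L (fun q => ind (near H rad p q)) <= C0 * (4 * (rad * W)) ^ 4.
Proof.
  intros HW HC Hs Hr.
  (* Strictly more than [2 rad W] cubes per side, because cubes are half-open and [near] is closed;
     at most [2 rad W + 1 <= 4 rad W], as [rad W >= 1]. *)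
  destruct (nat_between (2 * (rad * W))) as [k [Hk1 Hk2]]; [lra|].
  assert (HWi : 0 < / W) by (apply Rinv_0_lt_compat; assumption).
  assert (Hk : 2 * rad < INR k * / W).
  { apply Rmult_lt_reg_r with W; [assumption|].
    replace (INR k * / W * W) with (INR k) by (field; lra); lra. }
  apply Rle_trans with (INR k ^ 4 * C0).
  - eapply Rle_trans; [|apply (box_count H (/ W) C0 L (pv1 p - rad) (pv2 p - rad)
      (pm1 H p - rad) (pm2 H p - rad) k); assumption].
    apply lsum_le; intros q _; apply ind_imp; intros (A1 & A2 & A3 & A4).
    assert (Gen : forall a b, Rabs (a - b) <= rad -> a - rad <= b < a - rad + INR k * / W).
    { intros a b Hab; revert Hab; unfold Rabs; destruct Rcase_abs; lra. }
    unfold cube; auto.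
  - rewrite Rmult_comm; apply Rmult_le_compat_l; [assumption|].
    apply pow_incr; split; [apply pos_INR|lra].
Qed.

Lemma small_length H W C0 L :
  1 <= W -> 0 <= C0 -> spaced H (/ W) C0 L -> small H L ->
  INR (length L) <= 256 * C0 * W ^ 4.
Proof.
  intros HW HC Hs Hd; destruct L as [|p L0] eqn:E.
  - change (INR (length (@nil line))) with 0; apply Rmult_le_pos; [lra|apply pow_le; lra].
  - rewrite <- E in *.
    rewrite <- (Rmult_1_r (INR (length L))), <- lsum_const.
    apply Rle_trans with (lsum L (fun q => ind (near H 1 p q))).
    + apply lsum_le; intros q Hq; rewrite ind_true; [lra|].
      apply Hd; [rewrite E; left; reflexivity|assumption].
    + eapply Rle_trans; [apply (near_count H W C0 L p 1); try assumption; lra|].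
      right; ring.
Qed.

(** * Covering by overlapping cells, and dilations *)

Lemma floor_range (x x0 y : R) :
  0 <= y -> Rabs (x - x0) <= y ->
  In (Int_part x) (zr (Int_part (x0 - y)) (Z.to_nat (Int_part (2 * y) + 3))).
Proof.
  intros Hy Hx; apply In_zr.
  pose proof (floor_bounds x); pose proof (floor_bounds (x0 - y)); pose proof (floor_bounds (2 * y)).
  assert (- y <= x - x0 <= y) by (revert Hx; unfold Rabs; destruct Rcase_abs; lra).
  assert (0 <= Int_part (2 * y))%Z.
  { assert (-1 < Int_part (2 * y))%Z by (apply lt_IZR; lra); lia. }
  rewrite Z2Nat.id by lia; split.
  - assert (Int_part (x0 - y) < Int_part x + 1)%Z by (apply lt_IZR; rewrite plus_IZR; lra); lia.
  - apply lt_IZR; rewrite !plus_IZR; lra.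
Qed.

Lemma floor_range_length (y : R) :
  1 <= y -> INR (Z.to_nat (Int_part (2 * y) + 3)) <= 5 * y.
Proof.
  intro Hy; pose proof (floor_bounds (2 * y)).
  assert (0 <= Int_part (2 * y))%Z.
  { assert (-1 < Int_part (2 * y))%Z by (apply lt_IZR; lra); lia. }
  rewrite INR_IZR_INZ, Z2Nat.id, plus_IZR by lia; lra.
Qed.

(** The centre is that of a grid cell of side [rho]; the radius will be taken larger than half the
    side, so that a whole interacting pair fits into one enlarged cell. *)
Definition cell (H rho rad : R) (z : (Z * Z) * (Z * Z)) (p : line) : Prop :=
  Rabs (pv1 p - (IZR (fst (fst z)) + / 2) * rho) <= rad /\
  Rabs (pv2 p - (IZR (snd (fst z)) + / 2) * rho) <= rad /\
  Rabs (pm1 H p - (IZR (fst (snd z)) + / 2) * rho) <= rad /\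
  Rabs (pm2 H p - (IZR (snd (snd z)) + / 2) * rho) <= rad.

Definition cellb (H rho rad : R) z p : bool :=
  if excluded_middle_informative (cell H rho rad z p) then true else false.

Lemma cellb_true H rho rad z p : cellb H rho rad z p = true <-> cell H rho rad z p.
Proof.
  unfold cellb; destruct excluded_middle_informative; split; try tauto; discriminate.
Qed.

(** A pair is charged to the grid cell of [p]; as [q] is within [Lam rho] of [p], both lie in that
    cell enlarged to radius [(Lam + 1/2) rho]. A small family occupies at most [(5 / rho)^4]
    cells. *)
Lemma cells_cover H (L : list line) rho Lam (F : line -> line -> R) (bnd : R) :
  small H L -> 0 < rho <= 1 -> 0 <= Lam ->
  (forall p q, 0 <= F p q) -> 0 <= bnd ->
  (forall p q, In p L -> In q L -> F p q <> 0 -> near H (Lam * rho) p q) ->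
  (forall z, lsum (filter (cellb H rho ((Lam + / 2) * rho) z) L) (fun p =>
      lsum (filter (cellb H rho ((Lam + / 2) * rho) z) L) (F p)) <= bnd) ->
  lsum L (fun p => lsum L (F p)) <= (5 / rho) ^ 4 * bnd.
Proof.
  intros Hs [Hr Hr1] HL HF Hb Hnear Hcell.
  destruct L as [|p0 L0] eqn:EL.
  { unfold lsum at 1; cbn [fold_right]; apply Rmult_le_pos; [|assumption]; apply pow_le.
    apply Rmult_le_pos; [lra|left; apply Rinv_0_lt_compat; lra]. }
  rewrite <- EL in *.
  assert (Hir : 1 <= / rho) by (rewrite <- Rinv_1; apply Rinv_le_contravar; lra).
  set (nn := Z.to_nat (Int_part (2 * (/ rho)) + 3)).
  set (rg := fun f : line -> R => zr (Int_part (f p0 * / rho - / rho)) nn).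
  set (labs := list_prod (list_prod (rg pv1) (rg pv2)) (list_prod (rg (pm1 H)) (rg (pm2 H)))).
  set (lab := fun p : line => ((Int_part (pv1 p * / rho), Int_part (pv2 p * / rho)),
                        (Int_part (pm1 H p * / rho), Int_part (pm2 H p * / rho)))).
  assert (Hlab : forall p, In p L -> In (lab p) labs).
  { intros p Hp.
    assert (Hp0 : In p0 L) by (rewrite EL; left; reflexivity).
    destruct (Hs p p0 Hp Hp0) as (A1 & A2 & A3 & A4).
    assert (Gen : forall f : line -> R, Rabs (f p - f p0) <= 1 -> In (Int_part (f p * / rho)) (rg f)).
    { intros f Hf; unfold rg, nn; apply floor_range; [lra|].
      rewrite <- Rmult_minus_distr_r, Rabs_mult, (Rabs_pos_eq (/ rho)) by lra; nra. }
    unfold lab, labs; repeat (apply in_prod_iff; split); apply Gen; assumption. }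
  assert (ND : NoDup labs) by (repeat apply NoDup_list_prod; apply NoDup_zr).
  apply Rle_trans with (INR (length labs) * bnd).
  2: { apply Rmult_le_compat_r; [assumption|].
       unfold labs, rg; rewrite !length_prod, !length_zr, !mult_INR.
       assert (INR nn <= 5 * / rho) by (apply floor_range_length; assumption).
       replace (INR nn * INR nn * (INR nn * INR nn)) with (INR nn ^ 4) by ring.
       apply pow_incr; split; [apply pos_INR|assumption]. }
  rewrite <- lsum_const.
  rewrite (lsum_label L labs lab) by assumption.
  apply lsum_le; intros z _; eapply Rle_trans; [|apply (Hcell z)].
  rewrite lsum_filter; apply lsum_le; intros p Hp.
  assert (Pos : 0 <= lsum (filter (cellb H rho ((Lam + / 2) * rho) z) L) (F p))
    by (apply lsum_nonneg; auto).
  destruct (excluded_middle_informative (lab p = z)) as [<-|N].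
  2: { rewrite ind_false by assumption; rewrite Rmult_0_l.
       destruct cellb; lra. }
  rewrite ind_true, Rmult_1_l by reflexivity.
  assert (Fl : forall x, Rabs (x - (IZR (Int_part (x * / rho)) + / 2) * rho) <= / 2 * rho).
  { intro x; pose proof (floor_bounds (x * / rho)) as Fb.
    assert (Ex : x = (x * / rho) * rho) by (field; lra).
    set (y := x * / rho) in *; rewrite Ex.
    replace (y * rho - (IZR (Int_part y) + / 2) * rho) with ((y - IZR (Int_part y) - / 2) * rho) by ring.
    rewrite Rabs_mult, (Rabs_pos_eq rho) by lra; apply Rmult_le_compat_r; [lra|].
    apply Rabs_le; lra. }
  assert (Hcp : cell H rho ((Lam + / 2) * rho) (lab p) p).
  { unfold cell, lab; cbn [fst snd].
    repeat split; (eapply Rle_trans; [apply Fl|]); apply Rmult_le_compat_r; lra. }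
  rewrite (proj2 (cellb_true _ _ _ _ _) Hcp).
  rewrite lsum_filter; apply lsum_le; intros q Hq.
  destruct (cellb H rho ((Lam + / 2) * rho) (lab p) q) eqn:Ec; [lra|].
  destruct (Req_dec (F p q) 0) as [E0|N0]; [lra|exfalso].
  destruct (Hnear p q Hp Hq N0) as (A1 & A2 & A3 & A4).
  enough (cellb H rho ((Lam + / 2) * rho) (lab p) q = true) by congruence.
  apply cellb_true.
  assert (Gen : forall x y, Rabs (x - y) <= Lam * rho ->
     Rabs (y - (IZR (Int_part (x * / rho)) + / 2) * rho) <= (Lam + / 2) * rho).
  { intros x y Hxy.
    replace (y - (IZR (Int_part (x * / rho)) + / 2) * rho) with
      (- (x - y) + (x - (IZR (Int_part (x * / rho)) + / 2) * rho)) by ring.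
    eapply Rle_trans; [apply Rabs_triang|]; rewrite Rabs_Ropp; specialize (Fl x); lra. }
  unfold cell, lab; cbn [fst snd]; repeat split; apply Gen; assumption.
Qed.

(** Dilation by [1/s]. The integers stay put and the denominator [H] becomes [s H]; since [W]
    becomes [s W], the ratio [h = H / W] is invariant, and this is why the induction keeps [h]
    fixed. *)
Definition rescale (s : R) (p : line) : line :=
  ((pv1 p / s, pv2 p / s), snd p).

Lemma rescale_pv1 s p : pv1 (rescale s p) = pv1 p / s.
Proof. reflexivity. Qed.

Lemma rescale_pv2 s p : pv2 (rescale s p) = pv2 p / s.
Proof. reflexivity. Qed.

Lemma rescale_pm1 s H p : s <> 0 -> H <> 0 -> pm1 (s * H) (rescale s p) = pm1 H p / s.
Proof. intros; unfold pm1, rescale; simpl; field; auto. Qed.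

Lemma rescale_pm2 s H p : s <> 0 -> H <> 0 -> pm2 (s * H) (rescale s p) = pm2 H p / s.
Proof. intros; unfold pm2, rescale; simpl; field; auto. Qed.

Lemma inc_rescale T d v1 v2 m1 m2 s : 0 < s ->
  inc T d v1 v2 m1 m2 -> inc T (d / s) (v1 / s) (v2 / s) (m1 / s) (m2 / s).
Proof.
  intros Hs (w & H1 & H2 & H3); exists w.
  assert (Gen : forall v m, Rabs (v - w * m) <= d -> Rabs (v / s - w * (m / s)) <= d / s).
  { intros v m Hv; replace (v / s - w * (m / s)) with ((v - w * m) * / s) by (field; lra).
    rewrite Rabs_mult, (Rabs_pos_eq (/ s)) by (left; apply Rinv_0_lt_compat; lra).
    apply Rmult_le_compat_r; [left; apply Rinv_0_lt_compat; lra|assumption]. }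
  auto.
Qed.

Lemma spaced_sublist H r C0 L b : spaced H r C0 L -> spaced H r C0 (filter b L).
Proof.
  intros Hs x1 x2 x3 x4; eapply Rle_trans; [|apply (Hs x1 x2 x3 x4)].
  rewrite lsum_filter; apply lsum_le; intros p _.
  pose proof (ind_bound (cube H r x1 x2 x3 x4 p)); destruct (b p); lra.
Qed.

Lemma spaced_rescale H W C0 L s : 0 < s -> 0 < H -> 0 < W ->
  spaced H (/ W) C0 L -> spaced (s * H) (/ (s * W)) C0 (map (rescale s) L).
Proof.
  intros Hs HH HW Hsp x1 x2 x3 x4; rewrite lsum_map.
  eapply Rle_trans; [|apply (Hsp (s * x1) (s * x2) (s * x3) (s * x4))].
  apply lsum_le; intros p _; apply ind_imp; intros (A1 & A2 & A3 & A4).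
  rewrite rescale_pm1 in A3 by lra; rewrite rescale_pm2 in A4 by lra.
  unfold rescale, pv1 in A1; unfold rescale, pv2 in A2; simpl in A1, A2.
  assert (Gen : forall x a, x <= a / s < x + / (s * W) -> s * x <= a < s * x + / W).
  { intros x a [G1 G2].
    replace a with (s * (a / s)) by (field; lra).
    replace (/ W) with (s * / (s * W)) by (field; lra).
    rewrite <- Rmult_plus_distr_l; split.
    - apply Rmult_le_compat_l; lra.
    - apply Rmult_lt_compat_l; lra. }
  unfold cube; auto.
Qed.

(** * Induction on scales *)

(* The bound to be propagated: [W^8 d] is the count for randomly placed lines,
   and [1 / W^2] is the resolution below which it stops decreasing. *)
Definition claim (h C0 eta Y a T : R) (i : nat) : Prop :=
  forall W L, 1 <= W -> W <= Y ^ i -> small (h * W) L -> spaced (h * W) (/ W) C0 L ->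
  forall d, 0 < d -> count (h * W) (eta / 2) L T d <= a * W ^ 8 * Rmax d (/ W ^ 2).

Definition mclass (H rho T d : R) (p q : line) : Prop :=
  transv H (rho / 2) p q /\ Rabs (pm1 H p - pm1 H q) <= rho /\
  Rabs (pm2 H p - pm2 H q) <= rho /\ incp H T d p q.

(** [|v| <= |v - w m| + |w| |m|]: incident lines with close slopes are close in all four parameters
    and fit into one cell of comparable size. *)
Lemma inc_near T d rho v1 v2 m1 m2 : 0 <= T -> d <= rho ->
  Rabs m1 <= rho -> Rabs m2 <= rho -> inc T d v1 v2 m1 m2 ->
  Rabs v1 <= (T + 1) * rho /\ Rabs v2 <= (T + 1) * rho.
Proof.
  intros HT Hd Hm1 Hm2 (w & H1 & H2 & H3).
  assert (Gen : forall v m, Rabs m <= rho -> Rabs (v - w * m) <= d -> Rabs v <= (T + 1) * rho).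
  { intros v m Hm Hv; replace v with ((v - w * m) + w * m) by ring.
    eapply Rle_trans; [apply Rabs_triang|]; rewrite Rabs_mult.
    pose proof (Rabs_pos w); pose proof (Rabs_pos m); nra. }
  split; [apply (Gen v1 m1)|apply (Gen v2 m2)]; assumption.
Qed.

(** Enlarged cells have side [s = (2 Lam + 1) rho]. After dilation by [1/s] each holds a small
    family at scale [s W], its pairs keep a slope difference above [1 / (2 (2 Lam + 1))], and the
    inductive claim applies at resolution [dp / s]. *)
Lemma mclass_count h C0 Lam Y a T i W L rho dp :
  claim h C0 (/ (2 * Lam + 1)) Y a T i ->
  0 < h -> 0 <= a -> 0 <= T -> T + 1 <= Lam -> 1 <= W ->
  small (h * W) L -> spaced (h * W) (/ W) C0 L ->
  rho <= 1 -> 1 <= rho * W -> (2 * Lam + 1) * rho * W <= Y ^ i ->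
  0 < dp -> dp <= rho ->
  lsum L (fun p => lsum L (fun q => ind (mclass (h * W) rho T dp p q))) <=
  (5 / rho) ^ 4 * (a * (((2 * Lam + 1) * rho * W) ^ 8 * (dp / ((2 * Lam + 1) * rho)) +
                        ((2 * Lam + 1) * rho * W) ^ 6)).
Proof.
  intros Hcl Hh Ha HT HL HW Hsm Hsp Hr1 HrW HY Hdp Hdr.
  assert (Hr : 0 < rho) by nra.
  assert (HH : 0 < h * W) by nra.
  set (S := 2 * Lam + 1) in *.
  assert (HS : 3 <= S) by (unfold S; lra).
  set (s := S * rho) in *.
  assert (Hs : 0 < s) by (unfold s; nra).
  assert (HsW : 1 <= s * W) by (unfold s; nra).
  apply (cells_cover (h * W) L rho Lam); auto; try lra.
  - intros p q; apply ind_bound.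
  - apply Rmult_le_pos; [assumption|].
    apply Rplus_le_le_0_compat; [apply Rmult_le_pos|]; try (apply pow_le; lra).
    left; apply Rdiv_lt_0_compat; assumption.
  - intros p q Hp Hq Hne.
    destruct (excluded_middle_informative (mclass (h * W) rho T dp p q)) as [(A1 & A2 & A3 & A4)|N].
    2: { rewrite ind_false in Hne by assumption; lra. }
    destruct (inc_near _ _ rho _ _ _ _ HT Hdr A2 A3 A4) as [B1 B2].
    unfold near; repeat split; nra.
  - intro z.
    set (Lz := filter (cellb (h * W) rho ((Lam + / 2) * rho) z) L).
    assert (Hcell : forall p, In p Lz -> cell (h * W) rho ((Lam + / 2) * rho) z p).
    { intros p Hp; apply filter_In in Hp; apply cellb_true, Hp. }
    assert (Sm : small (h * (s * W)) (map (rescale s) Lz)).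
    { intros p' q' Hp Hq.
      apply in_map_iff in Hp; destruct Hp as [p [<- Hp]].
      apply in_map_iff in Hq; destruct Hq as [q [<- Hq]].
      destruct (Hcell p Hp) as (A1 & A2 & A3 & A4).
      destruct (Hcell q Hq) as (B1 & B2 & B3 & B4).
      assert (Gen : forall x y c, Rabs (x - c) <= (Lam + / 2) * rho ->
          Rabs (y - c) <= (Lam + / 2) * rho -> Rabs (x / s - y / s) <= 1).
      { intros x y c X Y0.
        replace (x / s - y / s) with (((x - c) + - (y - c)) * / s) by (field; lra).
        rewrite Rabs_mult, (Rabs_pos_eq (/ s)) by (left; apply Rinv_0_lt_compat; assumption).
        apply Rmult_le_reg_r with s; [assumption|].
        rewrite Rmult_assoc, Rinv_l, Rmult_1_r, Rmult_1_l by lra.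
        eapply Rle_trans; [apply Rabs_triang|]; rewrite Rabs_Ropp; unfold s, S; lra. }
      replace (h * (s * W)) with (s * (h * W)) by ring.
      unfold near; rewrite !rescale_pm1, !rescale_pm2 by lra.
      rewrite !rescale_pv1, !rescale_pv2.
      repeat split; eapply Gen; eassumption. }
    assert (Sp : spaced (h * (s * W)) (/ (s * W)) C0 (map (rescale s) Lz)).
    { replace (h * (s * W)) with (s * (h * W)) by ring.
      apply spaced_rescale; try lra; apply spaced_sublist; assumption. }
    specialize (Hcl (s * W) (map (rescale s) Lz) HsW HY Sm Sp (dp / s) ltac:(apply Rdiv_lt_0_compat; assumption)).
    eapply Rle_trans; [|eapply Rle_trans; [exact Hcl|]].
    + unfold count; rewrite lsum_map; apply lsum_le; intros p Hp.
      rewrite lsum_map; apply lsum_le; intros q Hq; apply ind_imp; intros (A1 & A2 & A3 & A4).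
      replace (h * (s * W)) with (s * (h * W)) by ring.
      split.
      * unfold transv in *; rewrite !rescale_pm1, !rescale_pm2 by lra.
        assert (Gen : forall x y, rho / 2 < Rabs (x - y) -> / S / 2 < Rabs (x / s - y / s)).
        { intros x y Hxy.
          replace (x / s - y / s) with ((x - y) * / s) by (field; lra).
          rewrite Rabs_mult, (Rabs_pos_eq (/ s)) by (left; apply Rinv_0_lt_compat; assumption).
          apply Rmult_lt_reg_r with s; [assumption|].
          rewrite (Rmult_assoc (Rabs _)), Rinv_l, Rmult_1_r by lra.
          replace (/ S / 2 * s) with (rho / 2) by (unfold s; field; lra); assumption. }
        destruct A1; [left|right]; apply Gen; assumption.
      * unfold incp in *; rewrite !rescale_pm1, !rescale_pm2 by lra.
        rewrite !rescale_pv1, !rescale_pv2.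
        replace (pv1 p / s - pv1 q / s) with ((pv1 p - pv1 q) / s) by (field; lra).
        replace (pv2 p / s - pv2 q / s) with ((pv2 p - pv2 q) / s) by (field; lra).
        replace (pm1 (h * W) p / s - pm1 (h * W) q / s) with ((pm1 (h * W) p - pm1 (h * W) q) / s) by (field; lra).
        replace (pm2 (h * W) p / s - pm2 (h * W) q / s) with ((pm2 (h * W) p - pm2 (h * W) q) / s) by (field; lra).
        apply inc_rescale; assumption.
    + rewrite Rmult_assoc; apply Rmult_le_compat_l; [assumption|].
      assert (E6 : (s * W) ^ 6 = (s * W) ^ 8 * / (s * W) ^ 2) by (field; lra).
      rewrite E6, <- Rmult_plus_distr_l; apply Rmult_le_compat_l; [apply pow_le; lra|].
      assert (0 < / (s * W) ^ 2) by (apply Rinv_0_lt_compat, pow_lt; lra).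
      assert (0 < dp / s) by (apply Rdiv_lt_0_compat; assumption).
      apply Rmax_lub; lra.
Qed.

Lemma dyadic_class (A x : R) (k : nat) : x <= A -> A * (/ 2) ^ k < x ->
  exists l, (l < k)%nat /\ A * (/ 2) ^ l / 2 < x <= A * (/ 2) ^ l.
Proof.
  intros Hx; induction k as [|k IH]; intro H; [simpl in H; lra|].
  destruct (Rlt_le_dec (A * (/ 2) ^ k) x) as [Hl|Hl].
  - destruct (IH Hl) as [l [H1 H2]]; exists l; split; [lia|assumption].
  - exists k; split; [lia|]; simpl in H; lra.
Qed.

Lemma half_pow_sum k : lsum (seq 0 k) (fun l => (/ 2) ^ l) <= 2.
Proof.
  enough (lsum (seq 0 k) (fun l => (/ 2) ^ l) = 2 - 2 * (/ 2) ^ k) as ->.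
  { assert (0 < (/ 2) ^ k) by (apply pow_lt; lra); lra. }
  induction k as [|k IH]; [simpl; lra|].
  rewrite seq_S, lsum_app, IH; simpl; lra.
Qed.

Lemma half_pow_small (x : R) : 0 < x -> exists k, (/ 2) ^ k < x.
Proof.
  intro Hx.
  destruct (pow_lt_1_zero (/ 2) ltac:(rewrite Rabs_pos_eq; lra) x Hx) as [N HN].
  exists N; specialize (HN N (Nat.le_refl N)).
  rewrite Rabs_pos_eq in HN by (apply pow_le; lra); assumption.
Qed.

Lemma mlab_eq H K p q : 0 < K -> mlab H K p = mlab H K q ->
  Rabs (pm1 H p - pm1 H q) <= / K /\ Rabs (pm2 H p - pm2 H q) <= / K.
Proof.
  intros HK E; injection E; intros E2 E1.
  assert (Gen : forall x y, Int_part (K * x) = Int_part (K * y) -> Rabs (x - y) <= / K).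
  { intros x y Exy; pose proof (floor_bounds (K * x)); pose proof (floor_bounds (K * y)).
    rewrite Exy in *.
    apply Rmult_le_reg_l with K; [assumption|]; rewrite Rinv_r by lra.
    rewrite <- (Rabs_pos_eq K) at 1 by lra; rewrite <- Rabs_mult; apply Rabs_le; lra. }
  auto.
Qed.

(** Three sources: kernel tails; pairs with slopes closer than [rm], which may stay incident for all
    [|w| <= T + 1] but are few; and the dyadic ranges between [rm] and [1/K], counted by the
    inductive claim. The bounds for the latter decay geometrically from the top scale [1/K] and
    bring the factor [1 / K^2]. *)
Lemma block_pairs_sum h C0 Lam Y a T i W L n nw M u P K dp tau rm :
  claim h C0 (/ (2 * Lam + 1)) Y a (T + 1) i ->
  0 < h -> 0 <= a -> 0 <= C0 -> 0 <= T -> T + 2 <= Lam -> 1 <= W ->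
  small (h * W) L -> spaced (h * W) (/ W) C0 L ->
  (0 < n)%nat -> (0 < nw)%nat -> (0 < P)%nat -> 0 < dp -> 0 <= tau ->
  Rabs u <= T -> T + 1 <= K -> 1 <= K ->
  (50 / (INR nw / (h * W)) ^ 2) ^ S M <= tau -> (50 / (INR n * dp) ^ 2) ^ S M <= tau ->
  2 * PI * (h * W) / INR P <= dp -> dp <= 1 ->
  dp <= rm -> 1 <= rm * W ->
  (2 * Lam + 1) * W <= K * Y ^ i ->
  K <= dp * W ^ 2 ->
  (2 * PI * (h * W) / INR P) * lsum L (fun p => lsum L (fun q =>
     ind (mlab (h * W) K p = mlab (h * W) K q) * kern (fpow n M) (fpow nw M) (h * W) u P p q)) <=
  INR (length L) ^ 2 * (8 * (h * W) * tau) +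
  (2 * T + 3) * (INR (length L) * (C0 * (4 * (Lam * rm * W)) ^ 4)) +
  12500 * a * (2 * Lam + 1) ^ 7 * dp ^ 2 * W ^ 8 / K ^ 2.
Proof.
  intros Hcl Hh Ha HC HT HL HW Hsm Hsp Hn Hnw HP Hdp Ht0 Hu HTK HK Ht1 Ht2 Hom Hdp1 Hdrm HrmW HYK HKW.
  set (H := h * W) in *.
  assert (HH : 0 < H) by (unfold H; nra).
  assert (HP' : 0 < INR P) by (apply lt_0_INR; lia).
  set (om := 2 * PI * H / INR P) in *.
  assert (Hom0 : 0 < om) by (apply net_step_pos; assumption).
  assert (Hrm : 0 < rm) by lra.
  assert (HKi : 0 < / K <= 1).
  { split; [apply Rinv_0_lt_compat; lra|]; rewrite <- Rinv_1; apply Rinv_le_contravar; lra. }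
  destruct (half_pow_small rm Hrm) as [lm Hlm].
  set (rho := fun l : nat => / K * (/ 2) ^ l).
  assert (Hrho : forall l, 0 < rho l <= / K).
  { intro l; assert (0 < (/ 2) ^ l) by (apply pow_lt; lra).
    assert ((/ 2) ^ l <= 1) by (rewrite <- (pow1 l); apply pow_incr; lra).
    unfold rho; split; [apply Rmult_lt_0_compat; tauto|nra]. }
  (* Incidence at slope distance above [rho / 2] lasts for a time at most [4 dp / rho]; the fifth
     unit absorbs the mesh [om <= dp <= dp / rho]. Ranges below [rm] are switched off, as
     [mclass_count] asks for [rho W >= 1] and [dp <= rho]. *)
  set (wt := fun l => ind (rm <= rho l) * (5 * dp / rho l)).
  assert (Hwt : forall l, 0 <= wt l).
  { intro l; apply Rmult_le_pos; [apply ind_bound|]; specialize (Hrho l).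
    apply Rmult_le_pos; [lra|left; apply Rinv_0_lt_compat; tauto]. }
  assert (Pt : forall p q, In p L -> In q L ->
    om * (ind (mlab H K p = mlab H K q) * kern (fpow n M) (fpow nw M) H u P p q) <=
    8 * H * tau + (2 * T + 3) * ind (near H (Lam * rm) p q) +
    lsum (seq 0 lm) (fun l => wt l * ind (mclass H (rho l) (T + 1) dp p q))).
  { intros p q Hp Hq.
    pose proof (ind_bound (near H (Lam * rm) p q)) as Bn.
    assert (Bs : 0 <= lsum (seq 0 lm) (fun l => wt l * ind (mclass H (rho l) (T + 1) dp p q))).
    { apply lsum_nonneg; intros l _; apply Rmult_le_pos; [apply Hwt|apply ind_bound]. }
    assert (0 <= 8 * H * tau) by (apply Rmult_le_pos; lra).
    destruct (excluded_middle_informative (mlab H K p = mlab H K q)) as [E|N].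
    2: { rewrite (ind_false (mlab H K p = mlab H K q)) by assumption.
         assert (0 <= (2 * T + 3) * ind (near H (Lam * rm) p q)) by (apply Rmult_le_pos; lra); lra. }
    rewrite (ind_true (mlab H K p = mlab H K q)), Rmult_1_l by assumption.
    destruct (mlab_eq H K p q ltac:(lra) E) as [D1 D2].
    destruct (Hsm p q Hp Hq) as (V1 & V2 & _ & _).
    assert (TK : forall x, x <= / K -> (T + 1) * x <= 1).
    { intros x Hx; apply Rle_trans with (K * / K); [|rewrite Rinv_r; lra].
      apply Rle_trans with ((T + 1) * / K); [apply Rmult_le_compat_l; lra|].
      apply Rmult_le_compat_r; lra. }
    pose proof (kern_upper n nw M H u P p q T dp tau Hn Hnw HP HH Hdp Ht0 Hu Ht1 Ht2 V1 V2
      (TK _ D1) (TK _ D2)) as KU.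
    set (cnt := lsum (zr 0 P) _) in KU.
    assert (KU' : om * kern (fpow n M) (fpow nw M) H u P p q <= 8 * H * tau + om * cnt).
    { apply Rle_trans with (om * (INR P * tau + cnt)); [apply Rmult_le_compat_l; lra|].
      rewrite Rmult_plus_distr_l; apply Rplus_le_compat_r.
      replace (om * (INR P * tau)) with (2 * PI * (H * tau)) by (unfold om; field; lra).
      pose proof PI_4; assert (0 <= H * tau) by (apply Rmult_le_pos; lra); nra. }
    eapply Rle_trans; [exact KU'|]; rewrite Rplus_assoc; apply Rplus_le_compat_l.
    destruct (excluded_middle_informative (incp H (T + 1) dp p q)) as [Hi|Ni].
    2: { assert (cnt <= 0).
         { eapply Rle_trans; [apply inc_net_count; lra || assumption|].
           fold (incp H (T + 1) dp p q); rewrite ind_false by assumption; lra. }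
         assert (0 <= (2 * T + 3) * ind (near H (Lam * rm) p q)) by (apply Rmult_le_pos; lra).
         nra. }
    set (mx := Rmax (Rabs (pm1 H p - pm1 H q)) (Rabs (pm2 H p - pm2 H q))).
    assert (Mx1 : Rabs (pm1 H p - pm1 H q) <= mx) by apply Rmax_l.
    assert (Mx2 : Rabs (pm2 H p - pm2 H q) <= mx) by apply Rmax_r.
    destruct (Rle_lt_dec mx rm) as [Hmx|Hmx].
    - assert (Nr : near H (Lam * rm) p q).
      { destruct (inc_near (T + 1) dp rm _ _ _ _ ltac:(lra) Hdrm (Rle_trans _ _ _ Mx1 Hmx)
          (Rle_trans _ _ _ Mx2 Hmx) Hi) as [B1 B2].
        unfold near; repeat split; nra. }
      rewrite (ind_true (near _ _ _ _)), Rmult_1_r by assumption.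
      enough (om * cnt <= 2 * T + 3) by lra.
      apply Rle_trans with (om * (2 * (T + 1) / om + 1)).
      + apply Rmult_le_compat_l; [lra|].
        eapply Rle_trans; [apply inc_net_count; lra || assumption|].
        fold om; fold (incp H (T + 1) dp p q); rewrite ind_true by assumption; lra.
      + replace (om * (2 * (T + 1) / om + 1)) with (2 * (T + 1) + om) by (field; lra); lra.
    - assert (mx <= / K) by (apply Rmax_lub; assumption).
      assert (Hl0 : / K * (/ 2) ^ lm < mx).
      { assert (0 < (/ 2) ^ lm) by (apply pow_lt; lra); nra. }
      destruct (dyadic_class (/ K) mx lm ltac:(assumption) Hl0) as [l [Hl [L1 L2]]].
      fold (rho l) in L1, L2.
      specialize (Hrho l) as Hrl.
      assert (Tv : transv H (rho l / 2) p q).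
      { unfold transv; revert L1; unfold mx, Rmax; destruct Rle_dec; auto. }
      assert (Mc : mclass H (rho l) (T + 1) dp p q) by (unfold mclass; repeat split; try lra; assumption).
      apply Rle_trans with (wt l * ind (mclass H (rho l) (T + 1) dp p q)).
      + rewrite ind_true, Rmult_1_r by assumption; unfold wt; rewrite ind_true, Rmult_1_l by lra.
        apply Rle_trans with (om * (2 * dp / (rho l / 2) / om + 1)).
        * apply Rmult_le_compat_l; [lra|].
          eapply Rle_trans; [apply (inc_net_count_transversal H u P (T + 1) dp _ _ _ _ (rho l / 2));
            try lra; try assumption; destruct Tv; lra|].
          fold om; fold (incp H (T + 1) dp p q); rewrite ind_true by assumption; lra.
        * replace (om * (2 * dp / (rho l / 2) / om + 1)) with (4 * (dp / rho l) + om) by (field; lra).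
          replace (5 * dp / rho l) with (4 * (dp / rho l) + dp / rho l) by (field; lra).
          apply Rplus_le_compat_l.
          apply Rle_trans with dp; [assumption|].
          rewrite <- (Rmult_1_r dp) at 1; unfold Rdiv; apply Rmult_le_compat_l; [lra|].
          rewrite <- Rinv_1; apply Rinv_le_contravar; lra.
      + assert (0 <= (2 * T + 3) * ind (near H (Lam * rm) p q)) by (apply Rmult_le_pos; lra).
        assert (wt l * ind (mclass H (rho l) (T + 1) dp p q) <=
          lsum (seq 0 lm) (fun l => wt l * ind (mclass H (rho l) (T + 1) dp p q))); [|lra].
        apply (lsum_ge_term (seq 0 lm) (fun l => wt l * ind (mclass H (rho l) (T + 1) dp p q)) l).
        * intros b _; apply Rmult_le_pos; [apply Hwt|apply ind_bound].
        * apply in_seq; lia. }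
  rewrite <- lsum_scal.
  apply Rle_trans with (lsum L (fun p => lsum L (fun q =>
    8 * H * tau + (2 * T + 3) * ind (near H (Lam * rm) p q) +
    lsum (seq 0 lm) (fun l => wt l * ind (mclass H (rho l) (T + 1) dp p q))))).
  { apply lsum_le; intros p Hp; rewrite <- lsum_scal; apply lsum_le; intros q Hq; auto. }
  rewrite (lsum_ext L _ (fun p => INR (length L) * (8 * H * tau) +
     (2 * T + 3) * lsum L (fun q => ind (near H (Lam * rm) p q)) +
     lsum (seq 0 lm) (fun l => wt l * lsum L (fun q => ind (mclass H (rho l) (T + 1) dp p q))))).
  2: { intros p _; rewrite !lsum_plus, lsum_const, lsum_scal; f_equal.
       rewrite lsum_exchange; apply lsum_ext; intros; apply lsum_scal. }
  rewrite !lsum_plus, lsum_const, lsum_scal.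
  apply Rplus_le_compat; [apply Rplus_le_compat|].
  - right; ring.
  - apply Rmult_le_compat_l; [lra|].
    rewrite <- lsum_const; apply lsum_le; intros p _.
    apply near_count; try assumption; try lra; nra.
  - rewrite lsum_exchange.
    set (S := 2 * Lam + 1) in *.
    assert (HS : 1 <= S) by (unfold S; lra).
    apply Rle_trans with (lsum (seq 0 lm) (fun l => (6250 * a * S ^ 7 * dp ^ 2 * W ^ 8 / K ^ 2) * (/ 2) ^ l)).
    + apply lsum_le; intros l _; rewrite lsum_scal.
      assert (0 < (/ 2) ^ l) by (apply pow_lt; lra).
      assert (S7 : 0 <= S ^ 7) by (apply pow_le; lra).
      assert (W8 : 0 < W ^ 8) by (apply pow_lt; lra).
      assert (RHS : 0 <= 6250 * a * S ^ 7 * dp ^ 2 * W ^ 8 / K ^ 2 * (/ 2) ^ l).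
      { apply Rmult_le_pos; [|lra]; apply Rmult_le_pos;
          [|left; apply Rinv_0_lt_compat, pow_lt; lra].
        repeat apply Rmult_le_pos; try lra. }
      unfold wt; destruct (Rle_lt_dec rm (rho l)) as [Hrl|Hrl].
      2: { rewrite ind_false by lra; rewrite !Rmult_0_l; assumption. }
      rewrite (ind_true (rm <= rho l)), Rmult_1_l by assumption.
      destruct (Hrho l) as [Hr0 HrK].
      assert (HKr : K * rho l <= 1).
      { apply Rle_trans with (K * / K); [apply Rmult_le_compat_l; lra|rewrite Rinv_r; lra]. }
      assert (Hcnt := mclass_count h C0 Lam Y a (T + 1) i W L (rho l) dp Hcl Hh Ha ltac:(lra) ltac:(lra)
         HW Hsm Hsp ltac:(lra) ltac:(nra)).
      fold S in Hcnt; fold H in Hcnt.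
      assert (HYi : S * rho l * W <= Y ^ i).
      { apply Rmult_le_reg_l with K; [lra|].
        replace (K * (S * rho l * W)) with ((K * rho l) * (S * W)) by ring.
        apply Rle_trans with (1 * (S * W)); [|lra].
        apply Rmult_le_compat_r; [nra|assumption]. }
      specialize (Hcnt HYi Hdp ltac:(lra)).
      apply Rle_trans with (5 * dp / rho l * ((5 / rho l) ^ 4 * (a *
          ((S * rho l * W) ^ 8 * (dp / (S * rho l)) + (S * rho l * W) ^ 6)))).
      { apply Rmult_le_compat_l; [|assumption].
        apply Rmult_le_pos; [lra|left; apply Rinv_0_lt_compat; assumption]. }
      set (r := rho l) in *.
      replace (5 * dp / r * ((5 / r) ^ 4 * (a *
          ((S * r * W) ^ 8 * (dp / (S * r)) + (S * r * W) ^ 6)))) with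
        (3125 * a * dp * S ^ 6 * r * (S * r * W ^ 8 * dp + W ^ 6)) by (field; lra).
      (* Here [K <= dp W^2] enters: the resolution term of the claim is no worse than the main term
         at [rho = 1/K]. *)
      assert (E1 : W ^ 6 <= W ^ 8 * dp * / K).
      { apply Rmult_le_reg_r with K; [lra|].
        replace (W ^ 8 * dp * / K * K) with (W ^ 6 * (dp * W ^ 2)) by (field; lra).
        apply Rmult_le_compat_l; [apply pow_le; lra|assumption]. }
      assert (E2 : S * r * W ^ 8 * dp + W ^ 6 <= 2 * S * (W ^ 8 * dp * / K)).
      { assert (0 <= W ^ 8 * dp) by (apply Rmult_le_pos; lra).
        assert (S * r * W ^ 8 * dp <= S * (W ^ 8 * dp * / K)).
        { replace (S * r * W ^ 8 * dp) with (S * (W ^ 8 * dp * r)) by ring.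
          apply Rmult_le_compat_l; [lra|]; apply Rmult_le_compat_l; assumption. }
        assert (1 * (W ^ 8 * dp * / K) <= S * (W ^ 8 * dp * / K)).
        { apply Rmult_le_compat_r; [apply Rmult_le_pos; lra|assumption]. }
        lra. }
      apply Rle_trans with (3125 * a * dp * S ^ 6 * r * (2 * S * (W ^ 8 * dp * / K))).
      { apply Rmult_le_compat_l; [|assumption].
        repeat apply Rmult_le_pos; try lra; apply pow_le; lra. }
      right; unfold r, rho; field; lra.
    + rewrite lsum_scal.
      replace (12500 * a * S ^ 7 * dp ^ 2 * W ^ 8 / K ^ 2) with
        ((6250 * a * S ^ 7 * dp ^ 2 * W ^ 8 / K ^ 2) * 2) by (field; lra).
      apply Rmult_le_compat_l; [|apply half_pow_sum].
      apply Rmult_le_pos; [|left; apply Rinv_0_lt_compat, pow_lt; lra].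
      repeat apply Rmult_le_pos; try lra; apply pow_le; lra.
Qed.

(** * One window in [w], and the inductive step *)

Definition window (H u r d : R) (p q : line) : Prop :=
  exists w, Rabs (w - u) <= r /\
    Rabs (pv1 p - pv1 q - w * (pm1 H p - pm1 H q)) <= d /\
    Rabs (pv2 p - pv2 q - w * (pm2 H p - pm2 H q)) <= d.

(** The four terms come from the low frequencies, the tails, the nearly parallel pairs and the
    inductive claim, in this order. *)
Definition window_const (C0 Lam : R) (M : nat) : R :=
  2 * 10 ^ 8 * C0 ^ 2 * INR (S M) ^ 2 + 10 ^ 7 * C0 ^ 2 +
  10 ^ 7 * C0 ^ 2 * Lam ^ 5 + 437500 * (2 * Lam + 1) ^ 7.

(** In the last factor [K^2 B^2] is due to the low frequencies and [a B^2 / K] to the block pairs: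
    their [1 / K^2] times the [O(K)] of orthogonality. [K <= d W^2] and [d K B^2 <= 1] keep the
    nearly parallel pairs below the main term. *)
Lemma window_bound h C0 Lam Y a T i W L M B K u d :
  claim h C0 (/ (2 * Lam + 1)) Y a (T + 1) i ->
  1 <= h -> 0 <= a -> 1 <= C0 -> 0 <= T -> T + 2 <= Lam -> 1 <= W ->
  small (h * W) L -> spaced (h * W) (/ W) C0 L ->
  Rabs u <= T -> T + 1 <= K -> 800 <= B ->
  (2 * Lam + 1) * W <= K * Y ^ i ->
  8 * (h * W) * (/ B) ^ S M * W ^ 4 <= 1 ->
  K <= d * W ^ 2 -> d * (K * B ^ 2) <= 1 ->
  lsum L (fun p => lsum L (fun q => ind (window (h * W) u (/ (4 * B)) d p q))) <=
  64 ^ S M * window_const C0 Lam M * W ^ 8 * d * (K ^ 2 * B ^ 2 + a * B ^ 2 / K).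
Proof.
  intros Hcl Hh Ha HC HT HL HW Hsm Hsp Hu HTK HB HYK Htau HKW HdKB.
  set (H := h * W) in *.
  assert (HK : 1 <= K) by lra.
  assert (HH : 1 <= H) by (unfold H; nra).
  assert (W2 : 1 <= W ^ 2) by nra.
  assert (Hd : 0 < d) by nra.
  assert (HB2 : 800 * B <= B ^ 2) by nra.
  assert (HdB2 : d * B ^ 2 <= 1) by nra.
  assert (Hd4 : d <= / (4 * B)).
  { apply Rmult_le_reg_r with (4 * B); [lra|]; rewrite Rinv_l by lra; nra. }
  assert (Hd1 : d <= / 4) by nra.
  set (tau := (/ B) ^ S M) in *.
  assert (Ht0 : 0 < tau) by (apply pow_lt, Rinv_0_lt_compat; lra).
  (* [n] lies between [1 / (4 d)] and [1 / (2 d)]: the bump in space has width about [d]. *)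
  assert (Hn : exists n : nat, (0 < n)%nat /\ INR n * (2 * d) <= 1 /\ 1 <= INR n * (4 * d)).
  { set (x := / (2 * d)).
    assert (Hx : x * (2 * d) = 1) by (unfold x; rewrite Rinv_l; lra).
    assert (2 <= x) by nra.
    pose proof (floor_bounds x) as Fb.
    assert (0 < Int_part x)%Z by (apply lt_IZR; lra).
    exists (Z.to_nat (Int_part x)); rewrite INR_IZR_INZ, Z2Nat.id by lia.
    repeat split; [lia| |]; nra. }
  destruct Hn as (n & Hn & Hn1 & Hn2).
  (* Degree about [B H] in the variable [w / H] localises [w] to a window of length about [1/B]. *)
  assert (Hnw : exists nw : nat, (0 < nw)%nat /\ B * H <= INR nw <= 2 * B * H).
  { destruct (nat_between (B * H)) as [k [K1 K2]]; [nra|].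
    exists k; split; [apply INR_lt; simpl; nra|nra]. }
  destruct Hnw as (nw & Hnw & Hnw1 & Hnw2).
  set (dl := (S M * n)%nat); set (dg := (S M * nw)%nat).
  (* The degree of [gam] is at most [2 (M + 1) B H], so from [X] of size about [K (M + 1) B] on a
     frequency resolves slopes up to [1/K]. *)
  assert (HX : exists X : Z, (0 < X)%Z /\ K * INR dg <= H * IZR X /\ IZR X <= 3 * K * INR (S M) * B).
  { destruct (archimed (2 * K * INR (S M) * B)) as [A1 A2].
    assert (HM : 1 <= INR (S M)) by (rewrite S_INR; pose proof (pos_INR M); lra).
    assert (Hx : 1 <= K * INR (S M) * B).
    { apply Rle_trans with (1 * 1 * 1); [lra|].
      repeat apply Rmult_le_compat; lra. }
    exists (up (2 * K * INR (S M) * B)); repeat split.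
    - apply lt_IZR; lra.
    - unfold dg; rewrite mult_INR.
      apply Rle_trans with (H * (2 * K * INR (S M) * B)).
      + replace (H * (2 * K * INR (S M) * B)) with (K * INR (S M) * (2 * B * H)) by ring.
        rewrite <- Rmult_assoc; apply Rmult_le_compat_l; [nra|assumption].
      + apply Rmult_le_compat_l; lra.
    - lra. }
  destruct HX as (X & HX & HX1 & HX2).
  (* The summands of this lower bound for [P] ensure a mesh of at most [d] and exclude aliasing. *)
  destruct (nat_between (2 * PI * H / d + 2 * INR dl * H + INR dg)) as [P [HP1 _]].
  { pose proof PI_RGT_0; pose proof (pos_INR dl); pose proof (pos_INR dg).
    assert (0 < 2 * PI * H / d) by (apply Rdiv_lt_0_compat; nra). nra. }
  assert (HPa : 0 < 2 * PI * H / d /\ 0 <= 2 * INR dl * H /\ 0 <= INR dg).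
  { pose proof PI_RGT_0; pose proof (pos_INR dl); repeat split; [|nra|apply pos_INR].
    apply Rdiv_lt_0_compat; nra. }
  assert (HP' : 0 < INR P) by lra.
  assert (HP : (0 < P)%nat) by (apply INR_lt; simpl; lra).
  set (om := 2 * PI * H / INR P).
  assert (Hom0 : 0 < om) by (apply net_step_pos; lra || assumption).
  assert (Hom : om <= d).
  { apply Rmult_le_reg_r with (INR P / d); [apply Rdiv_lt_0_compat; lra|].
    replace (om * (INR P / d)) with (2 * PI * H / d) by (unfold om; field; lra).
    replace (d * (INR P / d)) with (INR P) by (field; lra); lra. }
  set (dp := B * d).
  assert (Hddp : d <= dp).
  { unfold dp; rewrite <- (Rmult_1_l d) at 1; apply Rmult_le_compat_r; lra. }
  assert (Hdp : 0 < dp) by lra.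
  assert (HIB : / B <= 1) by (rewrite <- Rinv_1; apply Rinv_le_contravar; lra).
  assert (HIB0 : 0 < / B) by (apply Rinv_0_lt_compat; lra).
  (* Origin of 800: [50 / (B/4)^2 <= 1/B] means [B >= 800]. *)
  assert (tail : forall x, B / 4 <= x -> (50 / x ^ 2) ^ S M <= tau).
  { intros x Hx; apply pow_incr.
    assert (0 < x ^ 2) by (apply pow_lt; lra).
    split; [left; apply Rdiv_lt_0_compat; lra|].
    apply Rmult_le_reg_r with (x ^ 2 * B); [nra|].
    replace (50 / x ^ 2 * (x ^ 2 * B)) with (50 * B) by (field; nra).
    replace (/ B * (x ^ 2 * B)) with (x ^ 2) by (field; lra).
    apply Rle_trans with ((B / 4) ^ 2); [nra|apply pow_incr; lra]. }
  assert (Ht1 : (50 / (INR nw / H) ^ 2) ^ S M <= tau).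
  { apply tail; apply Rmult_le_reg_r with H; [lra|].
    replace (INR nw / H * H) with (INR nw) by (field; lra); nra. }
  assert (Ht2 : (50 / (INR n * dp) ^ 2) ^ S M <= tau).
  { apply tail; unfold dp; replace (INR n * (B * d)) with (B / 4 * (INR n * (4 * d))) by field; nra. }
  set (l := fpow n M); set (gam := fpow nw M).
  set (A := lsum L (fun p => lsum L (fun q => kern l gam H u P p q))).
  (* A pair incident in the window contributes at least [4^(-3 (M+1)) d / om] to the kernel;
     [64 = 4^3]. *)
  assert (S1 : lsum L (fun p => lsum L (fun q => ind (window H u (/ (4 * B)) d p q))) <=
     64 ^ S M / d * (om * A)).
  { replace (64 ^ S M / d * (om * A)) with (64 ^ S M * (om / d) * A) by (field; lra).
    unfold A; rewrite <- lsum_scal; apply lsum_le; intros p Hp.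
    rewrite <- lsum_scal; apply lsum_le; intros q Hq.
    assert (Kp : 0 <= kern l gam H u P p q) by (apply kern_nonneg; assumption).
    assert (Cp : 0 < 64 ^ S M * (om / d)).
    { apply Rmult_lt_0_compat; [apply pow_lt; lra|apply Rdiv_lt_0_compat; lra]. }
    destruct (excluded_middle_informative (window H u (/ (4 * B)) d p q)) as [(w & A1 & A2 & A3)|N].
    2: { rewrite ind_false by assumption; nra. }
    rewrite ind_true by (exists w; auto).
    destruct (Hsm p q Hp Hq) as (_ & _ & M1 & M2).
    assert (KL : (1 / 4) ^ (3 * S M) * (d / om) <= kern l gam H u P p q).
    { apply (kern_lower n nw M H u P p q w d); auto; try lra.
      apply Rle_trans with (2 * B * H * (/ (4 * B) + / (4 * B))).
      - pose proof (Rabs_pos (w - u)); apply Rmult_le_compat; [apply pos_INR|lra|lra|lra].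
      - right; field; lra. }
    apply Rle_trans with (64 ^ S M * (om / d) * ((1 / 4) ^ (3 * S M) * (d / om))).
    - right; rewrite pow_mult.
      replace (64 ^ S M * (om / d) * (((1 / 4) ^ 3) ^ S M * (d / om))) with
        (64 ^ S M * ((1 / 4) ^ 3) ^ S M) by (field; lra).
      rewrite <- Rpow_mult_distr; replace (64 * (1 / 4) ^ 3) with 1 by field; rewrite pow1; reflexivity.
    - apply Rmult_le_compat_l; lra. }
  eapply Rle_trans; [exact S1|].
  set (N := INR (length L)).
  assert (HN : 0 <= N) by apply pos_INR.
  set (nn := Z.to_nat (Int_part (2 * K) + 3)).
  assert (Hnn : INR nn <= 5 * K) by (apply floor_range_length; assumption).
  set (Bs := lsum L (fun p => lsum L (fun q =>
     ind (mlab H K p = mlab H K q) * kern l gam H u P p q))).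
  assert (HBs : 0 <= Bs).
  { apply lsum_nonneg; intros p _; apply lsum_nonneg; intros q _.
    apply Rmult_le_pos; [apply ind_bound|apply kern_nonneg; assumption]. }
  assert (Hdp1 : dp <= 1) by (unfold dp; nra).
  (* Below [1/W] the spacing gives no information, and below [dp] transversality gives none. *)
  set (rm := Rmax (/ W) dp).
  assert (HWi : 0 < / W) by (apply Rinv_0_lt_compat; lra).
  assert (S3 := block_pairs_sum h C0 Lam Y a T i W L n nw M u P K dp tau rm Hcl ltac:(lra) Ha ltac:(lra)
     HT HL HW Hsm Hsp Hn Hnw HP Hdp ltac:(lra) Hu HTK HK Ht1 Ht2).
  fold H in S3; fold om in S3; fold l in S3; fold gam in S3; fold Bs in S3; fold N in S3.
  specialize (S3 ltac:(lra) Hdp1 ltac:(apply Rmax_r)).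
  assert (HrmW : 1 <= rm * W).
  { apply Rle_trans with (/ W * W); [rewrite Rinv_l; lra|].
    apply Rmult_le_compat_r; [lra|apply Rmax_l]. }
  assert (HKdp : K <= dp * W ^ 2).
  { apply Rle_trans with (d * W ^ 2); [assumption|]; apply Rmult_le_compat_r; [lra|assumption]. }
  specialize (S3 HrmW HYK HKdp).
  assert (S2 : om * A <= 256 * (IZR X) ^ 2 * d ^ 2 * N ^ 2 + 35 * K * (om * Bs)).
  { assert (Hcase : L = [] \/ exists p0, In p0 L).
    { destruct L as [|p0 L0]; [left; reflexivity|right; exists p0; left; reflexivity]. }
    destruct Hcase as [EL|[p0 Hp0]].
    { replace A with 0 by (unfold A; rewrite EL; reflexivity).
      rewrite Rmult_0_r; nonneg. }
    assert (KE := kern_energy l dl (/ INR n) gam dg (/ INR nw) H u P X K L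
       (Int_part (K * pm1 H p0 - K)) (Int_part (K * pm2 H p0 - K)) nn
       (fpow_good n M Hn) (fpow_good nw M Hnw)
       (fun x => proj1 (fpow_bound nw M x Hnw)) ltac:(lra) ltac:(lra) HP HX HX1).
    assert (Lab : forall p, In p L -> In (mlab H K p)
       (list_prod (zr (Int_part (K * pm1 H p0 - K)) nn) (zr (Int_part (K * pm2 H p0 - K)) nn))).
    { intros p Hp; destruct (Hsm p p0 Hp Hp0) as (_ & _ & M1 & M2).
      apply in_prod_iff; split; apply floor_range; try lra;
        rewrite <- Rmult_minus_distr_l, Rabs_mult, (Rabs_pos_eq K) by lra; nra. }
    specialize (KE Lab).
    match type of KE with (?PP -> _) => assert (HPP : PP) end.
    { intros k1 k2 p q H1 H2 Hp Hq.
      destruct (Hsm p q Hp Hq) as (_ & _ & M1 & M2).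
      assert (Dz : forall z z' : Z, Rabs (IZR z / H - IZR z' / H) <= 1 -> Rabs (IZR (z - z')) <= H).
      { intros z z' Hz; replace (IZR z / H - IZR z' / H) with (IZR (z - z') * / H) in Hz
          by (rewrite minus_IZR; field; lra).
        rewrite Rabs_mult, (Rabs_pos_eq (/ H)) in Hz by (left; apply Rinv_0_lt_compat; lra).
        apply Rmult_le_reg_r with (/ H); [apply Rinv_0_lt_compat; lra|]; rewrite Rinv_r; lra. }
      apply Dz in M1; apply Dz in M2.
      apply IZR_le in H1; apply IZR_le in H2; rewrite abs_IZR, <- INR_IZR_INZ in H1, H2.
      apply lt_IZR; rewrite plus_IZR, abs_IZR, <- !INR_IZR_INZ, plus_IZR, !mult_IZR.
      eapply Rle_lt_trans; [apply Rplus_le_compat_r, Rabs_triang|]; rewrite !Rabs_mult.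
      assert (Rabs (IZR k1) * Rabs (IZR (fst (snd p) - fst (snd q))) <= INR dl * H)
        by (apply Rmult_le_compat; auto; apply Rabs_pos).
      assert (Rabs (IZR k2) * Rabs (IZR (snd (snd p) - snd (snd q))) <= INR dl * H)
        by (apply Rmult_le_compat; auto; apply Rabs_pos).
      lra. }
    specialize (KE HPP); clear HPP; fold A in KE; fold Bs in KE; fold N in KE.
    assert (GM := gam_mass nw M H P tau Hnw HP ltac:(lra) ltac:(lra) Ht1).
    fold gam in GM; fold om in GM.
    set (Gs := lsum (zr 0 P) (fun j => ev gam (net P j))) in *.
    assert (HG : om * Gs <= 4).
    { apply Rle_trans with (om * (2 / om + 1 + INR P * tau)); [apply Rmult_le_compat_l; lra|].
      replace (om * (2 / om + 1 + INR P * tau)) with (2 + om + 2 * PI * (H * tau)) by (unfold om; field; split; [lra|pose proof PI_RGT_0; lra]).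
      assert (W4 : 1 <= W ^ 4) by (rewrite <- (pow1 4); apply pow_incr; lra).
      assert (0 < H * tau) by nra.
      assert (8 * (H * tau) <= 1) by nra.
      assert (2 * PI * (H * tau) <= 8 * (H * tau))
        by (pose proof PI_4; apply Rmult_le_compat_r; lra).
      lra. }
    apply Rle_trans with (om * ((2 * IZR X * / INR n) ^ 2 * (N ^ 2 * Gs) + 7 * INR nn * Bs)).
    { apply Rmult_le_compat_l; lra. }
    rewrite Rmult_plus_distr_l; apply Rplus_le_compat.
    - replace (om * ((2 * IZR X * / INR n) ^ 2 * (N ^ 2 * Gs))) with
        ((2 * IZR X * / INR n) ^ 2 * N ^ 2 * (om * Gs)) by ring.
      replace (256 * IZR X ^ 2 * d ^ 2 * N ^ 2) with ((2 * IZR X * (4 * d)) ^ 2 * N ^ 2 * 4) by ring.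
      assert (0 <= N ^ 2) by apply pow2_ge_0.
      assert (Hn' : 0 < INR n) by (apply lt_0_INR; lia).
      assert (HXp : 0 < IZR X) by (apply IZR_lt; assumption).
      assert (In1 : / INR n <= 4 * d).
      { apply Rmult_le_reg_l with (INR n); [assumption|]; rewrite Rinv_r; lra. }
      assert (0 < / INR n) by (apply Rinv_0_lt_compat; assumption).
      assert (Q : (2 * IZR X * / INR n) ^ 2 <= (2 * IZR X * (4 * d)) ^ 2) by (apply pow_incr; split;
        [apply Rmult_le_pos; lra|apply Rmult_le_compat_l; lra]).
      pose proof (pow2_ge_0 (2 * IZR X * / INR n)).
      apply Rle_trans with ((2 * IZR X * / INR n) ^ 2 * N ^ 2 * 4).
      + apply Rmult_le_compat_l; [apply Rmult_le_pos; assumption|assumption].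
      + apply Rmult_le_compat_r; [lra|]; apply Rmult_le_compat_r; assumption.
    - replace (om * (7 * INR nn * Bs)) with (7 * INR nn * (om * Bs)) by ring.
      apply Rmult_le_compat_r; [apply Rmult_le_pos; lra|lra]. }
  assert (HN1 : N <= 256 * C0 * W ^ 4) by (apply (small_length H); lra || assumption).
  assert (W4 : 1 <= W ^ 4) by (rewrite <- (pow1 4); apply pow_incr; lra).
  assert (W8 : 1 <= W ^ 8) by (rewrite <- (pow1 8); apply pow_incr; lra).
  assert (HN2 : N ^ 2 <= 65536 * C0 ^ 2 * W ^ 8).
  { replace (65536 * C0 ^ 2 * W ^ 8) with ((256 * C0 * W ^ 4) ^ 2) by ring.
    apply pow_incr; lra. }
  set (Q := W ^ 8 * d ^ 2).
  assert (HQ : 0 < Q) by (unfold Q; apply Rmult_lt_0_compat; [lra|apply pow_lt; assumption]).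
  assert (HM0 : 0 < INR (S M)) by (apply lt_0_INR; lia).
  assert (D2 : 0 < d ^ 2) by (apply pow_lt; assumption).
  assert (T1 : 256 * (IZR X) ^ 2 * d ^ 2 * N ^ 2 <=
     2 * 10 ^ 8 * C0 ^ 2 * INR (S M) ^ 2 * (K ^ 2 * B ^ 2) * Q).
  { assert (HXp : 0 < IZR X) by (apply IZR_lt; assumption).
    assert (X2 : IZR X ^ 2 <= (3 * K * INR (S M) * B) ^ 2) by (apply pow_incr; lra).
    assert (E : IZR X ^ 2 * N ^ 2 <= (3 * K * INR (S M) * B) ^ 2 * (65536 * C0 ^ 2 * W ^ 8)).
    { apply Rmult_le_compat; try assumption; apply pow2_ge_0. }
    apply Rle_trans with (256 * d ^ 2 * ((3 * K * INR (S M) * B) ^ 2 * (65536 * C0 ^ 2 * W ^ 8))).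
    - replace (256 * IZR X ^ 2 * d ^ 2 * N ^ 2) with (256 * d ^ 2 * (IZR X ^ 2 * N ^ 2)) by ring.
      apply Rmult_le_compat_l; lra.
    - unfold Q.
      replace (256 * d ^ 2 * ((3 * K * INR (S M) * B) ^ 2 * (65536 * C0 ^ 2 * W ^ 8))) with
        (150994944 * (C0 ^ 2 * INR (S M) ^ 2 * (K ^ 2 * B ^ 2) * (W ^ 8 * d ^ 2))) by ring.
      replace (2 * 10 ^ 8 * C0 ^ 2 * INR (S M) ^ 2 * (K ^ 2 * B ^ 2) * (W ^ 8 * d ^ 2)) with
        (200000000 * (C0 ^ 2 * INR (S M) ^ 2 * (K ^ 2 * B ^ 2) * (W ^ 8 * d ^ 2))) by ring.
      apply Rmult_le_compat_r; [|lra].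
      nonneg. }
  assert (Dl : K ^ 2 <= d ^ 2 * W ^ 4).
  { replace (d ^ 2 * W ^ 4) with ((d * W ^ 2) ^ 2) by ring; apply pow_incr; lra. }
  assert (T2 : 35 * K * (N ^ 2 * (8 * H * tau)) <= 10 ^ 7 * C0 ^ 2 * Q).
  { assert (Et : K * (8 * H * tau) <= d ^ 2).
    { apply Rmult_le_reg_r with (W ^ 4); [lra|].
      replace (K * (8 * H * tau) * W ^ 4) with (K * (8 * H * tau * W ^ 4)) by ring. nra. }
    replace (35 * K * (N ^ 2 * (8 * H * tau))) with (35 * (N ^ 2 * (K * (8 * H * tau)))) by ring.
    assert (E : N ^ 2 * (K * (8 * H * tau)) <= 65536 * C0 ^ 2 * W ^ 8 * d ^ 2).
    { apply Rmult_le_compat; try assumption; [apply pow2_ge_0|].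
      nonneg. }
    unfold Q; assert (0 <= C0 ^ 2 * (W ^ 8 * d ^ 2)) by (nonneg).
    nra. }
  assert (T3 : 35 * K * ((2 * T + 3) * (N * (C0 * (4 * (Lam * rm * W)) ^ 4))) <= 10 ^ 7 * C0 ^ 2 * Lam ^ 5 * Q).
  { assert (Hr4 : K * (rm * W) ^ 4 * W ^ 4 <= 2 * Q).
    { assert (E1 : K * W ^ 4 <= Q).
      { unfold Q; replace (W ^ 8 * d ^ 2) with (d ^ 2 * W ^ 4 * W ^ 4) by ring.
        apply Rmult_le_compat_r; [lra|]; apply Rle_trans with (K ^ 2); [|assumption].
        rewrite <- (pow_1 K) at 1; apply Rle_pow; [assumption|lia]. }
      assert (E2 : K * (dp * W) ^ 4 * W ^ 4 <= Q).
      { unfold Q, dp.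
        replace (K * (B * d * W) ^ 4 * W ^ 4) with (W ^ 8 * d ^ 2 * (K * (d * B ^ 2) ^ 2)) by ring.
        assert (K * (d * B ^ 2) ^ 2 <= 1).
        { assert (0 <= d * B ^ 2) by nra. nra. }
        fold Q; rewrite <- (Rmult_1_r Q) at 2; apply Rmult_le_compat_l; lra. }
      unfold rm, Rmax; destruct Rle_dec as [Hle|Hle].
      - lra.
      - replace (/ W * W) with 1 by (field; lra); rewrite pow1; lra. }
    replace (35 * K * ((2 * T + 3) * (N * (C0 * (4 * (Lam * rm * W)) ^ 4)))) with
      (8960 * (2 * T + 3) * C0 * Lam ^ 4 * (N * (K * (rm * W) ^ 4))) by ring.
    assert (HLm : 0 <= Lam ^ 4) by (apply pow_le; lra).
    assert (Pk : 0 <= K * (rm * W) ^ 4) by (apply Rmult_le_pos; [lra|apply pow_le; lra]).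
    apply Rle_trans with (8960 * (2 * T + 3) * C0 * Lam ^ 4 * (256 * C0 * (2 * Q))).
    - apply Rmult_le_compat_l; [nonneg|].
      apply Rle_trans with (256 * C0 * W ^ 4 * (K * (rm * W) ^ 4)); [apply Rmult_le_compat_r; assumption|].
      replace (256 * C0 * W ^ 4 * (K * (rm * W) ^ 4)) with (256 * C0 * (K * (rm * W) ^ 4 * W ^ 4)) by ring.
      apply Rmult_le_compat_l; lra.
    - replace (8960 * (2 * T + 3) * C0 * Lam ^ 4 * (256 * C0 * (2 * Q))) with
        ((4587520 * (2 * T + 3)) * (C0 ^ 2 * Lam ^ 4 * Q)) by ring.
      replace (10 ^ 7 * C0 ^ 2 * Lam ^ 5 * Q) with ((10000000 * Lam) * (C0 ^ 2 * Lam ^ 4 * Q)) by ring.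
      apply Rmult_le_compat_r; [|lra].
      nonneg. }
  assert (T4 : 35 * K * (12500 * a * (2 * Lam + 1) ^ 7 * dp ^ 2 * W ^ 8 / K ^ 2) =
     437500 * (2 * Lam + 1) ^ 7 * (a * B ^ 2 / K) * Q).
  { unfold Q, dp; field; lra. }
  assert (KB1 : 1 <= K ^ 2 * B ^ 2).
  { rewrite <- Rpow_mult_distr, <- (pow1 2); apply pow_incr; split; [lra|].
    rewrite <- (Rmult_1_r 1) at 1; apply Rmult_le_compat; lra. }
  assert (aK : 0 <= a * B ^ 2 / K).
  { apply Rmult_le_pos; [apply Rmult_le_pos; [lra|apply pow2_ge_0]|left; apply Rinv_0_lt_compat; lra]. }
  assert (Fin : om * A <= window_const C0 Lam M * Q * (K ^ 2 * B ^ 2 + a * B ^ 2 / K)).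
  { apply Rle_trans with (2 * 10 ^ 8 * C0 ^ 2 * INR (S M) ^ 2 * (K ^ 2 * B ^ 2) * Q +
      10 ^ 7 * C0 ^ 2 * Q + 10 ^ 7 * C0 ^ 2 * Lam ^ 5 * Q +
      437500 * (2 * Lam + 1) ^ 7 * (a * B ^ 2 / K) * Q).
    - eapply Rle_trans; [exact S2|].
      assert (35 * K * (om * Bs) <= 35 * K * (N ^ 2 * (8 * H * tau) +
         (2 * T + 3) * (N * (C0 * (4 * (Lam * rm * W)) ^ 4)) +
         12500 * a * (2 * Lam + 1) ^ 7 * dp ^ 2 * W ^ 8 / K ^ 2)) as S4
        by (apply Rmult_le_compat_l; lra).
      rewrite !Rmult_plus_distr_l, T4 in S4; lra.
    - unfold window_const.
      set (g := K ^ 2 * B ^ 2) in *; set (f := a * B ^ 2 / K) in *.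
      set (c1 := 2 * 10 ^ 8 * C0 ^ 2 * INR (S M) ^ 2).
      set (c2 := 10 ^ 7 * C0 ^ 2); set (c3 := c2 * Lam ^ 5); set (c4 := 437500 * (2 * Lam + 1) ^ 7).
      assert (P1 : 0 <= c1) by (unfold c1; nonneg).
      assert (P2 : 0 <= c2) by (unfold c2; apply Rmult_le_pos; [apply pow_le; lra|apply pow2_ge_0]).
      assert (P3 : 0 <= c3) by (unfold c3; apply Rmult_le_pos; [assumption|apply pow_le; lra]).
      assert (P4 : 0 <= c4) by (unfold c4; apply Rmult_le_pos; [lra|apply pow_le; lra]).
      replace (c1 * g * Q + c2 * Q + c3 * Q + c4 * f * Q) with (Q * (c1 * g + c2 + c3 + c4 * f)) by ring.
      replace ((c1 + c2 + c3 + c4) * Q * (g + f)) with (Q * ((c1 + c2 + c3 + c4) * (g + f))) by ring.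
      apply Rmult_le_compat_l; [lra|].
      assert (Scale : forall c, 0 <= c -> c <= c * g).
      { intros c Hc; rewrite <- (Rmult_1_r c) at 1; apply Rmult_le_compat_l; assumption. }
      pose proof (Scale c2 P2); pose proof (Scale c3 P3).
      assert (0 <= c1 * f) by (apply Rmult_le_pos; assumption).
      assert (0 <= c2 * f) by (apply Rmult_le_pos; assumption).
      assert (0 <= c3 * f) by (apply Rmult_le_pos; assumption).
      assert (0 <= c4 * g) by (apply Rmult_le_pos; lra).
      lra. }
  apply Rle_trans with (64 ^ S M / d * (window_const C0 Lam M * Q * (K ^ 2 * B ^ 2 + a * B ^ 2 / K))).
  - apply Rmult_le_compat_l; [|assumption].
    left; apply Rdiv_lt_0_compat; [apply pow_lt; lra|assumption].
  - right; unfold Q; field; lra.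
Qed.

(** The first term accounts for the at most [20 B Lam] windows, with [B] kept apart; the second is
    the trivial bound by the number of all pairs. *)
Definition step_const (C0 Lam : R) (M : nat) : R :=
  20 * Lam * 64 ^ S M * window_const C0 Lam M + 65536 * C0 ^ 2.

Lemma window_const_pos C0 Lam M : 0 <= Lam -> 0 < window_const C0 Lam M.
Proof.
  intros HL; unfold window_const.
  assert (0 < (2 * Lam + 1) ^ 7) by (apply pow_lt; lra).
  assert (0 <= 2 * 10 ^ 8 * C0 ^ 2 * INR (S M) ^ 2) by nonneg.
  assert (0 <= 10 ^ 7 * C0 ^ 2) by nonneg.
  assert (0 <= 10 ^ 7 * C0 ^ 2 * Lam ^ 5) by nonneg.
  lra.
Qed.

Lemma step_const_ge C0 Lam M : 0 <= Lam -> 65536 * C0 ^ 2 <= step_const C0 Lam M.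
Proof.
  intro HL; unfold step_const; pose proof (window_const_pos C0 Lam M HL).
  assert (0 <= 20 * Lam * 64 ^ S M * window_const C0 Lam M) by nonneg; lra.
Qed.

Lemma small_count_trivial h C0 eta T W L d :
  1 <= W -> 0 <= C0 -> small (h * W) L -> spaced (h * W) (/ W) C0 L ->
  count (h * W) eta L T d <= 65536 * C0 ^ 2 * W ^ 8.
Proof.
  intros HW HC Hsm Hsp; eapply Rle_trans; [apply count_le_square|].
  replace (65536 * C0 ^ 2 * W ^ 8) with ((256 * C0 * W ^ 4) ^ 2) by ring.
  apply pow_incr; split; [apply pos_INR|].
  apply (small_length (h * W)); assumption.
Qed.

(** The range [|w| <= T] is cut into windows about the points [t / (4 B)]. Raising [d] to
    [d1 >= K / W^2] costs at most a factor [K] against the maximum in the claim, which the [1/K] of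
    [window_bound] repays on the term with [a]. The smaller scale needs [T + 2]: one unit for the
    window centres, one for the width of the kernel. *)
Lemma claim_step h C0 Lam Y a T i M B K :
  claim h C0 (/ (2 * Lam + 1)) Y a (T + 2) i ->
  1 <= h -> 0 <= a -> 1 <= C0 -> 0 <= T -> T + 3 <= Lam -> T + 2 <= K -> 800 <= B ->
  (2 * Lam + 1) * Y = K -> 1 <= Y ->
  8 * h * (Y ^ S i) ^ 5 * (/ B) ^ S M <= 1 ->
  claim h C0 (/ (2 * Lam + 1)) Y (step_const C0 Lam M * (K ^ 3 * B ^ 3 + a * B ^ 3)) T (S i).
Proof.
  intros Hcl Hh Ha HC HT HL HTK HB HY HY1 Htau W L HW HWY Hsm Hsp d Hd.
  assert (HK : 1 <= K) by lra.
  assert (W2 : 0 < W ^ 2) by (apply pow_lt; lra).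
  assert (W2i : 0 < / W ^ 2) by (apply Rinv_0_lt_compat; assumption).
  assert (W8 : 0 < W ^ 8) by (apply pow_lt; lra).
  set (mx := Rmax d (/ W ^ 2)).
  assert (Mx1 : d <= mx) by apply Rmax_l.
  assert (Mx2 : / W ^ 2 <= mx) by apply Rmax_r.
  set (d1 := Rmax d (K * / W ^ 2)).
  assert (D1 : d <= d1) by apply Rmax_l.
  assert (D2 : K * / W ^ 2 <= d1) by apply Rmax_r.
  assert (D3 : d1 <= K * mx) by (apply Rmax_lub; nra).
  assert (Hd1 : 0 < d1) by lra.
  pose proof (window_const_pos C0 Lam M ltac:(lra)) as WC.
  assert (B2 : 1 <= B ^ 2) by nra.
  assert (B3 : 1 <= B ^ 3) by (rewrite <- (pow1 3); apply pow_incr; lra).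
  assert (K3 : 1 <= K ^ 3) by (rewrite <- (pow1 3); apply pow_incr; lra).
  (* If [d1] exceeds [1 / (K B^2)], the asserted bound already exceeds the trivial one. *)
  destruct (Rle_lt_dec (d1 * (K * B ^ 2)) 1) as [Hsmall|Hbig].
  - eapply Rle_trans; [apply (count_mono _ _ _ _ d d1 D1)|].
    set (H := h * W) in *.
    set (nn := Z.to_nat (Int_part (2 * (4 * B * (T + 1))) + 3)).
    set (ts := zr (Int_part (0 - 4 * B * (T + 1))) nn).
    set (g := fun (t : Z) p q => ind (Rabs (IZR t * / (4 * B)) <= T + 1) *
                          ind (window H (IZR t * / (4 * B)) (/ (4 * B)) d1 p q)).
    assert (Hg : forall t p q, 0 <= g t p q)
      by (intros; apply Rmult_le_pos; apply ind_bound).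
    assert (HBi : 0 < / (4 * B)) by (apply Rinv_0_lt_compat; lra).
    assert (HBi1 : / (4 * B) <= 1) by (rewrite <- Rinv_1; apply Rinv_le_contravar; lra).
    apply Rle_trans with (lsum ts (fun t => lsum L (fun p => lsum L (fun q => g t p q)))).
    { rewrite lsum_exchange; apply lsum_le; intros p _.
      rewrite lsum_exchange; apply lsum_le; intros q _.
      destruct (excluded_middle_informative (transv H (/ (2 * Lam + 1) / 2) p q /\ incp H T d1 p q))
        as [[A1 (w & A2 & A3 & A4)]|N].
      2: { rewrite ind_false by assumption; apply lsum_nonneg; auto. }
      rewrite ind_true by (split; [assumption|exists w; auto]).
      set (t := Int_part (4 * B * w)).
      assert (Ht : In t ts).
      { apply floor_range; [nra|].
        rewrite Rminus_0_r, Rabs_mult, (Rabs_pos_eq (4 * B)) by lra.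
        apply Rmult_le_compat_l; lra. }
      pose proof (floor_bounds (4 * B * w)) as Fb; fold t in Fb.
      assert (Hw : w = (4 * B * w) * / (4 * B)) by (field; lra).
      assert (Hwt : Rabs (w - IZR t * / (4 * B)) <= / (4 * B)).
      { rewrite Hw at 1; rewrite <- Rmult_minus_distr_r, Rabs_mult, (Rabs_pos_eq (/ (4 * B))) by lra.
        rewrite <- (Rmult_1_l (/ (4 * B))) at 2; apply Rmult_le_compat_r; [lra|apply Rabs_le; lra]. }
      apply Rle_trans with (g t p q); [|apply (lsum_ge_term ts (fun t => g t p q)); auto].
      unfold g; rewrite !ind_true; [lra| |].
      - exists w; auto.
      - replace (IZR t * / (4 * B)) with (w + - (w - IZR t * / (4 * B))) by ring.
        eapply Rle_trans; [apply Rabs_triang|]; rewrite Rabs_Ropp; lra. }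
    set (E := 64 ^ S M * window_const C0 Lam M * W ^ 8 * d1 * (K ^ 2 * B ^ 2 + a * B ^ 2 / K)).
    assert (HaK : 0 <= a * B ^ 2 / K).
    { apply Rmult_le_pos; [nonneg|left; apply Rinv_0_lt_compat; lra]. }
    assert (HE : 0 <= E) by (unfold E; nonneg).
    apply Rle_trans with (lsum ts (fun _ => E)).
    { apply lsum_le; intros t _; unfold g.
      rewrite (lsum_ext L _ (fun p => ind (Rabs (IZR t * / (4 * B)) <= T + 1) *
         lsum L (fun q => ind (window H (IZR t * / (4 * B)) (/ (4 * B)) d1 p q))))
        by (intros; apply lsum_scal).
      rewrite lsum_scal.
      destruct (excluded_middle_informative (Rabs (IZR t * / (4 * B)) <= T + 1)) as [Hu|Nu].
      2: { rewrite ind_false by assumption; rewrite Rmult_0_l; assumption. }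
      rewrite ind_true, Rmult_1_l by assumption.
      apply (window_bound h C0 Lam Y a (T + 1) i); auto; try lra.
      - replace (T + 1 + 1) with (T + 2) by ring; assumption.
      (* One step shortens the scale by [Y]; the dilation factor [2 Lam + 1] is paid from
         [K = (2 Lam + 1) Y]. *)
      - apply Rle_trans with ((2 * Lam + 1) * (Y * Y ^ i)); [apply Rmult_le_compat_l; [lra|exact HWY]|].
        right; rewrite <- HY; ring.
      - eapply Rle_trans; [|exact Htau]; unfold H.
        replace (8 * (h * W) * (/ B) ^ S M * W ^ 4) with (8 * h * W ^ 5 * (/ B) ^ S M) by ring.
        apply Rmult_le_compat_r; [apply pow_le; left; apply Rinv_0_lt_compat; lra|].
        apply Rmult_le_compat_l; [lra|]; apply pow_incr; lra.
      - apply Rle_trans with (K * / W ^ 2 * W ^ 2); [right; field; lra|].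
        apply Rmult_le_compat_r; lra. }
    rewrite lsum_const; unfold ts; rewrite length_zr.
    assert (Hnn : INR nn <= 5 * (4 * B * (T + 1))) by (apply floor_range_length; nra).
    apply Rle_trans with (20 * B * Lam * E).
    { apply Rmult_le_compat_r; [assumption|].
      apply Rle_trans with (20 * B * (T + 1)); [lra|]; apply Rmult_le_compat_l; lra. }
    unfold E, step_const; fold mx.
    set (c := 64 ^ S M * window_const C0 Lam M).
    assert (Hc : 0 <= c) by (unfold c; nonneg).
    apply Rle_trans with (20 * B * Lam * (c * W ^ 8 * (K * mx) * (K ^ 2 * B ^ 2 + a * B ^ 2 / K))).
    { apply Rmult_le_compat_l; [nonneg|].
      apply Rmult_le_compat_r; [nonneg|].
      apply Rmult_le_compat_l; [nonneg|assumption]. }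
    replace (20 * B * Lam * (c * W ^ 8 * (K * mx) * (K ^ 2 * B ^ 2 + a * B ^ 2 / K))) with
      ((20 * Lam * c) * (K ^ 3 * B ^ 3 + a * B ^ 3) * W ^ 8 * mx) by (field; lra).
    apply Rmult_le_compat_r; [lra|]; apply Rmult_le_compat_r; [lra|].
    apply Rmult_le_compat_r; [nonneg|].
    unfold c; rewrite <- !Rmult_assoc.
    assert (0 <= 65536 * C0 ^ 2) by nonneg; lra.
  - eapply Rle_trans; [apply (small_count_trivial h C0); lra || assumption|].
    pose proof (step_const_ge C0 Lam M ltac:(lra)) as SC.
    assert (P0 : 0 <= 65536 * C0 ^ 2) by nonneg.
    fold mx.
    assert (Hm : 1 <= (K ^ 3 * B ^ 3 + a * B ^ 3) * mx).
    { assert (E1 : 1 <= K ^ 2 * B ^ 2 * mx) by nra.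
      assert (E2 : K ^ 2 * B ^ 2 * mx <= K ^ 3 * B ^ 3 * mx).
      { apply Rmult_le_compat_r; [lra|].
        replace (K ^ 3 * B ^ 3) with (K ^ 2 * B ^ 2 * (K * B)) by ring.
        assert (1 <= K * B) by nra. assert (0 <= K ^ 2 * B ^ 2) by nonneg. nra. }
      assert (0 <= a * B ^ 3 * mx) by nonneg.
      rewrite Rmult_plus_distr_r; lra. }
    replace (step_const C0 Lam M * (K ^ 3 * B ^ 3 + a * B ^ 3) * W ^ 8 * mx) with
      (step_const C0 Lam M * W ^ 8 * ((K ^ 3 * B ^ 3 + a * B ^ 3) * mx)) by ring.
    rewrite <- (Rmult_1_r (65536 * C0 ^ 2 * W ^ 8)).
    apply Rmult_le_compat; [nonneg|lra| |assumption].
    apply Rmult_le_compat_r; lra.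
Qed.

Lemma claim_mono h C0 eta Y a a' T i :
  a <= a' -> claim h C0 eta Y a T i -> claim h C0 eta Y a' T i.
Proof.
  intros Ha Hcl W L HW HWY Hsm Hsp d Hd; eapply Rle_trans; [apply Hcl; assumption|].
  rewrite !Rmult_assoc; apply Rmult_le_compat_r; [|assumption].
  apply Rmult_le_pos; [apply pow_le; lra|].
  pose proof (Rmax_l d (/ W ^ 2)); lra.
Qed.

(** The time range [2 (I - i) + 1] ends at 1 for [i = I] and never exceeds [Lam - 3]. The factor
    [K^3] does not accumulate: at each step the fresh [K^3] is dominated by the previous bound [a],
    which costs a factor 2. *)
Lemma claim_all C0 (I M : nat) h Y B K :
  let Lam := 2 * INR I + 4 in
  let Cs := step_const C0 Lam M in
  1 <= h -> 1 <= C0 -> 2 * INR I + 3 <= K -> 800 <= B -> (2 * Lam + 1) * Y = K -> 1 <= Y ->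
  8 * h * (Y ^ I) ^ 5 * (/ B) ^ S M <= 1 ->
  forall i, (i <= I)%nat ->
  claim h C0 (/ (2 * Lam + 1)) Y ((2 * Cs) ^ S i * K ^ 3 * B ^ (3 * S i)) (2 * INR (I - i) + 1) i.
Proof.
  intros Lam Cs Hh HC HK HB HY HY1 Htau.
  pose proof (pos_INR I) as HI.
  assert (HLam : 4 <= Lam) by (unfold Lam; lra).
  pose proof (step_const_ge C0 Lam M ltac:(lra)) as SC; fold Cs in SC.
  assert (C2 : 1 <= C0 ^ 2) by nra.
  assert (HCs : 1 <= Cs) by lra.
  assert (K3 : 1 <= K ^ 3) by (rewrite <- (pow1 3); apply pow_incr; lra).
  assert (B1 : forall k, 1 <= B ^ k) by (intro k; rewrite <- (pow1 k); apply pow_incr; lra).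
  assert (Cp : forall k, 1 <= (2 * Cs) ^ k) by (intro k; rewrite <- (pow1 k); apply pow_incr; lra).
  induction i as [|i IH]; intro Hi.
  - intros W L HW HW1 Hsm Hsp d Hd.
    (* Only [W = 1] occurs at the bottom, and there [1 / W^2 = 1] makes the trivial bound
       sufficient. *)
    simpl in HW1; replace W with 1 in * by lra.
    eapply Rle_trans; [apply (small_count_trivial h C0); lra || assumption|].
    pose proof (Rmax_r d (/ 1 ^ 2)) as Hm; rewrite pow1 in Hm; rewrite Rinv_1 in Hm.
    rewrite !pow1, !Rmult_1_r; rewrite Rinv_1.
    assert (E : 2 * Cs <= (2 * Cs) ^ 1 * K ^ 3 * B ^ (3 * 1)).
    { rewrite pow_1; specialize (B1 (3 * 1)%nat).
      replace (2 * Cs * K ^ 3 * B ^ (3 * 1)) with (2 * Cs * (K ^ 3 * B ^ (3 * 1))) by ring.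
      assert (1 <= K ^ 3 * B ^ (3 * 1)) by nra; nra. }
    nra.
  - specialize (IH ltac:(lia)).
    assert (ET : 2 * INR (I - i) + 1 = (2 * INR (I - S i) + 1) + 2).
    { replace (I - i)%nat with (S (I - S i)) by lia; rewrite S_INR; ring. }
    rewrite ET in IH.
    set (a := (2 * Cs) ^ S i * K ^ 3 * B ^ (3 * S i)) in *.
    assert (Ha : 1 <= a /\ K ^ 3 <= a).
    { assert (1 <= (2 * Cs) ^ S i * B ^ (3 * S i)).
      { rewrite <- (Rmult_1_r 1) at 1; apply Rmult_le_compat; try lra; auto. }
      assert (a = K ^ 3 * ((2 * Cs) ^ S i * B ^ (3 * S i))) by (unfold a; ring).
      split; nra. }
    assert (HIi : INR (I - S i) <= INR I - 1).
    { apply Rle_trans with (INR (I - 1)); [apply le_INR; lia|].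
      rewrite minus_INR by lia; simpl; lra. }
    pose proof (pos_INR (I - S i)) as Hpos.
    apply claim_mono with (a := Cs * (K ^ 3 * B ^ 3 + a * B ^ 3)).
    + apply Rle_trans with (Cs * (a * B ^ 3 + a * B ^ 3)).
      * apply Rmult_le_compat_l; [lra|]; apply Rplus_le_compat_r.
        apply Rmult_le_compat_r; [specialize (B1 3%nat); lra|tauto].
      * right; unfold a; replace (3 * S (S i))%nat with (3 + 3 * S i)%nat by lia.
        rewrite pow_add; simpl; ring.
    + apply (claim_step h C0 Lam Y a (2 * INR (I - S i) + 1) i M B K); auto; try lra.
      * unfold Lam; lra.
      * eapply Rle_trans; [|exact Htau].
        apply Rmult_le_compat_r; [apply pow_le; left; apply Rinv_0_lt_compat; lra|].
        apply Rmult_le_compat_l; [lra|].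
        apply pow_incr; split; [apply pow_le; lra|apply Rle_pow; assumption].
Qed.

(** * From distances to lines *)

(** With [u = x + y], decompose [y - x] along [u] and [J u]; [w] is the coefficient along [J u]. The
    component along [u] has length [| |y|^2 - |x|^2 | / |u|], small when the two lengths agree.
    Since [x . y >= 0], both [|x|^2 + |y|^2 <= |u|^2] and [|y - x| <= |u|], which yield the error
    bound and [|w| <= 1]. *)
Lemma rigid_motion_parameter (x1 x2 y1 y2 eta : R) :
  0 <= x1 * y1 + x2 * y2 -> 0 < (x1 + y1) ^ 2 + (x2 + y2) ^ 2 ->
  Rabs (sqrt (x1 ^ 2 + x2 ^ 2) - sqrt (y1 ^ 2 + y2 ^ 2)) <= eta ->
  exists w, Rabs w <= 1 /\
    Rabs ((y1 - x1) - w * (- (x2 + y2))) <= 2 * eta /\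
    Rabs ((y2 - x2) - w * (x1 + y1)) <= 2 * eta.
Proof.
  intros Hxy HS Heta.
  set (u1 := x1 + y1) in *; set (u2 := x2 + y2) in *.
  set (S2 := u1 ^ 2 + u2 ^ 2) in *.
  set (w := ((y1 - x1) * (- u2) + (y2 - x2) * u1) / S2).
  set (nx := sqrt (x1 ^ 2 + x2 ^ 2)) in *; set (ny := sqrt (y1 ^ 2 + y2 ^ 2)) in *.
  assert (Hnx : nx ^ 2 = x1 ^ 2 + x2 ^ 2) by (apply pow2_sqrt; nra).
  assert (Hny : ny ^ 2 = y1 ^ 2 + y2 ^ 2) by (apply pow2_sqrt; nra).
  assert (0 <= nx) by apply sqrt_pos; assert (0 <= ny) by apply sqrt_pos.
  assert (He0 : 0 <= eta) by (eapply Rle_trans; [apply Rabs_pos|exact Heta]).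
  set (kap := ny ^ 2 - nx ^ 2).
  assert (HS2 : nx ^ 2 + ny ^ 2 <= S2) by (unfold S2, u1, u2; rewrite Hnx, Hny; nra).
  assert (Hk : kap ^ 2 <= eta ^ 2 * (2 * S2)).
  { unfold kap; replace ((ny ^ 2 - nx ^ 2) ^ 2) with ((nx - ny) ^ 2 * (nx + ny) ^ 2) by ring.
    apply Rmult_le_compat; try apply pow2_ge_0.
    - rewrite <- (pow2_abs (nx - ny)); apply pow_incr; split; [apply Rabs_pos|assumption].
    - pose proof (pow2_ge_0 (nx - ny)); nra. }
  assert (Habs : forall a b, 0 <= b -> a ^ 2 <= b ^ 2 -> Rabs a <= b).
  { intros a b Hb Hab; apply Rabs_le; split; nra. }
  assert (E1 : (y1 - x1) - w * (- u2) = kap * u1 / S2).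
  { unfold kap; rewrite Hnx, Hny; unfold w, S2, u1, u2; field; unfold S2, u1, u2 in HS; lra. }
  assert (E2 : (y2 - x2) - w * u1 = kap * u2 / S2).
  { unfold kap; rewrite Hnx, Hny; unfold w, S2, u1, u2; field; unfold S2, u1, u2 in HS; lra. }
  assert (Err : forall u, u ^ 2 <= S2 -> Rabs (kap * u / S2) <= 2 * eta).
  { intros u Hu; apply Habs; [lra|].
    apply Rmult_le_reg_r with (S2 ^ 2); [apply pow_lt; assumption|].
    replace ((kap * u / S2) ^ 2 * S2 ^ 2) with (kap ^ 2 * u ^ 2) by (field; lra).
    apply Rle_trans with (eta ^ 2 * (2 * S2) * S2).
    - apply Rmult_le_compat; try apply pow2_ge_0; assumption.
    - assert (0 <= eta ^ 2 * S2 ^ 2) by nonneg. nra. }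
  exists w; repeat split.
  - apply Habs; [lra|]; rewrite pow1.
    apply Rmult_le_reg_r with (S2 ^ 2); [apply pow_lt; assumption|].
    replace (w ^ 2 * S2 ^ 2) with (((y1 - x1) * (- u2) + (y2 - x2) * u1) ^ 2) by (unfold w; field; lra).
    apply Rle_trans with (((y1 - x1) ^ 2 + (y2 - x2) ^ 2) * S2).
    + unfold S2; pose proof (pow2_ge_0 ((y1 - x1) * u1 + (y2 - x2) * u2)); nra.
    + replace (1 * S2 ^ 2) with (S2 * S2) by ring; apply Rmult_le_compat_r; [lra|].
      unfold S2, u1, u2; nra.
  - rewrite E1; apply Err; unfold S2; nra.
  - rewrite E2; apply Err; unfold S2; nra.
Qed.

(** [4 x2 y2 = (x2 + y2)^2 - (x2 - y2)^2 >= - t^2], which [x1 y1 >= t^2] outweighs. *)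
Lemma far_scalar_product (x1 x2 y1 y2 t : R) :
  0 < t -> (t <= x1 /\ t <= y1) \/ (x1 <= - t /\ y1 <= - t) -> Rabs (x2 - y2) <= t ->
  0 <= x1 * y1 + x2 * y2 /\ 2 * t <= Rabs (x1 + y1).
Proof.
  intros Ht H1 H2.
  assert (E : (x2 - y2) ^ 2 <= t ^ 2).
  { rewrite <- (pow2_abs (x2 - y2)); apply pow_incr; split; [apply Rabs_pos|assumption]. }
  assert (P : t ^ 2 <= x1 * y1) by (destruct H1; nra).
  split.
  - pose proof (pow2_ge_0 (x2 + y2)); nra.
  - destruct H1; [rewrite Rabs_right|rewrite Rabs_left]; lra.
Qed.

(* In the chart [w = tan (angle / 2)], [y = (1 - w J) (translation)], the rigid
   motions sending [a] to [c] form the line [y = v - w m] with [v = c - a] and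
   [m = J (a + c)].  Here everything is shrunk by [4] and [m] is rounded down to
   the grid [Z / H]. *)
Definition mkline (H : R) (a c : pt) : line :=
  (((fst c - fst a) / 4, (snd c - snd a) / 4),
   (Int_part (H * (- (snd a + snd c) / 4)), Int_part (H * ((fst a + fst c) / 4)))).

Lemma round_bounds (H x : R) : 0 < H -> x - / H < IZR (Int_part (H * x)) / H <= x.
Proof.
  intro HH; pose proof (floor_bounds (H * x)) as Fb.
  assert (Hi : 0 < / H) by (apply Rinv_0_lt_compat; assumption).
  unfold Rdiv; split.
  - apply Rmult_lt_reg_r with H; [assumption|].
    rewrite (Rmult_assoc _ (/ H)), Rinv_l, Rmult_minus_distr_r, Rinv_l by lra; lra.
  - apply Rmult_le_reg_r with H; [assumption|].
    rewrite (Rmult_assoc _ (/ H)), Rinv_l by lra; lra.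
Qed.

Lemma mkline_pm1 H a c : 0 < H ->
  - (snd a + snd c) / 4 - / H < pm1 H (mkline H a c) <= - (snd a + snd c) / 4.
Proof. intro; apply (round_bounds H); assumption. Qed.

Lemma mkline_pm2 H a c : 0 < H ->
  (fst a + fst c) / 4 - / H < pm2 H (mkline H a c) <= (fst a + fst c) / 4.
Proof. intro; apply (round_bounds H); assumption. Qed.

(** * The family of lines of a point set *)

Definition unit_square (E : list pt) : Prop :=
  forall p, In p E -> 0 <= fst p <= 1 /\ 0 <= snd p <= 1.

Definition square (x1 x2 q : R) (p : pt) : Prop :=
  (x1 <= fst p < x1 + q) /\ (x2 <= snd p < x2 + q).

Definition sq_spaced (q C : R) (E : list pt) : Prop :=
  forall x1 x2, lsum E (fun p => ind (square x1 x2 q p)) <= C.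

Definition lines (H : R) (E : list pt) : list line :=
  map (fun ac => mkline H (fst ac) (snd ac)) (list_prod E E).

(** After the shrinking by 4 all parameters vary by at most [1/2]; rounding the slopes adds at most
    [1 / H <= 1/2]. *)
Lemma lines_small H E : 2 <= H -> unit_square E -> small H (lines H E).
Proof.
  intros HH HE p q Hp Hq.
  apply in_map_iff in Hp; destruct Hp as [[a c] [<- Hp]].
  apply in_map_iff in Hq; destruct Hq as [[b d] [<- Hq]].
  apply in_prod_iff in Hp; apply in_prod_iff in Hq; cbn [fst snd].
  destruct (HE a (proj1 Hp)) as [Ha1 Ha2]; destruct (HE c (proj2 Hp)) as [Hc1 Hc2].
  destruct (HE b (proj1 Hq)) as [Hb1 Hb2]; destruct (HE d (proj2 Hq)) as [Hd1 Hd2].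
  assert (Hi : / H <= / 2) by (apply Rinv_le_contravar; lra).
  pose proof (mkline_pm1 H a c ltac:(lra)); pose proof (mkline_pm2 H a c ltac:(lra)).
  pose proof (mkline_pm1 H b d ltac:(lra)); pose proof (mkline_pm2 H b d ltac:(lra)).
  unfold near; repeat split; apply Rabs_le; try lra; unfold pv1, pv2, mkline; cbn [fst snd]; lra.
Qed.

(** [a] and [c] are recovered from [c - a] and [a + c], so a cube of lines pulls back into a product
    of two squares. In it differences are known up to [4 / W] and sums, because of the rounding, up
    to [8 / W]; the side needed is [(8 + 4) / (2 W) <= 8 / W]. *)
Lemma lines_spaced H W C E : 0 < W -> W <= H -> 0 <= C -> sq_spaced (8 / W) C E ->
  spaced H (/ W) (C ^ 2) (lines H E).
Proof.
  intros HW HH HC HE x1 x2 x3 x4.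
  assert (Hi : / H <= / W) by (apply Rinv_le_contravar; lra).
  assert (HWi : 0 < / W) by (apply Rinv_0_lt_compat; lra).
  unfold lines; rewrite lsum_map, lsum_prod; cbn [fst snd].
  set (i := / W) in *.
  set (A1 := (4 * x4 - 4 * x1 - 4 * i) / 2); set (A2 := (- 4 * x3 - 8 * i - 4 * x2 - 4 * i) / 2).
  set (B1 := (4 * x4 + 4 * x1) / 2); set (B2 := (- 4 * x3 - 8 * i + 4 * x2) / 2).
  apply Rle_trans with (lsum E (fun a => lsum E (fun c =>
     ind (square A1 A2 (8 / W) a) * ind (square B1 B2 (8 / W) c)))).
  - apply lsum_le; intros a _; apply lsum_le; intros c _.
    rewrite <- ind_and; apply ind_imp; intros (Q1 & Q2 & Q3 & Q4).
    pose proof (mkline_pm1 H a c ltac:(lra)); pose proof (mkline_pm2 H a c ltac:(lra)).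
    unfold pv1, pv2, mkline in Q1, Q2; cbn [fst snd] in Q1, Q2.
    unfold square; replace (8 / W) with (8 * i) by reflexivity.
    unfold A1, A2, B1, B2; repeat split; lra.
  - rewrite <- lsum_mul; replace (C ^ 2) with (C * C) by ring.
    apply Rmult_le_compat; auto; apply lsum_nonneg; intros; apply ind_bound.
Qed.

Lemma square_count q C E x1 x2 (k : nat) : 0 < q -> sq_spaced q C E ->
  lsum E (fun p => ind (square x1 x2 (INR k * q) p)) <= INR k ^ 2 * C.
Proof.
  intros Hq HE.
  eapply Rle_trans; [|right; instantiate (1 := INR k * (INR k * C)); ring].
  eapply Rle_trans; [|apply (interval_count E (fun p => x2 <= snd p < x2 + INR k * q) fst q (INR k * C) Hq) with (x := x1)].
  - apply lsum_le; intros p _; apply ind_imp; unfold square; tauto.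
  - intro x; eapply Rle_trans; [|apply (interval_count E (fun p => x <= fst p < x + q) snd q C Hq) with (x := x2)].
    + apply lsum_le; intros p _; apply ind_imp; tauto.
    + intro y; eapply Rle_trans; [|apply (HE x y)].
      apply lsum_le; intros p _; apply ind_imp; unfold square; tauto.
Qed.

(** * Two far squares, and counting by distance bins *)

Definition glab (k0 : R) (p : pt) : Z * Z := (Int_part (k0 * fst p), Int_part (k0 * snd p)).

Definition far (z z' : Z * Z) : Prop :=
  (3 <= Z.abs (fst z - fst z'))%Z \/ (3 <= Z.abs (snd z - snd z'))%Z.

(** The points whose square is not far from that of [a] lie in a box of side [6 / k], which by the
    spacing holds at most a fraction [196 C / k^2 <= 1/2] of all points. So at least half of the
    pairs are far, and some pair of squares carries an average share. *)
Lemma far_squares_exist (k0 : nat) q C E :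
  (0 < k0)%nat -> 0 < q -> INR k0 * q <= 1 -> unit_square E -> sq_spaced q C E -> 0 < C ->
  / q ^ 2 <= 4 * INR (length E) -> 392 * C <= INR k0 ^ 2 ->
  exists z z', far z z' /\
    INR (length E) ^ 2 / (4 * INR (k0 + 3) ^ 4) <=
    lsum E (fun p => ind (glab (INR k0) p = z)) * lsum E (fun p => ind (glab (INR k0) p = z')).
Proof.
  intros Hk Hq Hkq HE Hsp HC HN Hk0.
  set (k := INR k0) in *.
  assert (Hkp : 0 < k) by (apply lt_0_INR; assumption).
  set (N := INR (length E)) in *.
  assert (HN0 : 0 < N).
  { assert (0 < / q ^ 2) by (apply Rinv_0_lt_compat, pow_lt; assumption); lra. }
  set (labs := list_prod (zr 0 (k0 + 3)) (zr 0 (k0 + 3))).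
  assert (ND : NoDup labs) by (apply NoDup_list_prod; apply NoDup_zr).
  assert (Hlab : forall p, In p E -> In (glab k p) labs).
  { intros p Hp; destruct (HE p Hp) as [H1 H2].
    assert (Gen : forall x, 0 <= x <= 1 -> In (Int_part (k * x)) (zr 0 (k0 + 3))).
    { intros x Hx; apply In_zr; pose proof (floor_bounds (k * x)).
      split.
      - assert (-1 < Int_part (k * x))%Z by (apply lt_IZR; nra); lia.
      - assert (Int_part (k * x) < Z.of_nat k0 + 1)%Z; [|lia].
        apply lt_IZR; rewrite plus_IZR, <- INR_IZR_INZ; fold k; nra. }
    apply in_prod_iff; split; apply Gen; assumption. }
  assert (Hnear : forall a, In a E -> lsum E (fun b => ind (~ far (glab k a) (glab k b))) <= N / 2).
  { intros a _.
    destruct (nat_between (6 / (k * q))) as [m [Hm1 Hm2]].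
    { left; apply Rdiv_lt_0_compat; nra. }
    assert (Hkq0 : 0 < k * q) by nra.
    assert (Hmq : 6 / k < INR m * q).
    { apply Rmult_lt_compat_r with (r := q) in Hm1; [|assumption].
      replace (6 / (k * q) * q) with (6 / k) in Hm1 by (field; lra); assumption. }
    assert (Hm3 : INR m <= 7 / (k * q)).
    { apply Rle_trans with (6 / (k * q) + 1); [assumption|].
      replace (7 / (k * q)) with (6 / (k * q) + / (k * q)) by (field; lra).
      apply Rplus_le_compat_l; rewrite <- Rinv_1 at 1; apply Rinv_le_contravar; assumption. }
    apply Rle_trans with (INR m ^ 2 * C).
    - eapply Rle_trans; [|apply (square_count q C E (fst a - 3 / k) (snd a - 3 / k) m Hq Hsp)].
      apply lsum_le; intros b _; apply ind_imp; intro Nf.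
      assert (Gen : forall x y, (Z.abs (Int_part (k * x) - Int_part (k * y)) < 3)%Z ->
         x - 3 / k <= y < x - 3 / k + INR m * q).
      { intros x y Hz; pose proof (floor_bounds (k * x)); pose proof (floor_bounds (k * y)).
        assert (IZR (Int_part (k * x)) <= IZR (Int_part (k * y)) + 2) by (rewrite <- plus_IZR; apply IZR_le; lia).
        assert (IZR (Int_part (k * y)) <= IZR (Int_part (k * x)) + 2) by (rewrite <- plus_IZR; apply IZR_le; lia).
        assert (E3 : 3 / k * k = 3) by (field; lra).
        assert (E6 : 6 / k = 2 * (3 / k)) by (field; lra).
        set (tk := 3 / k) in *.
        assert (x - tk <= y) by nra. assert (y < x + tk) by nra. lra. }
      unfold far, glab in Nf; cbn [fst snd] in Nf.
      split; apply Gen; lia.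
    - assert (Hm4 : INR m ^ 2 <= (7 / (k * q)) ^ 2) by (apply pow_incr; split; [apply pos_INR|assumption]).
      apply Rle_trans with ((7 / (k * q)) ^ 2 * C); [apply Rmult_le_compat_r; lra|].
      replace ((7 / (k * q)) ^ 2 * C) with (49 * C / k ^ 2 * / q ^ 2) by (field; lra).
      assert (k2 : 0 < k ^ 2) by (apply pow_lt; assumption).
      apply Rle_trans with (49 * C / k ^ 2 * (4 * N)).
      + apply Rmult_le_compat_l; [|assumption]; left; apply Rdiv_lt_0_compat; lra.
      + replace (49 * C / k ^ 2 * (4 * N)) with (196 * C / k ^ 2 * N) by (field; lra).
        replace (N / 2) with (/ 2 * N) by field.
        apply Rmult_le_compat_r; [lra|].
        apply Rmult_le_reg_r with (k ^ 2); [assumption|].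
        replace (196 * C / k ^ 2 * k ^ 2) with (196 * C) by (field; lra); lra. }
  assert (Hfar : N ^ 2 / 2 <= lsum E (fun a => lsum E (fun b => ind (far (glab k a) (glab k b))))).
  { replace (N ^ 2 / 2) with (lsum E (fun _ => N / 2)) by (rewrite lsum_const; fold N; field).
    apply lsum_le; intros a Ha; specialize (Hnear a Ha).
    assert (lsum E (fun b => ind (far (glab k a) (glab k b)) + ind (~ far (glab k a) (glab k b))) = N) as Es.
    { rewrite (lsum_ext E _ (fun _ => 1)), lsum_const; [fold N; ring|]; intros b _.
      destruct (excluded_middle_informative (far (glab k a) (glab k b))).
      - rewrite ind_true, ind_false by tauto; ring.
      - rewrite ind_false, ind_true by tauto; ring. }
    rewrite lsum_plus in Es; lra. }
  set (n := fun z => lsum E (fun p => ind (glab k p = z))).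
  set (G := fun zz : (Z * Z) * (Z * Z) => ind (far (fst zz) (snd zz)) * (n (fst zz) * n (snd zz))).
  assert (HG : lsum E (fun a => lsum E (fun b => ind (far (glab k a) (glab k b)))) = lsum (list_prod labs labs) G).
  { rewrite lsum_prod; unfold G; cbn [fst snd].
    rewrite (lsum_label E labs (glab k)) by assumption; apply lsum_ext; intros z _.
    transitivity (lsum E (fun a => ind (glab k a = z) * lsum labs (fun z' => ind (far z z') * n z'))).
    - apply lsum_ext; intros a _.
      destruct (excluded_middle_informative (glab k a = z)) as [<-|Nz]; [|rewrite ind_false by assumption; ring].
      f_equal; rewrite (lsum_label E labs (glab k)) by assumption; apply lsum_ext; intros z' _.
      unfold n; rewrite <- lsum_scal; apply lsum_ext; intros b _.
      destruct (excluded_middle_informative (glab k b = z')) as [<-|Nz']; [ring|].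
      rewrite (ind_false (glab k b = z')) by assumption; ring.
    - rewrite lsum_scal_r; fold (n z); rewrite <- lsum_scal; apply lsum_ext; intros; ring. }
  rewrite HG in Hfar.
  assert (Hk3 : 0 < INR (k0 + 3)) by (apply lt_0_INR; lia).
  (* The 4 in place of 2 provides the strict inequality that the averaging argument asks for. *)
  destruct (lsum_exists_ge (list_prod labs labs) G (N ^ 2 / (4 * INR (k0 + 3) ^ 4))) as [[z z'] [_ Hz]].
  { eapply Rlt_le_trans; [|exact Hfar].
    unfold labs; rewrite !length_prod, !length_zr, !mult_INR.
    set (kk := INR (k0 + 3)) in *.
    replace (kk * kk * (kk * kk) * (N ^ 2 / (4 * kk ^ 4))) with (N ^ 2 / 4) by (field; lra).
    assert (0 < N ^ 2) by (apply pow_lt; assumption); lra. }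
  exists z, z'; unfold G in Hz; cbn [fst snd] in Hz.
  destruct (excluded_middle_informative (far z z')) as [Hf|Nf].
  - rewrite ind_true, Rmult_1_l in Hz by assumption; split; [assumption|left; exact Hz].
  - rewrite ind_false, Rmult_0_l in Hz by assumption; exfalso.
    assert (0 < N ^ 2 / (4 * INR (k0 + 3) ^ 4)); [|lra].
    apply Rdiv_lt_0_compat; [apply pow_lt; assumption|].
    assert (0 < INR (k0 + 3) ^ 4) by (apply pow_lt; assumption); lra.
Qed.

(** Cauchy-Schwarz over the fibres of [key]: few coincidences force many values. *)
Lemma key_cauchy {A : Type} (P : list A) (key : A -> Z) :
  exists Sx : list Z, NoDup Sx /\ (forall k, In k Sx -> exists p, In p P /\ key p = k) /\
    INR (length P) ^ 2 <= INR (length Sx) * lsum P (fun p => lsum P (fun p' => ind (key p = key p'))).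
Proof.
  set (Sx := nodup Z.eq_dec (map key P)).
  assert (ND : NoDup Sx) by apply NoDup_nodup.
  assert (Hin : forall p, In p P -> In (key p) Sx) by (intros p Hp; apply nodup_In, in_map; assumption).
  exists Sx; repeat split; [assumption| |].
  - intros k Hk; apply nodup_In, in_map_iff in Hk; destruct Hk as [p [E Hp]]; eauto.
  - set (n := fun k => lsum P (fun p => ind (key p = k))).
    assert (E1 : INR (length P) = lsum Sx n).
    { rewrite <- (Rmult_1_r (INR (length P))), <- lsum_const.
      rewrite (lsum_label P Sx key) by assumption; apply lsum_ext; intros k _.
      unfold n; apply lsum_ext; intros; ring. }
    assert (E2 : lsum P (fun p => lsum P (fun p' => ind (key p = key p'))) = lsum Sx (fun k => n k ^ 2)).
    { rewrite (lsum_label P Sx key) by assumption; apply lsum_ext; intros k _.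
      replace (n k ^ 2) with (n k * n k) by ring; unfold n at 1; rewrite <- lsum_scal_r.
      apply lsum_ext; intros p _.
      destruct (excluded_middle_informative (key p = k)) as [<-|Nk]; [|rewrite ind_false by assumption; ring].
      f_equal; unfold n; apply lsum_ext; intros p' _; apply ind_iff; split; congruence. }
    rewrite E1, E2; apply lsum_cauchy.
Qed.

Lemma lsum_filter_le {A : Type} (l : list A) (b : A -> bool) f :
  (forall a, 0 <= f a) -> lsum (filter b l) f <= lsum l f.
Proof.
  intro Hf; rewrite lsum_filter; apply lsum_le; intros a _; specialize (Hf a); destruct (b a); lra.
Qed.

(** The sign is recorded through the indices, so that two pairs taken from the same two squares have
    differences of the same sign. *)
Lemma glab_coord (k x y : R) (z z' : Z) : 0 < k ->
  Int_part (k * x) = z -> Int_part (k * y) = z' -> (3 <= Z.abs (z - z'))%Z ->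
  ((0 < z - z')%Z /\ 2 / k <= x - y) \/ ((z - z' < 0)%Z /\ x - y <= - (2 / k)).
Proof.
  intros Hk <- <- H; pose proof (floor_bounds (k * x)); pose proof (floor_bounds (k * y)).
  set (z := Int_part (k * x)) in *; set (z' := Int_part (k * y)) in *.
  assert (E : 2 / k * k = 2) by (field; lra); set (t := 2 / k) in *.
  destruct (Z_lt_le_dec 0 (z - z')) as [Hz|Hz].
  - left; split; [assumption|].
    assert (IZR z' + 3 <= IZR z) by (rewrite <- plus_IZR; apply IZR_le; lia); nra.
  - right; split; [lia|].
    assert (IZR z + 3 <= IZR z') by (rewrite <- plus_IZR; apply IZR_le; lia); nra.
Qed.

Lemma glab_close (k x y : R) : 0 < k -> Int_part (k * x) = Int_part (k * y) -> Rabs (x - y) <= 1 / k.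
Proof.
  intros Hk E; pose proof (floor_bounds (k * x)); pose proof (floor_bounds (k * y)); rewrite E in *.
  assert (E1 : 1 / k * k = 1) by (field; lra); set (t := 1 / k) in *.
  apply Rabs_le; split; nra.
Qed.

(** In a far coordinate the two differences share their sign and have size at least [2 / k]; in the
    other coordinate they agree up to [2 / k]. This is the situation of [far_scalar_product]. *)
Lemma far_pair_geometry (k : R) (a b c d : pt) : 0 < k ->
  glab k a = glab k c -> glab k b = glab k d -> far (glab k a) (glab k b) ->
  let x1 := fst a - fst b in let x2 := snd a - snd b in
  let y1 := fst c - fst d in let y2 := snd c - snd d in
  0 <= x1 * y1 + x2 * y2 /\ (4 / k <= Rabs (x1 + y1) \/ 4 / k <= Rabs (x2 + y2)).
Proof.
  intros Hk Eac Ebd Hf x1 x2 y1 y2.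
  injection Eac; intros A2 A1; injection Ebd; intros B2 B1.
  pose proof (glab_close k _ _ Hk A1) as a1; pose proof (glab_close k _ _ Hk A2) as a2.
  pose proof (glab_close k _ _ Hk B1) as b1; pose proof (glab_close k _ _ Hk B2) as b2.
  assert (Ht : 0 < 2 / k) by (apply Rdiv_lt_0_compat; lra).
  assert (E2 : 2 / k = 1 / k + 1 / k) by (field; lra).
  assert (E4 : 4 / k = 2 * (2 / k)) by (field; lra).
  assert (D : forall p q p' q' : R, Rabs (p - p') <= 1 / k -> Rabs (q - q') <= 1 / k ->
     Rabs ((p - q) - (p' - q')) <= 2 / k).
  { intros p q p' q' H1 H2; replace ((p - q) - (p' - q')) with ((p - p') + - (q - q')) by ring.
    eapply Rle_trans; [apply Rabs_triang|]; rewrite Rabs_Ropp; lra. }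
  destruct Hf as [Hf|Hf]; unfold glab in Hf; cbn [fst snd] in Hf.
  - pose proof (glab_coord k (fst a) (fst b) _ _ Hk eq_refl eq_refl Hf) as G1.
    pose proof (glab_coord k (fst c) (fst d) _ _ Hk (eq_sym A1) (eq_sym B1) Hf) as G2.
    destruct (far_scalar_product x1 x2 y1 y2 (2 / k)) as [F1 F2].
    + assumption.
    + unfold x1, y1; destruct G1 as [[? ?]|[? ?]], G2 as [[? ?]|[? ?]]; try lia; [left|right]; split; assumption.
    + apply D; assumption.
    + split; [assumption|left; lra].
  - pose proof (glab_coord k (snd a) (snd b) _ _ Hk eq_refl eq_refl Hf) as G1.
    pose proof (glab_coord k (snd c) (snd d) _ _ Hk (eq_sym A2) (eq_sym B2) Hf) as G2.
    destruct (far_scalar_product x2 x1 y2 y1 (2 / k)) as [F1 F2].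
    + assumption.
    + unfold x2, y2; destruct G1 as [[? ?]|[? ?]], G2 as [[? ?]|[? ?]]; try lia; [left|right]; split; assumption.
    + apply D; assumption.
    + split; [lra|right; lra].
Qed.

(** With [x = a - b] and [y = c - e] the two lines differ, up to rounding, by [v = (y - x) / 4] and
    [m = J (x + y) / 4], so [rigid_motion_parameter] supplies the time of incidence. Its error [4 d]
    shrinks to [d], and rounding adds at most [1 / H <= d]. *)
Lemma congruent_pairs_incident (k H d r0 : R) (a b c e : pt) :
  0 < k -> 0 < d -> / d <= H -> 2 * k <= H -> 2 * k * r0 < 1 ->
  glab k a = glab k c -> glab k b = glab k e -> far (glab k a) (glab k b) ->
  Rabs (dist2 a b - dist2 c e) <= 2 * d ->
  transv H r0 (mkline H a c) (mkline H b e) /\ incp H 1 (2 * d) (mkline H a c) (mkline H b e).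
Proof.
  intros Hk Hd HH1 HH2 Hr0 Eac Ebe Hf Hdist.
  destruct (far_pair_geometry k a b c e Hk Eac Ebe Hf) as [Sc Fr].
  set (x1 := fst a - fst b) in *; set (x2 := snd a - snd b) in *.
  set (y1 := fst c - fst e) in *; set (y2 := snd c - snd e) in *.
  assert (HH : 0 < H) by lra.
  assert (Hk4 : 0 < 4 / k) by (apply Rdiv_lt_0_compat; lra).
  assert (HHi : / H <= d).
  { rewrite <- (Rinv_inv d); apply Rinv_le_contravar; [apply Rinv_0_lt_compat; assumption|assumption]. }
  assert (HHi2 : / H <= / (2 * k)) by (apply Rinv_le_contravar; lra).
  assert (Hr1 : r0 < / (2 * k)).
  { apply Rmult_lt_reg_l with (2 * k); [lra|]; rewrite Rinv_r; lra. }
  assert (Ek : 4 / k / 4 = / (2 * k) + / (2 * k)) by (field; lra).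
  pose proof (mkline_pm1 H a c HH) as P1; pose proof (mkline_pm2 H a c HH) as P2.
  pose proof (mkline_pm1 H b e HH) as Q1; pose proof (mkline_pm2 H b e HH) as Q2.
  set (m1 := pm1 H (mkline H a c) - pm1 H (mkline H b e)).
  set (m2 := pm2 H (mkline H a c) - pm2 H (mkline H b e)).
  assert (M1 : Rabs (m1 - - (x2 + y2) / 4) <= / H).
  { unfold m1, x2, y2; apply Rabs_le; lra. }
  assert (M2 : Rabs (m2 - (x1 + y1) / 4) <= / H).
  { unfold m2, x1, y1; apply Rabs_le; lra. }
  split.
  - assert (Low : forall m s, Rabs (m - s / 4) <= / H -> 4 / k <= Rabs s -> r0 < Rabs m).
    { intros m s Hm Hs.
      assert (Rabs (s / 4) = Rabs s / 4) as E4.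
      { unfold Rdiv; rewrite Rabs_mult, (Rabs_pos_eq (/ 4)) by lra; reflexivity. }
      pose proof (Rabs_triang (s / 4 - m) m) as Tr.
      replace (s / 4 - m + m) with (s / 4) in Tr by ring.
      rewrite Rabs_minus_sym in Hm; lra. }
    unfold transv; fold m1 m2; destruct Fr as [Fr|Fr].
    + right; apply (Low m2 (x1 + y1)); assumption.
    + left; apply (Low m1 (- (x2 + y2))); [assumption|rewrite Rabs_Ropp; assumption].
  - assert (HS : 0 < (x1 + y1) ^ 2 + (x2 + y2) ^ 2).
    { rewrite <- (pow2_abs (x1 + y1)), <- (pow2_abs (x2 + y2)).
      pose proof (Rabs_pos (x1 + y1)); pose proof (Rabs_pos (x2 + y2)); destruct Fr; nra. }
    destruct (rigid_motion_parameter x1 x2 y1 y2 (2 * d) Sc HS Hdist) as (w & W0 & W1 & W2).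
    exists w; fold m1 m2; split; [assumption|].
    assert (Fin : forall v g m, Rabs (v - w * g) <= 2 * (2 * d) -> Rabs (m - g / 4) <= / H ->
       Rabs (v / 4 - w * m) <= 2 * d).
    { intros v g m Hv Hm.
      replace (v / 4 - w * m) with ((v - w * g) * / 4 + - (w * (m - g / 4))) by field.
      eapply Rle_trans; [apply Rabs_triang|]; rewrite Rabs_Ropp, !Rabs_mult, (Rabs_pos_eq (/ 4)) by lra.
      assert (Rabs w * Rabs (m - g / 4) <= 1 * / H) by (apply Rmult_le_compat; auto using Rabs_pos).
      lra. }
    replace (pv1 (mkline H a c) - pv1 (mkline H b e)) with ((y1 - x1) / 4)
      by (unfold pv1, mkline, x1, y1; cbn [fst snd]; field).
    replace (pv2 (mkline H a c) - pv2 (mkline H b e)) with ((y2 - x2) / 4)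
      by (unfold pv2, mkline, x2, y2; cbn [fst snd]; field).
    split; [apply (Fin _ (- (x2 + y2)))|apply (Fin _ (x1 + y1))]; assumption.
Qed.

Definition glabb (k : R) (z : Z * Z) (p : pt) : bool :=
  if excluded_middle_informative (glab k p = z) then true else false.

Lemma glabb_true k z p : glabb k z p = true <-> glab k p = z.
Proof. unfold glabb; destruct excluded_middle_informative; split; try tauto; discriminate. Qed.

Lemma length_glabb k z E :
  INR (length (filter (glabb k z) E)) = lsum E (fun p => ind (glab k p = z)).
Proof.
  rewrite <- (Rmult_1_r (INR _)), <- lsum_const, lsum_filter; apply lsum_ext; intros p _.
  unfold glabb, ind; destruct excluded_middle_informative; reflexivity.
Qed.

(** Bins have length [2 d], so that the intervals of length [d] at their left ends are disjoint. *)
Definition dkey (d : R) (ab : pt * pt) : Z := Int_part (dist2 (fst ab) (snd ab) / (2 * d)).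

Lemma dkey_eq_close d x y : 0 < d -> Int_part (x / (2 * d)) = Int_part (y / (2 * d)) ->
  Rabs (x - y) <= 2 * d.
Proof.
  intros Hd E; pose proof (floor_bounds (x / (2 * d))) as F1; pose proof (floor_bounds (y / (2 * d))) as F2.
  rewrite E in *.
  assert (Ex : x / (2 * d) * (2 * d) = x) by (field; lra).
  assert (Ey : y / (2 * d) * (2 * d) = y) by (field; lra).
  set (s := x / (2 * d)) in *; set (t := y / (2 * d)) in *.
  rewrite <- Ex, <- Ey; apply Rabs_le; split; nra.
Qed.

(** A coincidence between the pairs [(a, b)] and [(c, e)] is regrouped as an incidence between the
    lines of [(a, c)] and of [(b, e)]. *)
Lemma same_key_count (k H d r0 : R) E z z' :
  0 < k -> 0 < d -> / d <= H -> 2 * k <= H -> 2 * k * r0 < 1 -> far z z' ->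
  let P := list_prod (filter (glabb k z) E) (filter (glabb k z') E) in
  lsum P (fun p => lsum P (fun p' => ind (dkey d p = dkey d p'))) <=
  count H r0 (lines H E) 1 (2 * d).
Proof.
  intros Hk Hd HH1 HH2 Hr0 Hf P; unfold P.
  set (E1 := filter (glabb k z) E); set (E2 := filter (glabb k z') E).
  set (F := fun a c b e => ind (transv H r0 (mkline H a c) (mkline H b e) /\
                                incp H 1 (2 * d) (mkline H a c) (mkline H b e))).
  assert (HF : forall a c b e, 0 <= F a c b e) by (intros; apply ind_bound).
  rewrite lsum_prod.
  apply Rle_trans with (lsum E1 (fun a => lsum E1 (fun c => lsum E2 (fun b => lsum E2 (fun e => F a c b e))))).
  - apply lsum_le; intros a Ha.
    rewrite (lsum_exchange E1 E2 (fun c b => lsum E2 (fun e => F a c b e))).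
    apply lsum_le; intros b Hb.
    rewrite lsum_prod; apply lsum_le; intros c Hc; apply lsum_le; intros e He.
    apply filter_In in Ha, Hb, Hc, He; rewrite glabb_true in Ha, Hb, Hc, He.
    apply ind_imp; intro E0; unfold dkey in E0; cbn [fst snd] in E0.
    apply (congruent_pairs_incident k H d r0 a b c e); try assumption.
    + transitivity z; [tauto|symmetry; tauto].
    + transitivity z'; [tauto|symmetry; tauto].
    + destruct Ha as [_ ->], Hb as [_ ->]; assumption.
    + apply dkey_eq_close; assumption.
  - unfold count, lines; rewrite lsum_map, lsum_prod; cbn [fst snd].
    eapply Rle_trans; [apply lsum_filter_le; intro; apply lsum_nonneg; intros; apply lsum_nonneg; intros;
      apply lsum_nonneg; intros; apply HF|].
    apply lsum_le; intros a _.
    eapply Rle_trans; [apply lsum_filter_le; intro; apply lsum_nonneg; intros; apply lsum_nonneg; intros;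
      apply HF|].
    apply lsum_le; intros c _.
    rewrite lsum_map, lsum_prod; cbn [fst snd].
    eapply Rle_trans; [apply lsum_filter_le; intro; apply lsum_nonneg; intros; apply HF|].
    apply lsum_le; intros b _; apply lsum_filter_le; intro; apply HF.
Qed.

(** The parameters are [h = 1/d], which keeps rounding errors below [d], [K = B^J], [I = 2 J] and
    [Lam = 4 J + 4]; the total loss in [B] is [K^3 B^(3 (2 J + 1)) = B^(9 J + 3)]. The bound
    [k0 <= J] makes the slope gap of far squares exceed the threshold [1 / (2 (2 Lam + 1))]. *)
Lemma distance_bins (C1 d r B : R) (J k0 : nat) (E : list pt) :
  let M := (11 * (J * J) + 2)%nat in
  let Cs := step_const (C1 ^ 2) (2 * INR (2 * J) + 4) M in
  1 <= C1 -> 0 < d -> (1 <= J)%nat -> (1 <= k0)%nat -> (k0 <= J)%nat ->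
  B ^ (J * J) = / d -> 800 <= B -> 8 * INR J + 9 <= B ->
  16 * (8 * INR J + 9) ^ (2 * J) <= / d ->
  392 * C1 <= INR k0 ^ 2 -> 2 * d <= r -> r <= 1 -> r ^ 2 <= d -> INR k0 * r <= 2 ->
  unit_square E -> sq_spaced (r / 2) C1 E -> / r ^ 2 <= INR (length E) ->
  exists Sx : list Z, NoDup Sx /\
    (forall k, In k Sx -> exists a b, In a E /\ In b E /\ 0 < dist2 a b /\ dkey d (a, b) = k) /\
    / (2 ^ 37 * INR (k0 + 3) ^ 8 * (2 * Cs) ^ (2 * J + 1)) <=
      INR (length Sx) * (d * B ^ (9 * J + 3)).
Proof.
  intros M Cs HC Hd HJ Hk0 HkJ HBd HB800 HBJ Hdsm HCk Hdr Hr1 Hr2 Hkr HE Hsp HN.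
  set (k := INR k0) in *.
  assert (Hk : 1 <= k) by (change 1 with (INR 1); apply le_INR; assumption).
  assert (HJr : 1 <= INR J) by (change 1 with (INR 1); apply le_INR; assumption).
  assert (HkJr : k <= INR J) by (apply le_INR; assumption).
  assert (Hr : 0 < r) by lra.
  assert (Hd1 : d <= / 2) by lra.
  set (W := 16 / r).
  assert (HWr : W * r = 16) by (unfold W; field; lra).
  assert (HW : 16 <= W) by nra.
  set (h := / d).
  assert (Hh : 2 <= h) by (unfold h; rewrite <- (Rinv_inv 2); apply Rinv_le_contravar; lra).
  set (H := h * W).
  set (N := INR (length E)) in *.
  destruct (far_squares_exist k0 (r / 2) C1 E) as (z & z' & Hf & Hprod); auto; try lia; try lra.
  { fold k; lra. }
  { replace (/ (r / 2) ^ 2) with (4 * / r ^ 2) by (field; lra); fold N; lra. }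
  fold N in Hprod; fold k in Hprod.
  rewrite <- !length_glabb in Hprod.
  set (E1 := filter (glabb k z) E) in *; set (E2 := filter (glabb k z') E) in *.
  set (P := list_prod E1 E2).
  assert (HP : INR (length P) = INR (length E1) * INR (length E2))
    by (unfold P; rewrite length_prod, mult_INR; reflexivity).
  rewrite <- HP in Hprod.
  destruct (key_cauchy P (dkey d)) as (Sx & ND & HS & HCS).
  exists Sx; split; [assumption|]; split.
  { intros kk Hkk; destruct (HS kk Hkk) as [[a b] [Hab Ek]].
    apply in_prod_iff in Hab; destruct Hab as [Ha Hb].
    apply filter_In in Ha, Hb; rewrite glabb_true in Ha, Hb.
    exists a, b; repeat split; try tauto.
    destruct (far_pair_geometry k a b a b ltac:(lra) eq_refl eq_refl) as [_ Fr].
    { destruct Ha as [_ ->], Hb as [_ ->]; assumption. }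
    unfold dist2; apply sqrt_lt_R0.
    assert (Hk4 : 0 < 4 / k) by (apply Rdiv_lt_0_compat; lra).
    set (x := fst a - fst b) in *; set (y := snd a - snd b) in *.
    destruct Fr as [Fr|Fr].
    - assert (x <> 0) by (intro E0; rewrite E0, Rplus_0_r, Rabs_R0 in Fr; lra).
      assert (0 < x ^ 2) by (rewrite <- Rsqr_pow2; apply Rsqr_pos_lt; assumption).
      pose proof (pow2_ge_0 y); lra.
    - assert (y <> 0) by (intro E0; rewrite E0, Rplus_0_r, Rabs_R0 in Fr; lra).
      assert (0 < y ^ 2) by (rewrite <- Rsqr_pow2; apply Rsqr_pos_lt; assumption).
      pose proof (pow2_ge_0 x); lra. }
  set (I := (2 * J)%nat).
  set (Lam := 2 * INR I + 4).
  assert (EI : INR I = 2 * INR J) by (unfold I; rewrite mult_INR; reflexivity).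
  assert (EL : 2 * Lam + 1 = 8 * INR J + 9) by (unfold Lam; rewrite EI; ring).
  set (K := B ^ J).
  assert (HBK : B <= K).
  { unfold K; rewrite <- (pow_1 B) at 1; apply Rle_pow; [lra|assumption]. }
  set (Y := K / (2 * Lam + 1)).
  assert (HY : (2 * Lam + 1) * Y = K) by (unfold Y; field; lra).
  assert (HY1 : 1 <= Y).
  { apply Rmult_le_reg_l with (2 * Lam + 1); [lra|]; rewrite HY; lra. }
  assert (HYK : Y <= K) by nra.
  assert (HB0 : 0 < B) by lra.
  (* In powers of [B]: [8 <= B], [h = B^(J^2)] and [(K^I)^5 = B^(10 J^2)], so it suffices that
     [11 J^2 + 1 <= M + 1]; hence the choice of [M]. *)
  assert (Htau : 8 * h * (Y ^ I) ^ 5 * (/ B) ^ S M <= 1).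
  { apply Rle_trans with (B * B ^ (J * J) * (K ^ I) ^ 5 * (/ B) ^ S M).
    - apply Rmult_le_compat_r; [apply pow_le; left; apply Rinv_0_lt_compat; lra|].
      apply Rmult_le_compat; [lra|apply pow_le, pow_le; lra| |].
      + rewrite HBd; fold h; apply Rmult_le_compat_r; lra.
      + apply pow_incr; split; [apply pow_le; lra|]; apply pow_incr; lra.
    - unfold K; rewrite <- !pow_mult.
      replace (B * B ^ (J * J)) with (B ^ (1 + J * J)) by (rewrite pow_add, pow_1; reflexivity).
      rewrite <- pow_add, pow_inv.
      assert (0 < B ^ S M) by (apply pow_lt; assumption).
      apply Rmult_le_reg_r with (B ^ S M); [assumption|].
      rewrite Rmult_assoc, Rinv_l, Rmult_1_r, Rmult_1_l by lra.
      apply Rle_pow; [lra|]; unfold M, I; nia. }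
  (* [K^I = h^2] while [W <= 8 h]; the lower bound on [1/d] pays for the divisor [(2 Lam + 1)^I]. *)
  assert (HWY : W <= Y ^ I).
  { assert (W <= 8 * h).
    { apply Rmult_le_reg_r with r; [assumption|]; rewrite HWr.
      apply Rle_trans with (8 * h * (2 * d)); [right; unfold h; field; lra|].
      apply Rmult_le_compat_l; lra. }
    unfold Y; unfold Rdiv; rewrite Rpow_mult_distr, pow_inv, EL.
    set (q := (8 * INR J + 9) ^ I).
    assert (Hq : 0 < q) by (apply pow_lt; lra).
    assert (K ^ I = h * h) as ->.
    { unfold K, I, h; rewrite <- HBd, <- pow_mult, <- pow_add; f_equal; lia. }
    assert (16 * q <= h) by (unfold h; exact Hdsm).
    apply Rle_trans with (8 * h); [assumption|].
    apply Rmult_le_reg_r with q; [assumption|].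
    rewrite (Rmult_assoc (h * h)), Rinv_l by lra; nra. }
  assert (C2 : 1 <= C1 ^ 2) by nra.
  assert (HClaim := claim_all (C1 ^ 2) I M h Y B K ltac:(lra) C2).
  fold Lam in HClaim.
  specialize (HClaim ltac:(lra) HB800 HY HY1 Htau I (Nat.le_refl I)).
  rewrite Nat.sub_diag in HClaim; replace (2 * INR 0 + 1) with 1 in HClaim by (simpl; ring).
  assert (HWH : W <= H) by (unfold H; nra).
  specialize (HClaim W (lines H E) ltac:(lra) HWY
    (lines_small H E ltac:(lra) HE)
    (lines_spaced H W C1 E ltac:(lra) HWH ltac:(lra)
       ltac:(replace (8 / W) with (r / 2) by (unfold W; field; lra); assumption))
    (2 * d) ltac:(lra)).
  fold H in HClaim.
  change (step_const (C1 ^ 2) Lam M) with Cs in HClaim.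
  (* [r^2 <= d], which will come from [s > 1], puts the resolution [1 / W^2] below [2 d], so the
     claim gives the count for random lines. *)
  assert (HWd : / W ^ 2 <= 2 * d).
  { replace (/ W ^ 2) with (r ^ 2 / 256) by (unfold W; field; lra); lra. }
  rewrite Rmax_left in HClaim by assumption.
  assert (SK := same_key_count k H d (/ (2 * Lam + 1) / 2) E z z' ltac:(lra) Hd).
  assert (hH : h <= H) by (unfold H; nra).
  specialize (SK hH).
  assert (kH : 2 * k <= H) by (unfold H; nra).
  specialize (SK kH).
  assert (kr0 : 2 * k * (/ (2 * Lam + 1) / 2) < 1).
  { replace (2 * k * (/ (2 * Lam + 1) / 2)) with (k * / (2 * Lam + 1)) by (field; lra).
    apply Rmult_lt_reg_r with (2 * Lam + 1); [lra|]; rewrite Rmult_assoc, Rinv_l; lra. }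
  specialize (SK kr0 Hf); cbv zeta in SK; fold E1 in SK; fold E2 in SK; fold P in SK.
  set (cc := lsum P _) in *.
  set (D := (2 * Cs) ^ S I * K ^ 3 * B ^ (3 * S I)) in *.
  assert (Hcc : cc <= D * W ^ 8 * (2 * d)) by (eapply Rle_trans; eassumption).
  set (kk := INR (k0 + 3)) in *.
  assert (Hkk : 0 < kk) by (apply lt_0_INR; lia).
  assert (HNW : W ^ 2 / 256 <= N).
  { replace (W ^ 2 / 256) with (/ r ^ 2) by (unfold W; field; lra); assumption. }
  assert (HPl : W ^ 4 / (2 ^ 18 * kk ^ 4) <= INR (length P)).
  { eapply Rle_trans; [|exact Hprod].
    replace (W ^ 4 / (2 ^ 18 * kk ^ 4)) with ((W ^ 2 / 256) ^ 2 / (4 * kk ^ 4)) by (field; lra).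
    apply Rmult_le_compat_r; [left; apply Rinv_0_lt_compat; assert (0 < kk ^ 4) by (apply pow_lt; assumption); lra|].
    apply pow_incr; split; [|assumption].
    apply Rmult_le_pos; [apply pow2_ge_0|lra]. }
  assert (HPl2 : W ^ 8 / (2 ^ 36 * kk ^ 8) <= INR (length P) ^ 2).
  { replace (W ^ 8 / (2 ^ 36 * kk ^ 8)) with ((W ^ 4 / (2 ^ 18 * kk ^ 4)) ^ 2) by (field; lra).
    apply pow_incr; split; [|assumption].
    left; apply Rdiv_lt_0_compat; [apply pow_lt; lra|].
    assert (0 < kk ^ 4) by (apply pow_lt; assumption); lra. }
  assert (HCs : 0 < 2 * Cs).
  { pose proof (step_const_ge (C1 ^ 2) Lam M ltac:(lra)) as SC.
    change (step_const (C1 ^ 2) Lam M) with Cs in SC.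
    assert (0 < (C1 ^ 2) ^ 2) by (apply pow_lt; lra); lra. }
  assert (ED : D = (2 * Cs) ^ (2 * J + 1) * B ^ (9 * J + 3)).
  { unfold D, K, I; rewrite <- pow_mult, Rmult_assoc, <- pow_add; f_equal; f_equal; lia. }
  assert (W8 : 0 < W ^ 8) by (apply pow_lt; lra).
  set (c8 := 2 ^ 36 * kk ^ 8) in *.
  assert (Hc8 : 0 < c8).
  { assert (0 < kk ^ 8) by (apply pow_lt; assumption); unfold c8.
    apply Rmult_lt_0_compat; [apply pow_lt; lra|assumption]. }
  assert (HQ : 0 < (2 * Cs) ^ (2 * J + 1)) by (apply pow_lt; assumption).
  assert (Main : W ^ 8 / c8 <= INR (length Sx) * (D * W ^ 8 * (2 * d))).
  { eapply Rle_trans; [exact HPl2|]; eapply Rle_trans; [exact HCS|].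
    apply Rmult_le_compat_l; [apply pos_INR|assumption]. }
  rewrite ED in Main.
  set (Q := (2 * Cs) ^ (2 * J + 1)) in *; set (Bp := B ^ (9 * J + 3)) in *.
  set (n := INR (length Sx)) in *.
  change ((2 * Cs) ^ (I + 1)) with Q.
  apply Rmult_le_reg_r with (2 * Q * W ^ 8).
  { apply Rmult_lt_0_compat; [lra|assumption]. }
  replace (/ (2 ^ 37 * kk ^ 8 * Q) * (2 * Q * W ^ 8)) with (W ^ 8 / c8) by (unfold c8; field; split; lra).
  replace (n * (d * Bp) * (2 * Q * W ^ 8)) with (n * (Q * Bp * W ^ 8 * (2 * d))) by ring.
  exact Main.
Qed.

(** * From bins back to intervals of distances *)

Lemma dist2_triangle (p q x : pt) : dist2 p x <= dist2 p q + dist2 q x.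
Proof.
  pose proof (triangle (fst p) (snd p) (fst x) (snd x) (fst q) (snd q)) as T.
  unfold dist_euc in T; rewrite !Rsqr_pow2 in T; exact T.
Qed.

(** A square of side [r / 2] lies within [r / 2] of its centre, which leaves room for the radius
    [d <= r / 2] of the balls. *)
Lemma ball_count_sq_spaced d r C E :
  NoDup E -> 2 * d <= r -> 0 < r -> ball_count_le d r C E -> sq_spaced (r / 2) C E.
Proof.
  intros ND Hd Hr HB x1 x2.
  set (b := fun p => if excluded_middle_informative (square x1 x2 (r / 2) p) then true else false).
  assert (Hb : forall p, b p = true <-> square x1 x2 (r / 2) p).
  { intro p; unfold b; destruct excluded_middle_informative; split; try tauto; discriminate. }
  apply Rle_trans with (INR (length (filter b E))).
  - right; rewrite <- (Rmult_1_r (INR _)), <- lsum_const, lsum_filter.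
    apply lsum_ext; intros p _; unfold ind, b; destruct excluded_middle_informative; reflexivity.
  - apply (HB (x1 + r / 4, x2 + r / 4)).
    + apply NoDup_filter; assumption.
    + intros p Hp; apply filter_In in Hp; tauto.
    + intros c Hc p Hp; apply filter_In in Hc; destruct Hc as [_ Hc].
      apply Hb in Hc; destruct Hc as [H1 H2].
      unfold in_ball in *; eapply Rle_trans; [apply (dist2_triangle p c)|].
      assert (dist2 c (x1 + r / 4, x2 + r / 4) <= r / 2); [|lra].
      unfold dist2; cbn [fst snd].
      set (u := fst c - (x1 + r / 4)); set (v := snd c - (x2 + r / 4)).
      assert (- (r / 4) <= u <= r / 4) by (unfold u; lra).
      assert (- (r / 4) <= v <= r / 4) by (unfold v; lra).
      apply Rsqr_incr_0_var; [|lra]; rewrite Rsqr_sqrt, Rsqr_pow2 by nra; nra.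
Qed.

Lemma dist2_scale (a b : pt) (f : R) : 0 <= f ->
  dist2 (fst a + (f - 1) / 2 * (fst a - fst b), snd a + (f - 1) / 2 * (snd a - snd b))
        (fst b - (f - 1) / 2 * (fst a - fst b), snd b - (f - 1) / 2 * (snd a - snd b)) =
  f * dist2 a b.
Proof.
  intro Hf; unfold dist2; cbn [fst snd].
  rewrite <- (sqrt_pow2 f) at 5 by assumption; rewrite <- sqrt_mult_alt by apply pow2_ge_0.
  f_equal; field.
Qed.

Lemma dist2_shift (a : pt) (g u1 u2 : R) :
  dist2 (fst a + g * u1, snd a + g * u2) a = Rabs g * sqrt (u1 ^ 2 + u2 ^ 2).
Proof.
  unfold dist2; cbn [fst snd].
  rewrite <- sqrt_Rsqr_abs, <- sqrt_mult_alt by apply Rle_0_sqr; f_equal; unfold Rsqr; ring.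
Qed.

(** The segment from [a] to [b] is stretched about its midpoint to length [u]; each end moves by
    half the change of length, at most [d]. *)
Lemma DistSet_neighbourhood d E a b u :
  In a E -> In b E -> 0 < dist2 a b -> 0 <= u -> Rabs (u - dist2 a b) <= 2 * d ->
  DistSet d E u.
Proof.
  intros Ha Hb Ht Hu Hd.
  set (t := dist2 a b) in *.
  set (f := u / t).
  assert (Hf : 0 <= f) by (apply Rmult_le_pos; [assumption|left; apply Rinv_0_lt_compat; assumption]).
  assert (Hg : Rabs ((f - 1) / 2) * t <= d).
  { rewrite <- (Rabs_pos_eq t) by lra; rewrite <- Rabs_mult.
    replace ((f - 1) / 2 * t) with ((u - t) * / 2) by (unfold f; field; lra).
    rewrite Rabs_mult, (Rabs_pos_eq (/ 2)) by lra; lra. }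
  exists (fst a + (f - 1) / 2 * (fst a - fst b), snd a + (f - 1) / 2 * (snd a - snd b)).
  exists (fst b - (f - 1) / 2 * (fst a - fst b), snd b - (f - 1) / 2 * (snd a - snd b)).
  repeat split.
  - exists a; split; [assumption|]; unfold in_ball; rewrite dist2_shift; exact Hg.
  - exists b; split; [assumption|]; unfold in_ball.
    replace (fst b - (f - 1) / 2 * (fst a - fst b)) with (fst b + - ((f - 1) / 2) * (fst a - fst b)) by ring.
    replace (snd b - (f - 1) / 2 * (snd a - snd b)) with (snd b + - ((f - 1) / 2) * (snd a - snd b)) by ring.
    rewrite dist2_shift, Rabs_Ropp; exact Hg.
  - rewrite dist2_scale by assumption; fold t; unfold f; field; lra.
Qed.

(** Every point in the lower half of a bin is within [2 d] of the distance realised in that bin, and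
    lower halves of distinct bins are separated. *)
Lemma bins_to_intervals d E (Sx : list Z) :
  0 < d -> NoDup Sx ->
  (forall k, In k Sx -> exists a b, In a E /\ In b E /\ 0 < dist2 a b /\ dkey d (a, b) = k) ->
  disjoint_intervals_in (DistSet d E) d (map (fun k => 2 * d * IZR k) Sx).
Proof.
  intros Hd ND HS; repeat split.
  - apply Injective_map_NoDup; [|assumption].
    intros x y Exy; apply eq_IZR; apply Rmult_eq_reg_l with (2 * d); lra.
  - intros x Hx u [U1 U2]; apply in_map_iff in Hx; destruct Hx as [k [<- Hk]].
    destruct (HS k Hk) as (a & b & Ha & Hb & Ht & Ek).
    unfold dkey in Ek; cbn [fst snd] in Ek.
    pose proof (floor_bounds (dist2 a b / (2 * d))) as Fb; rewrite Ek in Fb.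
    assert (E1 : dist2 a b / (2 * d) * (2 * d) = dist2 a b) by (field; lra).
    assert (P0 : 0 < dist2 a b / (2 * d)) by (apply Rdiv_lt_0_compat; lra).
    assert (Hk0 : 0 <= IZR k).
    { apply IZR_le; assert (-1 < k)%Z by (apply lt_IZR; lra); lia. }
    apply (DistSet_neighbourhood d E a b); try assumption.
    + nra.
    + set (y := dist2 a b / (2 * d)) in *; rewrite <- E1; apply Rabs_le; split; nra.
  - intros x y Hx Hy Nxy u [U1 U2] [V1 V2].
    apply in_map_iff in Hx; destruct Hx as [k [<- Hk]].
    apply in_map_iff in Hy; destruct Hy as [l [<- Hl]].
    assert (Nkl : k <> l) by congruence.
    assert (IZR k + 1 <= IZR l \/ IZR l + 1 <= IZR k) as [Hc|Hc].
    { rewrite <- !plus_IZR; destruct (Z_lt_le_dec k l); [left|right]; apply IZR_le; lia. }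
    + nra.
    + nra.
Qed.

(** Distances from the centre of a single ball already fill [[0, d]]; this serves for [delta]
    bounded away from 0. *)
Lemma DistSet_trivial_interval d E : 0 < d -> E <> [] ->
  disjoint_intervals_in (DistSet d E) d [0].
Proof.
  intros Hd HE; destruct E as [|c E]; [tauto|].
  repeat split.
  - constructor; [simpl; tauto|constructor].
  - intros x [<-|[]] u [U1 U2].
    exists c, (fst c + u * 1, snd c + u * 0); repeat split.
    + exists c; split; [left; reflexivity|].
      unfold in_ball, dist2; rewrite !Rminus_diag_eq by reflexivity.
      replace (0 ^ 2 + 0 ^ 2) with 0 by ring; rewrite sqrt_0; lra.
    + exists c; split; [left; reflexivity|].
      unfold in_ball; rewrite dist2_shift.
      replace (1 ^ 2 + 0 ^ 2) with 1 by ring; rewrite sqrt_1, Rabs_pos_eq; lra.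
    + unfold dist2; cbn [fst snd].
      replace ((fst c - (fst c + u * 1)) ^ 2 + (snd c - (snd c + u * 0)) ^ 2) with (u ^ 2) by ring.
      symmetry; apply sqrt_pow2; assumption.
  - intros x y [<-|[]] [<-|[]] N; tauto.
Qed.

(** * Choice of the parameters *)

Lemma Rpower_antitone (d x y : R) : 0 < d < 1 -> x <= y -> Rpower d y <= Rpower d x.
Proof.
  intros [H0 H1] Hxy; unfold Rpower; destruct (Req_dec x y) as [->|N]; [lra|].
  left; apply exp_increasing.
  assert (ln d < 0) by (rewrite <- ln_1; apply ln_increasing; lra); nra.
Qed.

Lemma pow_le_reg (a b : R) (n : nat) : 0 <= a -> 0 <= b -> (0 < n)%nat -> a ^ n <= b ^ n -> a <= b.
Proof.
  intros Ha Hb Hn H; apply Rnot_lt_le; intro Hl.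
  assert (b ^ n < a ^ n); [|lra].
  clear H; induction n as [|n IH]; [lia|].
  destruct n as [|n]; [simpl; lra|].
  specialize (IH ltac:(lia)); simpl in *.
  apply Rmult_le_0_lt_compat; try lra.
  assert (0 <= b * b ^ n) by (apply Rmult_le_pos; [lra|apply pow_le; lra]); lra.
Qed.

Theorem theorem5p1 :
  forall (s eps : R), 1 < s < 2 -> 0 < eps ->
  forall (C : R),
  exists c : R, 0 < c /\
    forall (delta : R) (E : list pt),
      0 < delta < 1 ->
      NoDup E ->
      (forall p, In p E -> 0 <= fst p <= 1 /\ 0 <= snd p <= 1) ->
      Rpower delta (- s) <= INR (length E) ->
      ball_count_le delta (Rpower delta (s / 2)) C E ->
      exists I : list R,
        disjoint_intervals_in (DistSet delta E) delta I /\
        c * Rpower delta (-1 + eps) <= INR (length I).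
Proof.
  intros s eps Hs Heps C.
  set (C1 := Rmax C 1).
  assert (HC1 : 1 <= C1) by apply Rmax_r.
  destruct (nat_between (392 * C1)) as [k0 [Hk0 _]]; [lra|].
  assert (Hk1 : (1 <= k0)%nat) by (apply INR_le; simpl; lra).
  (* The final loss is [delta^(-(9 J + 3) / J^2)] and [9 J + 3 <= 12 J], so [J >= 12 / eps]
     suffices; [k0] is added to ensure [k0 <= J]. *)
  destruct (nat_between (12 / eps)) as [j [Hj _]]; [left; apply Rdiv_lt_0_compat; lra|].
  set (J := (k0 + j)%nat).
  assert (HJ1 : (1 <= J)%nat) by (unfold J; lia).
  assert (HJr : 1 <= INR J) by (change 1 with (INR 1); apply le_INR; assumption).
  assert (HJe : 12 <= eps * INR J).
  { assert (12 / eps <= INR J) by (apply Rle_trans with (INR j); [lra|apply le_INR; unfold J; lia]).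
    apply Rmult_le_compat_l with (r := eps) in H; [|lra].
    replace (eps * (12 / eps)) with 12 in H by (field; lra); lra. }
  set (Cs := step_const (C1 ^ 2) (2 * INR (2 * J) + 4) (11 * (J * J) + 2)).
  set (c0 := / (2 ^ 37 * INR (k0 + 3) ^ 8 * (2 * Cs) ^ (2 * J + 1))).
  assert (Hc0 : 0 < c0).
  { apply Rinv_0_lt_compat; apply Rmult_lt_0_compat; [apply Rmult_lt_0_compat|].
    - apply pow_lt; lra.
    - apply pow_lt, lt_0_INR; lia.
    - apply pow_lt.
      pose proof (step_const_ge (C1 ^ 2) (2 * INR (2 * J) + 4) (11 * (J * J) + 2)
        ltac:(pose proof (pos_INR (2 * J)); lra)) as SC; fold Cs in SC.
      assert (0 < (C1 ^ 2) ^ 2) by (apply pow_lt, pow_lt; lra); lra. }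
  set (b0 := 800 + 8 * INR J + 9).
  set (q0 := 16 * (8 * INR J + 9) ^ (2 * J)).
  set (kap := 1 - s / 2).
  assert (Hkap : 0 < kap) by (unfold kap; lra).
  assert (Hb0 : 0 < b0 ^ (J * J)) by (apply pow_lt; unfold b0; lra).
  assert (Hq0 : 0 < q0) by (apply Rmult_lt_0_compat; [lra|apply pow_lt; lra]).
  (* Below [d0] four requirements hold: [B >= b0], [1/d >= q0], [2 d <= r] and [k0 r <= 2]. *)
  set (d0 := Rmin (Rmin (/ b0 ^ (J * J)) (/ q0)) (Rmin (Rpower 2 (- / kap)) (/ INR k0 ^ 2))).
  assert (Hk0r : 0 < INR k0) by (apply lt_0_INR; lia).
  assert (Hd0 : 0 < d0).
  { unfold d0; repeat apply Rmin_glb_lt; try (apply Rinv_0_lt_compat; assumption).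
    - apply exp_pos.
    - apply Rinv_0_lt_compat, pow_lt; assumption. }
  (* For [delta >= d0] one interval is enough: [c <= d0 <= delta] makes the required number at most
     1. *)
  exists (Rmin c0 d0); split; [apply Rmin_glb_lt; assumption|].
  intros d E Hd ND HE HN Hball.
  assert (HnE : E <> []).
  { intros ->; simpl in HN; unfold Rpower in HN; pose proof (exp_pos (- s * ln d)); lra. }
  assert (Hpe : 0 < Rpower d (-1 + eps)) by apply exp_pos.
  assert (Rp1 : Rpower d (-1) = / d).
  { replace (-1) with (- (1)) by ring; rewrite Rpower_Ropp, Rpower_1 by lra; reflexivity. }
  destruct (Rle_lt_dec d0 d) as [Hbig|Hsmall].
  { exists [0]; split; [apply DistSet_trivial_interval; [lra|assumption]|].
    simpl length; change (INR 1) with 1.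
    apply Rle_trans with (d * Rpower d (-1)).
    - apply Rmult_le_compat; [apply Rmin_glb; lra|lra| |].
      + pose proof (Rmin_r c0 d0); lra.
      + apply Rpower_antitone; lra.
    - rewrite Rp1, Rinv_r; lra. }
  assert (Hd1 : d <= / b0 ^ (J * J)).
  { apply Rle_trans with d0; [lra|]; unfold d0; eapply Rle_trans; [apply Rmin_l|apply Rmin_l]. }
  assert (Hd2 : d <= / q0).
  { apply Rle_trans with d0; [lra|]; unfold d0; eapply Rle_trans; [apply Rmin_l|apply Rmin_r]. }
  assert (Hd3 : d <= Rpower 2 (- / kap)).
  { apply Rle_trans with d0; [lra|]; unfold d0; eapply Rle_trans; [apply Rmin_r|apply Rmin_l]. }
  assert (Hd4 : d <= / INR k0 ^ 2).
  { apply Rle_trans with d0; [lra|]; unfold d0; eapply Rle_trans; [apply Rmin_r|apply Rmin_r]. }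
  set (B := Rpower d (- / INR (J * J))).
  assert (HJJ : 0 < INR (J * J)) by (apply lt_0_INR; nia).
  assert (HB0 : 0 < B) by apply exp_pos.
  assert (HBd : B ^ (J * J) = / d).
  { rewrite <- Rpower_pow by assumption; unfold B; rewrite Rpower_mult.
    replace (- / INR (J * J) * INR (J * J)) with (-1) by (field; lra); assumption. }
  assert (HBb : b0 <= B).
  { apply (pow_le_reg b0 B (J * J)); [unfold b0; lra|lra|nia|].
    rewrite HBd, <- (Rinv_inv (b0 ^ (J * J))); apply Rinv_le_contravar; lra. }
  set (r := Rpower d (s / 2)) in *.
  assert (Hr0 : 0 < r) by apply exp_pos.
  assert (Hr2 : r ^ 2 = Rpower d s).
  { replace (r ^ 2) with (r * r) by ring; unfold r; rewrite <- Rpower_plus; f_equal; field. }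
  assert (Hr2d : r ^ 2 <= d).
  { rewrite Hr2; rewrite <- (Rpower_1 d) at 2 by lra; apply Rpower_antitone; lra. }
  (* Here [s < 2] enters: [r / d = d^(-(1 - s/2))] is large for small [d]. *)
  assert (Hdr : 2 * d <= r).
  { assert (Er : r = d * Rpower d (- kap)).
    { rewrite <- (Rpower_1 d) at 1 by lra; rewrite <- Rpower_plus; unfold r, kap; f_equal; field. }
    assert (2 <= Rpower d (- kap)).
    { set (x := Rpower 2 (- / kap)) in *.
      replace 2 with (Rpower x (- kap)).
      - rewrite !Rpower_Ropp; apply Rinv_le_contravar; [apply exp_pos|].
        apply Rle_Rpower_l; lra.
      - unfold x; rewrite Rpower_mult; replace (- / kap * - kap) with 1 by (field; lra); apply Rpower_1; lra. }
    rewrite Er; nra. }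
  assert (Hk0d : INR k0 ^ 2 * d <= 1).
  { apply Rmult_le_compat_l with (r := INR k0 ^ 2) in Hd4; [|apply pow2_ge_0].
    rewrite Rinv_r in Hd4; [assumption|]; apply pow_nonzero; lra. }
  destruct (distance_bins C1 d r B J k0 E) as (Sx & NDS & HSx & Hlen); try assumption; try lra.
  - unfold J; lia.
  - unfold b0 in HBb; lra.
  - unfold b0 in HBb; lra.
  - fold q0; rewrite <- (Rinv_inv q0); apply Rinv_le_contravar; lra.
  - nra.
  - nra.
  - apply (pow_le_reg (INR k0 * r) 2 2); [nra|lra|lia|]; rewrite Rpow_mult_distr.
    apply Rle_trans with (INR k0 ^ 2 * d); [apply Rmult_le_compat_l; [apply pow2_ge_0|assumption]|lra].
  - intros x1 x2; eapply Rle_trans; [apply (ball_count_sq_spaced d r C); assumption|apply Rmax_l].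
  - rewrite Hr2, <- Rpower_Ropp; assumption.
  - exists (map (fun k => 2 * d * IZR k) Sx); split.
    { apply bins_to_intervals; try assumption; lra. }
    rewrite length_map.
    change (c0 <= INR (length Sx) * (d * B ^ (9 * J + 3))) in Hlen.
    assert (HBe : B ^ (9 * J + 3) <= Rpower d (- eps)).
    { rewrite <- Rpower_pow by assumption; unfold B; rewrite Rpower_mult.
      apply Rpower_antitone; [assumption|].
      apply Ropp_le_cancel; rewrite Ropp_involutive.
      replace (- (- / INR (J * J) * INR (9 * J + 3))) with (INR (9 * J + 3) / INR (J * J)) by (field; lra).
      apply Rmult_le_reg_r with (INR (J * J)); [assumption|].
      unfold Rdiv; rewrite Rmult_assoc, Rinv_l by lra.
      rewrite plus_INR, !mult_INR; simpl (INR 9); simpl (INR 3); nra. }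
    set (n := INR (length Sx)) in *.
    assert (Hn : 0 <= n) by apply pos_INR.
    apply Rle_trans with (c0 * Rpower d (-1 + eps)).
    { apply Rmult_le_compat_r; [lra|apply Rmin_l]. }
    assert (Ep : Rpower d (- eps) * Rpower d (-1 + eps) = / d).
    { rewrite <- Rpower_plus, <- Rp1; f_equal; ring. }
    apply Rle_trans with (n * (d * Rpower d (- eps)) * Rpower d (-1 + eps)).
    + apply Rmult_le_compat_r; [lra|]; eapply Rle_trans; [exact Hlen|].
      apply Rmult_le_compat_l; [assumption|]; apply Rmult_le_compat_l; lra.
    + right; replace (n * (d * Rpower d (- eps)) * Rpower d (-1 + eps))
        with (n * d * (Rpower d (- eps) * Rpower d (-1 + eps))) by ring.
      rewrite Ep; field; lra.
Qed.
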